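(* Let $\mathcal{C}$ be a class of algebras which is closed by taking quotients, and assume that Han's conjecture holds for all algebras in $\mathcal{C}$. Let $\Lambda$ be an algebra which admits a $\mathcal{C}$-strongly stratifying $n$-chain for some $n>0$. Then $\Lambda$ verifies Han's conjecture.
   Context: Throughout, ''algebra'' means a finite dimensional associative unital algebra over a fixed field $k$. For an algebra $\Lambda$, $HH_*(\Lambda)=\mathrm{Tor}_*^{\Lambda\otimes_k\Lambda^{\mathrm{op}}}(\Lambda,\Lambda)$ is its Hochschild homology; it is called finite if there is $N$ with $HH_m(\Lambda)=0$ for all $m>N$. An algebra $\Lambda$ verifies Han's conjecture (equivalently, Han's conjecture holds, or is true, for $\Lambda$) if the following implication holds: if $HH_*(\Lambda)$ is finite, then $\Lambda$ has finite global dimension. Let $e\in\Lambda$ be an idempotent and $f=1-e$. The ideal $\Lambda e\Lambda$ is strongly stratifying if: (1) $\mathrm{Tor}_n^{e\Lambda e}(\Lambda e,e\Lambda)=0$ for $n>0$; (2) $f\Lambda e\otimes_{e\Lambda e}e\Lambda f=0$; (3) $\mathrm{Tor}_n^{f\Lambda f}(\Lambda f,f\Lambda)=0$ for $n>0$. A strongly stratifying $n$-chain of $\Lambda$ is an ordered complete system of orthogonal idempotents $\{e_1,\dots,e_n\}$ of $\Lambda$ (pairwise orthogonal idempotents with sum $1$, not necessarily primitive) such that the filtration by ideals $0\subset\Lambda e_1\Lambda\subset\Lambda(e_1+e_2)\Lambda\subset\cdots\subset\Lambda(e_1+\dots+e_{n-1})\Lambda\subset\Lambda$ verifies that, for $1\le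 i\le n$, the quotient $\Lambda(e_1+\dots+e_i)\Lambda/\Lambda(e_1+\dots+e_{i-1})\Lambda$ is a strongly stratifying ideal of $\Lambda_{i-1}:=\Lambda/\Lambda(e_1+\dots+e_{i-1})\Lambda$ (with $\Lambda_0=\Lambda$); this quotient equals $\Lambda_{i-1}\overline{e_i}\Lambda_{i-1}$, where $\overline{e_i}$ is the class of $e_i$, and strongly stratifying is meant with respect to the idempotent $\overline{e_i}$. For a class of algebras $\mathcal{C}$, a $\mathcal{C}$-strongly stratifying $n$-chain of $\Lambda$ is a strongly stratifying $n$-chain $\{e_1,\dots,e_n\}$ such that $e_i\Lambda e_i$ belongs to $\mathcal{C}$ for $1\le i\le n$. Closed by taking quotients means that quotients of algebras in $\mathcal{C}$ by two-sided ideals are in $\mathcal{C}$. *)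

(* Defs.v *)
From HB Require Import structures.
From mathcomp Require Import all_boot all_order all_algebra.
From mathcomp Require Import boolp.
From mathcomp Require Import freeg.

Set Implicit Arguments.
Unset Strict Implicit.
Unset Printing Implicit Defensive.

Import GRing.Theory.
Local Open Scope ring_scope.
Local Open Scope quotient_scope.

Section Resolutions.
Variable R : pzRingType.

Definition projective (P : lmodType R) : Prop :=
  forall (X Y : lmodType R) (g : {linear X -> Y}) (f : {linear P -> Y}),
    (forall y, exists x, g x = y) ->
    exists h : {linear P -> X}, forall p, g (h p) = f p.

Record proj_resolution (M : lmodType R) := ProjResolution {
  res_obj :> nat -> lmodType R;
  res_d : forall n, {linear res_obj n.+1 -> res_obj n};
  res_aug : {linear res_obj 0 -> M};
  res_projective : forall n, projective (res_obj n);
  res_aug_surj : forall m, exists x, res_aug x = m;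
  res_exact0 : forall x, res_aug x = 0 <-> exists y, res_d 0 y = x;
  res_exactS : forall n x, res_d n x = 0 <-> exists y, res_d n.+1 y = x
}.

(* Left modules suffice: for a finite dimensional algebra the left and right
   global dimensions agree. *)
Definition gldim_finite : Prop :=
  exists d : nat, forall M : lmodType R, exists P : proj_resolution M,
    forall n, (d < n)%N -> forall x : P n, x = 0.

End Resolutions.

Section Tensor.
Variable R : pzRingType.

(* Right R-modules are left modules over the converse ring R^c. *)
Section TensorObject.
Variables (M : lmodType R^c) (N : lmodType R).

Local Notation F := {freeg (M * N)%type / int}.

Inductive tensor_relation : F -> Prop :=
| TRel0 : tensor_relation 0
| TRelB x y : tensor_relation x -> tensor_relation y -> tensor_relation (x - y)
| TRelDl m m' n :
    tensor_relation (<< (m + m', n) >> - << (m, n) >> - << (m', n) >>)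
| TRelDr m n n' :
    tensor_relation (<< (m, n + n') >> - << (m, n) >> - << (m, n') >>)
| TRelA m (r : R) n :
    tensor_relation (<< ((r : R^c) *: m, n) >> - << (m, r *: n) >>).

Definition tensor_rel : {pred F} := fun x => `[< tensor_relation x >].

Fact tensor_rel_closed : zmod_closed tensor_rel.
Proof.
split; first by apply/asboolP; constructor.
by move=> x y /asboolP hx /asboolP hy; apply/asboolP; constructor.
Qed.

HB.instance Definition _ := GRing.isZmodClosed.Build F tensor_rel tensor_rel_closed.

Definition tensor : Type := Quotient.quot tensor_rel.
HB.instance Definition _ := GRing.Zmodule.on tensor.

Definition tensor_pi (x : F) : tensor := \pi_(Quotient.quot tensor_rel) x.

Definition tensor_pure (m : M) (n : N) : tensor := tensor_pi << (m, n) >>.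

Lemma tensor_piP x y : tensor_pi x = tensor_pi y <-> tensor_relation (x - y).
Proof.
split=> [h|h]; first by apply/asboolP; rewrite -[`[< _ >]]/(x - y \in tensor_rel)
  Quotient.idealrBE; apply/eqP.
by apply/eqP; rewrite -[_ == _]Quotient.idealrBE; apply/asboolP.
Qed.

Lemma tensor_repr (t : tensor) : tensor_pi (repr t) = t.
Proof. exact: (@reprK _ (Quotient.quot tensor_rel)). Qed.

Fact tensor_pi_is_additive : zmod_morphism tensor_pi.
Proof. exact: (raddfB (\pi_(Quotient.quot tensor_rel))). Qed.
HB.instance Definition _ :=
  GRing.isZmodMorphism.Build F tensor tensor_pi tensor_pi_is_additive.

End TensorObject.

Section TensorMap.
Variables (M M' : lmodType R^c) (N : lmodType R) (f : {linear M -> M'}).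

Definition tensor_map_pre (x : {freeg (M * N)%type / int}) :
    {freeg (M' * N)%type / int} :=
  fglift (fun mn => << (f mn.1, mn.2) >>) x.

Definition tensor_map (t : tensor M N) : tensor M' N :=
  tensor_pi (tensor_map_pre (repr t)).

Fact tensor_map_pre_additive : zmod_morphism tensor_map_pre.
Proof. exact: lift_is_additive. Qed.
HB.instance Definition _ := GRing.isZmodMorphism.Build _ _ tensor_map_pre
  tensor_map_pre_additive.

Lemma tensor_map_preU m n : tensor_map_pre << (m, n) >> = << (f m, n) >>.
Proof. by rewrite /tensor_map_pre liftU scale1r. Qed.

Lemma tensor_map_pre_rel x : tensor_relation x -> tensor_relation (tensor_map_pre x).
Proof.
elim=> [|{}x y _ hx _ hy|m m' n|m n n'|m r n].
- by rewrite raddf0; exact: TRel0.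
- by rewrite raddfB; exact: TRelB.
- by rewrite !raddfB /= !tensor_map_preU linearD; exact: TRelDl.
- by rewrite !raddfB /= !tensor_map_preU; exact: TRelDr.
- rewrite tensor_map_pre_additive !tensor_map_preU linearZ_LR; exact: TRelA.
Qed.

Lemma tensor_map_pi x : tensor_map (tensor_pi x) = tensor_pi (tensor_map_pre x).
Proof.
by apply/tensor_piP; rewrite -raddfB; apply/tensor_map_pre_rel/tensor_piP/tensor_repr.
Qed.

Fact tensor_map_additive : zmod_morphism tensor_map.
Proof.
move=> s t; rewrite -[s]tensor_repr -[t]tensor_repr -raddfB !tensor_map_pi.
by rewrite !raddfB.
Qed.
HB.instance Definition _ := GRing.isZmodMorphism.Build _ _ tensor_map
  tensor_map_additive.

Lemma tensor_mapE m n : tensor_map (tensor_pure m n) = tensor_pure (f m) n.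
Proof. by rewrite tensor_map_pi tensor_map_preU. Qed.

End TensorMap.

(* The cycles of P (x)_R N in degree n; degree 0 maps to 0. *)
Definition tensor_cycle (M : lmodType R^c) (P : proj_resolution M) (N : lmodType R)
    (n : nat) : tensor (P n) N -> Prop :=
  match n with
  | 0 => fun _ => True
  | m.+1 => fun z => tensor_map (res_d P m) z = 0
  end.

(* Tor_n^R(M, N) = 0: for a projective resolution P of the right module M, the
   complex P (x)_R N has no homology in degree n. *)
Definition tor_zero (M : lmodType R^c) (N : lmodType R) (n : nat) : Prop :=
  exists P : proj_resolution M, forall z : tensor (P n) N,
    tensor_cycle z -> exists w : tensor (P n.+1) N, tensor_map (res_d P n) w = z.

End Tensor.

(* falgType requires 1 != 0.  The zero algebra has to be allowed here: it is
   the quotient by the unit ideal, and the corner at the idempotent 0. *)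
HB.mixin Record Vector_isAlg (k : fieldType) A of Vector k A := {
  alg_one : A;
  alg_mul : A -> A -> A;
  alg_mulA : associative alg_mul;
  alg_mul1l : left_id alg_one alg_mul;
  alg_mul1r : right_id alg_one alg_mul;
  alg_mull : forall y, linear (alg_mul^~ y);
  alg_mulr : forall x, linear (alg_mul x)
}.

#[short(type="fdAlgType")]
HB.structure Definition FdAlg (k : fieldType) :=
  {A of Vector k A & Vector_isAlg k A}.

Section AlgRing.
Variables (k : fieldType) (A : fdAlgType k).

Fact alg_mulDl : @left_distributive A A alg_mul +%R.
Proof. by move=> x y z; have := @alg_mull k A z 1 x y; rewrite !scale1r. Qed.

Fact alg_mulDr : @right_distributive A A alg_mul +%R.
Proof. by move=> x y z; have := @alg_mulr k A x 1 y z; rewrite !scale1r. Qed.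

#[non_forgetful_inheritance]
HB.instance Definition _ := GRing.Zmodule_isPzRing.Build (FdAlg.sort A)
  alg_mulA alg_mul1l alg_mul1r alg_mulDl alg_mulDr.

Lemma algZl (a : k) (x y : A) : (a *: x) * y = a *: (x * y).
Proof.
by have := @alg_mull k A y a x 0; rewrite addr0 [X in _ + X](mul0r y) addr0.
Qed.

Lemma algZr (a : k) (x y : A) : x * (a *: y) = a *: (x * y).
Proof.
by have := @alg_mulr k A x a y 0; rewrite addr0 [X in _ + X](mulr0 x) addr0.
Qed.

End AlgRing.

Section Quotients.
Variables (k : fieldType) (A : fdAlgType k).

Record ideal := Ideal {
  ideal_space :> {vspace A};
  idealMl : forall x y : A, y \in ideal_space -> x * y \in ideal_space;
  idealMr : forall x y : A, x \in ideal_space -> x * y \in ideal_space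
}.

Section Quo.
Variable I : ideal.

Definition quo_type : Type := Quotient.quot (ideal_space I).
HB.instance Definition _ := GRing.Zmodule.on quo_type.
HB.instance Definition _ : EqQuotient A (Quotient.equiv (ideal_space I)) quo_type
  := EqQuotient.on quo_type.

Definition quo_pi (x : A) : quo_type := \pi_quo_type x.

Lemma quo_piP x y : quo_pi x = quo_pi y <-> x - y \in ideal_space I.
Proof.
split=> [h|h]; first by rewrite Quotient.idealrBE; apply/eqP.
by apply/eqP; rewrite -[_ == _]Quotient.idealrBE.
Qed.

Lemma quo_repr (u : quo_type) : quo_pi (repr u) = u.
Proof. exact: reprK. Qed.

Lemma quo_piB : {morph quo_pi : x y / x - y}.
Proof. exact: (raddfB (\pi_(Quotient.quot (ideal_space I)))). Qed.
Lemma quo_piD : {morph quo_pi : x y / x + y}.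
Proof. exact: (raddfD (\pi_(Quotient.quot (ideal_space I)))). Qed.

Definition quo_scale (a : k) (u : quo_type) : quo_type := quo_pi (a *: repr u).
Definition quo_one : quo_type := quo_pi 1.
Definition quo_mul (u v : quo_type) : quo_type := quo_pi (repr u * repr v).

Lemma quo_scaleE a x : quo_scale a (quo_pi x) = quo_pi (a *: x).
Proof. by apply/quo_piP; rewrite -scalerBr memvZ //; apply/quo_piP/quo_repr. Qed.

Lemma quo_mulE x y : quo_mul (quo_pi x) (quo_pi y) = quo_pi (x * y).
Proof.
apply/quo_piP; set x' := repr _; set y' := repr _.
have -> : x' * y' - x * y = x' * (y' - y) + (x' - x) * y.
  by rewrite mulrBr mulrBl addrA subrK.
by apply: memvD; [apply: idealMl | apply: idealMr]; apply/quo_piP/quo_repr.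
Qed.

Ltac quo_elim u := rewrite -[u]quo_repr; move: (repr u) => {}u.

Fact quo_scaleA a b u : quo_scale a (quo_scale b u) = quo_scale (a * b) u.
Proof. by quo_elim u; rewrite !quo_scaleE scalerA. Qed.
Fact quo_scale1 : left_id 1 quo_scale.
Proof. by move=> u; quo_elim u; rewrite quo_scaleE scale1r. Qed.
Fact quo_scaleDr : right_distributive quo_scale +%R.
Proof.
by move=> a u v; quo_elim u; quo_elim v; rewrite !(quo_scaleE, =^~ quo_piD) scalerDr.
Qed.
Fact quo_scaleDl u : {morph quo_scale^~ u : a b / a + b}.
Proof. by move=> a b; quo_elim u; rewrite !quo_scaleE -quo_piD scalerDl. Qed.

HB.instance Definition _ := GRing.Zmodule_isLmodule.Build k quo_type
  quo_scaleA quo_scale1 quo_scaleDr quo_scaleDl.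

Lemma quo_piZ a x : quo_pi (a *: x) = a *: quo_pi x.
Proof. by rewrite -quo_scaleE. Qed.

Fact quo_vect_iso : Vector.axiom (\dim (ideal_space I)^C) quo_type.
Proof.
pose U := (ideal_space I)^C%VS.
pose g (v : subvs_of U) : quo_type := quo_pi (vsval v).
pose f (u : quo_type) : subvs_of U := vsproj U (repr u - projv I (repr u)).
have fP x : vsval (f (quo_pi x)) = x - projv I x.
  have hU z : z - projv I z \in U by exact: memv_projC.
  rewrite vsprojK //.
  have: repr (quo_pi x) - x \in ideal_space I by apply/quo_piP/quo_repr.
  move/projv_id; rewrite linearB /= => /(canRL (subrK _)) ->.
  by rewrite opprD opprB addrA [_ + (x - _)]addrCA subrr addr0.
have f_lin : linear f.
  move=> a u v; quo_elim u; quo_elim v; apply: val_inj.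
  rewrite -quo_piZ -quo_piD -[LHS]/(vsval _) -[RHS]/(vsval _) linearP /= !fP linearP /=.
  by rewrite scalerBr opprD addrACA.
have fK : cancel f g.
  move=> u; quo_elim u; rewrite /g fP; apply/quo_piP.
  by rewrite addrAC subrr add0r memvN memv_proj.
have gK : cancel g f.
  move=> v; apply: val_inj; rewrite -[LHS]/(vsval _) -[RHS]/(vsval _) /g fP.
  rewrite -[RHS]subr0; congr (_ - _); apply/eqP.
  rewrite -memv0 -(capv_compl I) memv_cap memv_proj.
  rewrite -[X in X \in _](subrK (vsval v)) -opprB memvD ?memvN ?subvsP //.
  exact: memv_projC.
have [v2r v2r_lin v2r_bij] := (subvs_vect_iso U).
exists (v2r \o f) => [a u v /=|]; first by rewrite f_lin v2r_lin.
by apply: bij_comp => //; exists g.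
Qed.

HB.instance Definition _ := Lmodule_hasFinDim.Build k quo_type quo_vect_iso.

Fact quo_mulA : associative quo_mul.
Proof. by move=> u v w; quo_elim u; quo_elim v; quo_elim w; rewrite !quo_mulE mulrA. Qed.
Fact quo_mul1l : left_id quo_one quo_mul.
Proof. by move=> u; quo_elim u; rewrite quo_mulE mul1r. Qed.
Fact quo_mul1r : right_id quo_one quo_mul.
Proof. by move=> u; quo_elim u; rewrite quo_mulE mulr1. Qed.
Fact quo_mull v : linear (quo_mul^~ v).
Proof.
move=> a u w; quo_elim u; quo_elim v; quo_elim w.
by rewrite -quo_piZ -quo_piD !quo_mulE mulrDl algZl quo_piD quo_piZ.
Qed.
Fact quo_mulr v : linear (quo_mul v).
Proof.
move=> a u w; quo_elim u; quo_elim v; quo_elim w.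
by rewrite -quo_piZ -quo_piD !quo_mulE mulrDr algZr quo_piD quo_piZ.
Qed.

HB.instance Definition _ := Vector_isAlg.Build k quo_type
  quo_mulA quo_mul1l quo_mul1r quo_mull quo_mulr.

Definition quo : fdAlgType k := quo_type.

End Quo.

(* By bilinearity this is the span of all the x * s * y, that is A s A. *)
Definition gen_space (s : A) : {vspace A} :=
  <<[seq x * s * y | x <- vbasis {:A}, y <- vbasis {:A}]>>%VS.

Lemma mem_gen_space s x y : x * s * y \in gen_space s.
Proof.
rewrite (coord_vbasis (memvf x)) (coord_vbasis (memvf y)).
rewrite !mulr_suml; apply: memv_suml => i _; rewrite mulr_sumr.
apply: memv_suml => j _; rewrite !algZl algZr !memvZ // memv_span //.
by apply/allpairsP; exists ((vbasis {:A})`_i, (vbasis {:A})`_j); split=> //=;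
  apply: mem_nth; rewrite size_tuple.
Qed.

Lemma gen_space_ind s (U : {vspace A}) :
  (forall x y, x * s * y \in U) -> (gen_space s <= U)%VS.
Proof. by move=> h; apply/span_subvP => z /allpairsP[[x y] [_ _ ->]]. Qed.

Fact gen_spaceMl s x y : y \in gen_space s -> x * y \in gen_space s.
Proof.
have hl : linear (fun y : A => x * y) by move=> a u v; rewrite mulrDr algZr.
pose f : {linear A -> A} := HB.pack (fun y : A => x * y) (GRing.isLinear.Build _ _ _ _ _ hl).
move=> hy; suff : y \in (linfun f @^-1: gen_space s)%VS by rewrite -memv_preim lfunE.
apply: subvP hy; apply: gen_space_ind => u v.
by rewrite -memv_preim lfunE /= !mulrA mem_gen_space.
Qed.

Fact gen_spaceMr s x y : x \in gen_space s -> x * y \in gen_space s.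
Proof.
have hl : linear (fun x : A => x * y) by move=> a u v; rewrite mulrDl algZl.
pose f : {linear A -> A} := HB.pack (fun x : A => x * y) (GRing.isLinear.Build _ _ _ _ _ hl).
move=> hx; suff : x \in (linfun f @^-1: gen_space s)%VS by rewrite -memv_preim lfunE.
apply: subvP hx; apply: gen_space_ind => u v.
by rewrite -memv_preim lfunE /= -!mulrA mulrA mem_gen_space.
Qed.

Definition gen_ideal (s : A) : ideal :=
  Ideal (@gen_spaceMl s) (@gen_spaceMr s).

End Quotients.

Section Idempotents.
Variables (k : fieldType) (A : fdAlgType k).

Record idem := Idem { idem_val :> A; idemP : idem_val * idem_val = idem_val }.

Definition idem1 : idem := Idem (mulr1 1).

Fact idem_compl_subproof (e : idem) : (1 - idem_val e) * (1 - idem_val e) = 1 - idem_val e.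
Proof. by rewrite mulrBl mul1r mulrBr mulr1 idemP subrr subr0. Qed.
Definition idem_compl (e : idem) : idem := Idem (idem_compl_subproof e).

Section Peirce.
Variables a b : idem.

Definition peirce_proj (x : A) : A := idem_val a * x * idem_val b.

Fact peirce_lin : linear peirce_proj.
Proof. by move=> c u v; rewrite /peirce_proj mulrDr algZr mulrDl algZl. Qed.
HB.instance Definition _ := GRing.isLinear.Build k A A _ peirce_proj peirce_lin.

Definition peirce : {vspace A} := limg (linfun peirce_proj).

Lemma peirceP x : reflect (idem_val a * x * idem_val b = x) (x \in peirce).
Proof.
apply: (iffP idP) => [/memv_imgP[y _ ->]|<-].
  by rewrite lfunE /= /peirce_proj !mulrA idemP -!mulrA idemP.
by apply/memv_imgP; exists x; rewrite ?memvf // lfunE.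
Qed.

Lemma peirce_l (x : subvs_of peirce) : idem_val a * vsval x = vsval x.
Proof.
by case: x => x /= /peirceP hx; rewrite -hx !mulrA idemP.
Qed.

Lemma peirce_r (x : subvs_of peirce) : vsval x * idem_val b = vsval x.
Proof.
by case: x => x /= /peirceP hx; rewrite -hx -!mulrA idemP.
Qed.

End Peirce.

Lemma peirceM (a b c : idem) (x : subvs_of (peirce a b)) (y : subvs_of (peirce b c)) :
  vsval x * vsval y \in peirce a c.
Proof. by apply/peirceP; rewrite mulrA peirce_l -mulrA peirce_r. Qed.

(* vsproj only serves as a retraction: by peirceM the product already lies in
   a A c. *)
Definition peirce_mul (a b c : idem)
    (x : subvs_of (peirce a b)) (y : subvs_of (peirce b c)) : subvs_of (peirce a c) :=
  vsproj (peirce a c) (vsval x * vsval y).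

Lemma peirce_mulE a b c x y :
  vsval (@peirce_mul a b c x y) = vsval x * vsval y.
Proof. exact/vsprojK/peirceM. Qed.

Lemma peirce_mulA a b c d x y z :
  @peirce_mul a b d x (@peirce_mul b c d y z) = peirce_mul (peirce_mul x y) z.
Proof. by apply: val_inj; rewrite /= !peirce_mulE mulrA. Qed.

Lemma peirce_mull a b c y : linear (@peirce_mul a b c ^~ y).
Proof.
move=> t u v; apply: val_inj.
by rewrite [RHS]linearP /= !peirce_mulE linearP /= mulrDl algZl.
Qed.

Lemma peirce_mulr a b c x : linear (@peirce_mul a b c x).
Proof.
move=> t u v; apply: val_inj.
by rewrite [RHS]linearP /= !peirce_mulE linearP /= mulrDr algZr.
Qed.

Section Corner.
Variable e : idem.

Definition corner_type : Type := subvs_of (peirce e e).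
HB.instance Definition _ := Vector.on corner_type.

Fact mem_corner1 : idem_val e \in peirce e e.
Proof. by apply/peirceP; rewrite !idemP. Qed.

Definition corner_one : corner_type := Subvs mem_corner1.

Fact corner_mul1l b : left_id corner_one (@peirce_mul e e b).
Proof. by move=> x; apply: val_inj; rewrite /= peirce_mulE /= peirce_l. Qed.

Fact corner_mul1r b : @right_id _ corner_type corner_one (@peirce_mul b e e).
Proof. by move=> x; apply: val_inj; rewrite /= peirce_mulE /= peirce_r. Qed.

HB.instance Definition _ := Vector_isAlg.Build k corner_type
  (@peirce_mulA e e e e) (@corner_mul1l e) (@corner_mul1r e)
  (@peirce_mull e e e) (@peirce_mulr e e e).

Definition corner : fdAlgType k := corner_type.

End Corner.

Section Modules.
Variables a b : idem.

(* a A b as a left a A a-module. *)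
Definition lpeirce : Type := subvs_of (peirce a b).
HB.instance Definition _ := GRing.Zmodule.on lpeirce.

Definition lpeirce_scale (x : corner a) (y : lpeirce) : lpeirce := peirce_mul x y.

Fact lpeirce_scaleA x y z :
  lpeirce_scale x (lpeirce_scale y z) = lpeirce_scale (x * y) z.
Proof. exact: peirce_mulA. Qed.
Fact lpeirce_scale1 : left_id 1 lpeirce_scale.
Proof. exact: corner_mul1l. Qed.
Fact lpeirce_scaleDr : right_distributive lpeirce_scale +%R.
Proof.
by move=> x y z; have := @peirce_mulr a a b x 1 y z; rewrite !scale1r.
Qed.
Fact lpeirce_scaleDl z : {morph lpeirce_scale^~ z : x y / x + y}.
Proof.
by move=> x y; have := @peirce_mull a a b z 1 x y; rewrite !scale1r.
Qed.

HB.instance Definition _ := GRing.Zmodule_isLmodule.Build (corner a) lpeirce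
  lpeirce_scaleA lpeirce_scale1 lpeirce_scaleDr lpeirce_scaleDl.

(* a A b as a right b A b-module. *)
Definition rpeirce : Type := subvs_of (peirce a b).
HB.instance Definition _ := GRing.Zmodule.on rpeirce.

Definition rpeirce_scale (x : (corner b)^c) (y : rpeirce) : rpeirce :=
  peirce_mul y (x : corner b).

Fact rpeirce_scaleA x y z :
  rpeirce_scale x (rpeirce_scale y z) = rpeirce_scale (x * y) z.
Proof. by symmetry; exact: peirce_mulA. Qed.
Fact rpeirce_scale1 : left_id 1 rpeirce_scale.
Proof. exact: corner_mul1r. Qed.
Fact rpeirce_scaleDr : right_distributive rpeirce_scale +%R.
Proof.
by move=> x y z; have := @peirce_mull a b b x 1 y z; rewrite !scale1r.
Qed.
Fact rpeirce_scaleDl z : {morph rpeirce_scale^~ z : x y / x + y}.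
Proof.
by move=> x y; have := @peirce_mulr a b b z 1 x y; rewrite !scale1r.
Qed.

HB.instance Definition _ := GRing.Zmodule_isLmodule.Build (corner b)^c rpeirce
  rpeirce_scaleA rpeirce_scale1 rpeirce_scaleDr rpeirce_scaleDl.

End Modules.
End Idempotents.

Section IdemClass.
Variables (k : fieldType) (A : fdAlgType k) (I : ideal A) (e : idem A).

Fact idem_class_subproof : (quo_pi I e : quo I) * quo_pi I e = quo_pi I e.
Proof. by rewrite [LHS](quo_mulE I e e) idemP. Qed.
Definition idem_class : idem (quo I) := Idem idem_class_subproof.

End IdemClass.

Section Enveloping.
Variables (k : fieldType) (A : fdAlgType k).
Local Notation d := (\dim {:A}).
Local Notation b i := ((vbasis {:A})`_i).
Local Notation crd := (coord (vbasis {:A})).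

(* A (x)_k A^op, identified with square matrices: E stands for
   \sum_(i, j) E i j *: (b_i (x) b_j), where b is the basis vbasis {:A}. *)
Definition env : Type := 'M[k]_d.
HB.instance Definition _ := Vector.on env.

Definition env_pure (x y : A) : env := \matrix_(i, j) (crd i x * crd j y).

Definition env_lift (V : lmodType k) (phi : A -> A -> V) (E : env) : V :=
  \sum_i \sum_j (E : 'M_d) i j *: phi (b i) (b j).

(* The product (x (x) y) (z (x) w) = xz (x) wy. *)
Definition env_mul (E F : env) : env :=
  env_lift (fun x y => env_lift (fun z w => env_pure (x * z) (w * y)) F) E.

Definition env_one : env := env_pure 1 1.

Section Lift.
Variables (V : lmodType k) (phi : A -> A -> V).

Fact env_lift_lin : linear (env_lift phi).
Proof.
move=> a E F; rewrite /env_lift scaler_sumr -big_split; apply: eq_bigr => i _ /=.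
rewrite scaler_sumr -big_split; apply: eq_bigr => j _ /=.
by rewrite !mxE scalerDl scalerA.
Qed.
HB.instance Definition _ := GRing.isLinear.Build k env V _ (env_lift phi) env_lift_lin.

Hypothesis phil : forall y, linear (phi^~ y).
Hypothesis phir : forall x, linear (phi x).

Lemma env_lift_pure x y : env_lift phi (env_pure x y) = phi x y.
Proof.
pose fl z : {linear A -> V} := HB.pack (phi^~ z) (GRing.isLinear.Build _ _ _ _ _ (phil z)).
pose fr z : {linear A -> V} := HB.pack (phi z) (GRing.isLinear.Build _ _ _ _ _ (phir z)).
rewrite [in RHS](coord_vbasis (memvf x)) -[RHS]/(fl y _) linear_sum.
apply: eq_bigr => i _; rewrite linearZ /=.
rewrite [in RHS](coord_vbasis (memvf y)) -[X in _ *: X]/(fr _ _) linear_sum scaler_sumr.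
by apply: eq_bigr => j _; rewrite linearZ /= scalerA mxE.
Qed.

End Lift.

Lemma env_pure_l y : linear (env_pure^~ y).
Proof. by move=> a u v; apply/matrixP => i j; rewrite !mxE linearP /= mulrDl mulrA. Qed.

Lemma env_pure_r x : linear (env_pure x).
Proof. by move=> a u v; apply/matrixP => i j; rewrite !mxE linearP /= mulrDr mulrCA. Qed.

Lemma env_pure_basis (i j : 'I_d) : env_pure (b i) (b j) = delta_mx i j :> 'M_d.
Proof.
have fr : free (vbasis {:A}) by exact: basis_free (vbasisP _).
by apply/matrixP => p q; rewrite !mxE !(coord_free _ _ fr) -natrM mulnb [i == p]eq_sym [j == q]eq_sym.
Qed.

Lemma env_decomp E : env_lift env_pure E = E.
Proof.
rewrite [RHS](matrix_sum_delta (E : 'M_d)); apply: eq_bigr => i _; apply: eq_bigr => j _.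
by rewrite env_pure_basis.
Qed.

Lemma env_ext (V : lmodType k) (f g : {linear env -> V}) :
  (forall x y, f (env_pure x y) = g (env_pure x y)) -> f =1 g.
Proof.
move=> h E; rewrite -(env_decomp E) !linear_sum; apply: eq_bigr => i _.
by rewrite !linear_sum; apply: eq_bigr => j _; rewrite !linearZ /= h.
Qed.

Lemma env_ind (P : env -> Prop) :
  P 0 -> (forall a x y E, P E -> P (a *: env_pure x y + E)) -> forall E, P E.
Proof.
move=> P0 PS E; rewrite -(env_decomp E) /env_lift pair_bigA.
by elim/big_rec: _ => // ij F _; apply: PS.
Qed.

Lemma env_mul_l F : linear (env_mul^~ F).
Proof. by move=> a E E'; apply: env_lift_lin. Qed.

Lemma env_lift_param (W V : lmodType k) (psi : W -> A -> A -> V) F :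
  (forall z w, linear (fun u => psi u z w)) ->
  linear (fun u => env_lift (psi u) F).
Proof.
move=> h a u v; rewrite /env_lift scaler_sumr -big_split; apply: eq_bigr => i _ /=.
rewrite scaler_sumr -big_split; apply: eq_bigr => j _ /=.
by rewrite h scalerDr !scalerA mulrC.
Qed.

Lemma env_mul_r E : linear (env_mul E).
Proof.
apply: (@env_lift_param env env (fun F x y => env_lift _ F)) => x y.
exact: env_lift_lin.
Qed.

Lemma env_mul_pure x y z w :
  env_mul (env_pure x y) (env_pure z w) = env_pure (x * z) (w * y).
Proof.
have lin_l (z' w' y' : A) : linear (fun x' : A => env_pure (x' * z') (w' * y')).
  by move=> a u v; rewrite mulrDl algZl env_pure_l.
have lin_r (z' w' x' : A) : linear (fun y' : A => env_pure (x' * z') (w' * y')).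
  by move=> a u v; rewrite mulrDr algZr env_pure_r.
rewrite /env_mul env_lift_pure ?env_lift_pure // => u.
- by move=> a s t; rewrite mulrDr algZr env_pure_l.
- by move=> a s t; rewrite mulrDl algZl env_pure_r.
- by apply: env_lift_param.
- by apply: env_lift_param.
Qed.

Definition env_mull_linear F : {linear env -> env} :=
  HB.pack (env_mul^~ F) (GRing.isLinear.Build _ _ _ _ _ (env_mul_l F)).
Definition env_mulr_linear E : {linear env -> env} :=
  HB.pack (env_mul E) (GRing.isLinear.Build _ _ _ _ _ (env_mul_r E)).

Fact env_mulDl : left_distributive env_mul +%R.
Proof. by move=> E F G; exact: (linearD (env_mull_linear G)). Qed.

Fact env_mulDr : right_distributive env_mul +%R.
Proof. by move=> E F G; exact: (linearD (env_mulr_linear E)). Qed.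

Fact env_mul1l : left_id env_one env_mul.
Proof.
by apply: (@env_ext _ (env_mulr_linear env_one) idfun) => x y /=;
  rewrite env_mul_pure mul1r mulr1.
Qed.

Fact env_mul1r : right_id env_one env_mul.
Proof.
by apply: (@env_ext _ (env_mull_linear env_one) idfun) => x y /=;
  rewrite env_mul_pure mul1r mulr1.
Qed.

Fact env_mulA : associative env_mul.
Proof.
move=> E F G; symmetry.
apply: (@env_ext _ (env_mull_linear G \o env_mull_linear F)
                   (env_mull_linear (env_mul F G)) _ E) => x y /=.
apply: (@env_ext _ (env_mull_linear G \o env_mulr_linear (env_pure x y))
                   (env_mulr_linear (env_pure x y) \o env_mull_linear G) _ F) => z w /=.
apply: (@env_ext _ (env_mulr_linear (env_mul (env_pure x y) (env_pure z w)))
                   (env_mulr_linear (env_pure x y) \o env_mulr_linear (env_pure z w)) _ G).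
by move=> s t /=; rewrite !env_mul_pure !mulrA.
Qed.

HB.instance Definition _ := GRing.Zmodule_isPzRing.Build env
  env_mulA env_mul1l env_mul1r env_mulDl env_mulDr.

(* A as a left module over A (x) A^op: (x (x) y) a = x a y. *)
Definition env_lmod : Type := A.
HB.instance Definition _ := GRing.Zmodule.on env_lmod.

Definition env_lact (E : env) (a : env_lmod) : env_lmod :=
  env_lift (fun x y : A => x * (a : A) * y) E.

(* A as a right module over A (x) A^op: a (x (x) y) = y a x. *)
Definition env_rmod : Type := A.
HB.instance Definition _ := GRing.Zmodule.on env_rmod.

Definition env_ract (E : env^c) (a : env_rmod) : env_rmod :=
  env_lift (fun x y : A => y * (a : A) * x) (E : env).

Lemma env_lact_pure x y a : env_lact (env_pure x y) a = x * (a : A) * y :> A.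
Proof.
apply: env_lift_pure => u c s t; first by rewrite !mulrDl !algZl.
by rewrite mulrDr algZr.
Qed.

Lemma env_ract_pure x y a : env_ract (env_pure x y) a = y * (a : A) * x :> A.
Proof.
apply: env_lift_pure => u c s t; first by rewrite mulrDr algZr.
by rewrite !mulrDl !algZl.
Qed.

Fact env_lact_lin_l (a : A) : linear (fun E : env => env_lact E a : A).
Proof. exact: env_lift_lin. Qed.
Fact env_ract_lin_l (a : A) : linear (fun E : env => env_ract E a : A).
Proof. exact: env_lift_lin. Qed.
Fact env_lact_lin_r E : linear (env_lact E : A -> A).
Proof.
apply: (@env_lift_param A A (fun a x y => x * a * y)) => x y c s t.
by rewrite mulrDr mulrDl algZr algZl.
Qed.
Fact env_ract_lin_r E : linear (env_ract E : A -> A).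
Proof.
apply: (@env_lift_param A A (fun a x y => y * a * x)) => x y c s t.
by rewrite mulrDr mulrDl algZr algZl.
Qed.

Definition env_lact_linear_l a : {linear env -> A} :=
  HB.pack (fun E : env => env_lact E a : A) (GRing.isLinear.Build _ _ _ _ _ (env_lact_lin_l a)).
Definition env_ract_linear_l a : {linear env -> A} :=
  HB.pack (fun E : env => env_ract E a : A) (GRing.isLinear.Build _ _ _ _ _ (env_ract_lin_l a)).
Definition env_lact_linear_r E : {linear A -> A} :=
  HB.pack (env_lact E : A -> A) (GRing.isLinear.Build _ _ _ _ _ (env_lact_lin_r E)).
Definition env_ract_linear_r E : {linear A -> A} :=
  HB.pack (env_ract E : A -> A) (GRing.isLinear.Build _ _ _ _ _ (env_ract_lin_r E)).

Fact env_lactA E F a : env_lact E (env_lact F a) = env_lact (E * F) a.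
Proof.
apply: (@env_ext _ (env_lact_linear_l (env_lact F a))
                   (env_lact_linear_l a \o env_mull_linear F) _ E) => x y /=.
apply: (@env_ext _ (env_lact_linear_r (env_pure x y) \o env_lact_linear_l a)
          (env_lact_linear_l a \o env_mulr_linear (env_pure x y)) _ F) => z w /=.
by rewrite env_mul_pure !env_lact_pure !mulrA.
Qed.
Fact env_lact1 : left_id 1 env_lact.
Proof. by move=> a; rewrite [LHS]env_lact_pure mul1r mulr1. Qed.
Fact env_lactDr : right_distributive env_lact +%R.
Proof. by move=> E a b; apply: (linearD (env_lact_linear_r E)). Qed.
Fact env_lactDl a : {morph env_lact^~ a : E F / E + F}.
Proof. exact: (linearD (env_lact_linear_l a)). Qed.

HB.instance Definition _ := GRing.Zmodule_isLmodule.Build env env_lmod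
  env_lactA env_lact1 env_lactDr env_lactDl.

Fact env_ractA (E F : env^c) a : env_ract E (env_ract F a) = env_ract (E * F) a.
Proof.
apply: (@env_ext _ (env_ract_linear_l (env_ract F a))
                   (env_ract_linear_l a \o env_mulr_linear F) _ E) => x y /=.
apply: (@env_ext _ (env_ract_linear_r (env_pure x y) \o env_ract_linear_l a)
          (env_ract_linear_l a \o env_mull_linear (env_pure x y)) _ F) => z w /=.
by rewrite env_mul_pure !env_ract_pure !mulrA.
Qed.
Fact env_ract1 : left_id 1 env_ract.
Proof. by move=> a; rewrite [LHS]env_ract_pure mul1r mulr1. Qed.
Fact env_ractDr : right_distributive env_ract +%R.
Proof. by move=> E a b; apply: (linearD (env_ract_linear_r E)). Qed.
Fact env_ractDl a : {morph env_ract^~ a : E F / E + F}.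
Proof. exact: (linearD (env_ract_linear_l a)). Qed.

HB.instance Definition _ := GRing.Zmodule_isLmodule.Build env^c env_rmod
  env_ractA env_ract1 env_ractDr env_ractDl.

End Enveloping.

Section Han.
Variables (k : fieldType) (A : fdAlgType k).

(* HH_m(A) = Tor_m(A, A) over A (x)_k A^op. *)
Definition hh_zero (m : nat) : Prop := tor_zero (env_rmod A) (env_lmod A) m.

Definition hh_finite : Prop := exists N : nat, forall m, (N < m)%N -> hh_zero m.

Definition han : Prop := hh_finite -> gldim_finite A.

(* The ideal A e A is strongly stratifying; here Ae is rpeirce 1 e, eA is
   lpeirce e 1, and similarly for the other modules. *)
Definition strongly_stratifying (e : idem A) : Prop :=
  let f := idem_compl e in
  [/\ forall n, (0 < n)%N -> tor_zero (rpeirce (idem1 A) e) (lpeirce e (idem1 A)) n,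
      forall z : tensor (rpeirce f e) (lpeirce e f), z = 0
    & forall n, (0 < n)%N -> tor_zero (rpeirce (idem1 A) f) (lpeirce f (idem1 A)) n].

End Han.

Section Chains.
Variables (k : fieldType) (A : fdAlgType k).

Definition complete_orthogonal n (e : 'I_n -> idem A) : Prop :=
  (forall i j, i != j -> idem_val (e i) * idem_val (e j) = 0) /\
  \sum_i idem_val (e i) = 1.

(* Indices start from 0: chain_ideal e i is A (e_0 + ... + e_(i-1)) A, so that
   the first algebra of the chain is A/0 rather than A itself. *)
Definition chain_ideal n (e : 'I_n -> idem A) (i : 'I_n) : ideal A :=
  gen_ideal (\sum_(j < n | (j < i)%N) idem_val (e j)).

Definition strongly_stratifying_chain n (e : 'I_n -> idem A) : Prop :=
  complete_orthogonal e /\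
  forall i, strongly_stratifying (idem_class (chain_ideal e i) (e i)).

End Chains.

Section AlgebraClass.
Variables (k : fieldType) (C : fdAlgType k -> Prop).

Definition closed_under_quotients : Prop :=
  forall (A : fdAlgType k) (I : ideal A), C A -> C (quo I).

Definition class_chain (A : fdAlgType k) n (e : 'I_n -> idem A) : Prop :=
  strongly_stratifying_chain e /\ forall i, C (corner (e i)).

End AlgebraClass.

(* Main.v *)
(* Over a field, vanishing of Tor can be tested on the dual complexes of
   multilinear forms, and then becomes vanishing of Hochschild cohomology with
   coefficients in a bimodule: of DA = Hom_k(A, k) for HH_n(A), of Hom_k(M, W)
   for Ext_A(M, W).  The latter is handled by dimension shifting, the shift of
   a bimodule D being Hom_k(A, D) with a twisted right action.

   Let A e A = J be stratifying with f J f = 0, and put U = e A e, V = A / J.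
   A space E with commuting bimodule structures over two algebras, acyclic for
   both, identifies the cohomology of its two spaces of invariants.  Applied to
   the bilinear maps on Ae x eA with values in W this gives
   Ext_A(J, W) = Ext_U(eA, eW) and H(A, DJ) = H(U, DU); applied to the bilinear
   forms on V x V it gives H(A, DV) = H(V, DV), since Ext_A(V, DV) = 0.
   The map v |-> f v f embeds V in A, so DV is a retract of DA; if HH(A) is
   finite, so are HH(V) and, by 0 -> DV -> DA -> DJ -> 0, also HH(U).
   Conversely, if U and V have finite global dimension, then Ext_A(V, W) vanishes
   in high degrees, hence Ext_A(N, W) does for every V-module N, and induction on
   the projective dimension of eM over U, using Ae (x)_U Q -> M for Q projective
   over eM, bounds Ext_A(M, W).  The theorem follows by descending induction
   along the chain, the corners that occur being quotients of the e_i A e_i. *)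

Require Import Defs.
From HB Require Import structures.
From mathcomp Require Import all_boot all_order all_algebra.
From mathcomp Require Import boolp classical_sets.
From mathcomp Require Import freeg.

Set Implicit Arguments.
Unset Strict Implicit.
Unset Printing Implicit Defensive.

Import GRing.Theory.
Local Open Scope ring_scope.

(** * Linear maps over a field *)

(** The class [C] is not assumed closed under isomorphism, so the corner met at each step has to be
    a literal quotient of some e_i A e_i, whereas the corner of the quotient algebra is only
    isomorphic to one. Hence [corner_quotient] ties three independent algebras together by maps
    [iota : U -> A] and [pi : A -> V]. This also replaces iterated quotients by quotients of one
    algebra. No cohomology group is formed: only vanishing statements are needed, so the predicate
    [hv], defined by recursion through the dimension shift, suffices, and each comparison becomes an
    induction on the degree whose base is a computation with derivations. Units are dropped from the
    bimodule axioms because the twisted right action is not unital; likewise the embedding of V in A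
    sends 1 to f. Modules have arbitrary dimension. Splittings therefore come from Zorn's lemma, and
    acyclicity of what is built from a projective module comes from an explicit retraction, a finite
    sum read off a section of its free cover, which avoids infinite direct sums of Ext. *)

Section Khom.
Variables (k : fieldType) (X Z : lmodType k).

Record khom := Khom { kfun :> X -> Z; kfun_lin : linear kfun }.

Lemma khomP (f g : khom) : (forall x, f x = g x) -> f = g.
Proof.
case: f g => f hf [g hg] /= /funext e; rewrite e in hf *.
by congr Khom; apply: Prop_irrelevance.
Qed.

HB.instance Definition _ := gen_eqMixin khom.
HB.instance Definition _ := gen_choiceMixin khom.

Lemma linearDZ (f : X -> Z) :
  (forall x y, f (x + y) = f x + f y) -> (forall a x, f (a *: x) = a *: f x) -> linear f.
Proof. by move=> hD hZ a x y; rewrite hD hZ. Qed.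

Lemma kfD (f : khom) x y : f (x + y) = f x + f y.
Proof. by have := kfun_lin f 1 x y; rewrite !scale1r. Qed.
Lemma kf0 (f : khom) : f 0 = 0.
Proof. by apply: (addrI (f 0)); rewrite -kfD !addr0. Qed.
Lemma kfZ (f : khom) a x : f (a *: x) = a *: f x.
Proof. by have := kfun_lin f a x 0; rewrite kf0 !addr0. Qed.
Lemma kfN (f : khom) x : f (- x) = - f x.
Proof. by rewrite -scaleN1r kfZ scaleN1r. Qed.
Lemma kfB (f : khom) x y : f (x - y) = f x - f y.
Proof. by rewrite kfD kfN. Qed.
Lemma kf_sum (f : khom) I (r : seq I) P (F : I -> X) :
  f (\sum_(i <- r | P i) F i) = \sum_(i <- r | P i) f (F i).
Proof. exact: (big_morph f (kfD f) (kf0 f)). Qed.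

Fact kadd_lin (f g : khom) : linear (fun x => f x + g x).
Proof.
by apply: linearDZ => [x y|a x]; rewrite ?kfD ?kfZ ?scalerDr // addrACA.
Qed.
Fact kopp_lin (f : khom) : linear (fun x => - f x).
Proof. by apply: linearDZ => [x y|a x]; rewrite ?kfD ?kfZ ?scalerN ?opprD. Qed.
Fact kscale_lin c (f : khom) : linear (fun x => c *: f x).
Proof.
by apply: linearDZ => [x y|a x]; rewrite ?kfD ?kfZ ?scalerDr // !scalerA mulrC.
Qed.
Fact kzero_lin : linear (fun _ : X => 0 : Z).
Proof. by apply: linearDZ => *; rewrite ?addr0 ?scaler0. Qed.

Definition kadd f g := Khom (kadd_lin f g).
Definition kopp f := Khom (kopp_lin f).
Definition kscale c f := Khom (kscale_lin c f).
Definition kzero := Khom kzero_lin.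

Fact kaddA : associative kadd.
Proof. by move=> f g h; apply: khomP => x /=; rewrite addrA. Qed.
Fact kaddC : commutative kadd.
Proof. by move=> f g; apply: khomP => x /=; rewrite addrC. Qed.
Fact kadd0 : left_id kzero kadd.
Proof. by move=> f; apply: khomP => x /=; rewrite add0r. Qed.
Fact kaddN : left_inverse kzero kopp kadd.
Proof. by move=> f; apply: khomP => x /=; rewrite addNr. Qed.
HB.instance Definition _ := GRing.isZmodule.Build khom kaddA kaddC kadd0 kaddN.

Fact kscaleA a b f : kscale a (kscale b f) = kscale (a * b) f.
Proof. by apply: khomP => x /=; rewrite scalerA. Qed.
Fact kscale1 : left_id 1 kscale.
Proof. by move=> f; apply: khomP => x /=; rewrite scale1r. Qed.
Fact kscaleDr : right_distributive kscale +%R.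
Proof. by move=> a f g; apply: khomP => x /=; rewrite scalerDr. Qed.
Fact kscaleDl f : {morph kscale^~ f : a b / a + b}.
Proof. by move=> a b; apply: khomP => x /=; rewrite scalerDl. Qed.
HB.instance Definition _ := GRing.Zmodule_isLmodule.Build k khom
  kscaleA kscale1 kscaleDr kscaleDl.

Lemma kDE (f g : khom) x : (f + g) x = f x + g x. Proof. by []. Qed.
Lemma kNE (f : khom) x : (- f) x = - f x. Proof. by []. Qed.
Lemma kBE (f g : khom) x : (f - g) x = f x - g x. Proof. by []. Qed.
Lemma kZE a (f : khom) x : (a *: f) x = a *: f x. Proof. by []. Qed.
Lemma k0E x : (0 : khom) x = 0. Proof. by []. Qed.
Lemma ksumE I (r : seq I) P (F : I -> khom) x :
  (\sum_(i <- r | P i) F i) x = \sum_(i <- r | P i) F i x.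
Proof. exact: (big_morph (fun f : khom => f x) (fun f g => kDE f g x) (k0E x)). Qed.

End Khom.

Definition kE := (kDE, kNE, kBE, kZE, k0E).

Section KhomComp.
Variables (k : fieldType) (X Y Z : lmodType k).

Fact kcomp_lin (g : khom Y Z) (f : khom X Y) : linear (fun x => g (f x)).
Proof. by apply: linearDZ => *; rewrite !(kfD, kfZ). Qed.
Definition kcomp g f := Khom (kcomp_lin g f).

Fact kid_lin : linear (fun x : X => x). Proof. by []. Qed.
Definition kid := Khom kid_lin.

End KhomComp.

(** * Subspaces, complements and splittings *)

Section Subspace.
Variables (R : pzRingType) (Y : lmodType R).
Local Open Scope classical_set_scope.

Definition subspace (S : set Y) : Prop :=
  S 0 /\ forall a x y, S x -> S y -> S (a *: x + y).

Lemma subspaceZ S a x : subspace S -> S x -> S (a *: x).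
Proof. by case=> S0 hS Sx; rewrite -[_ *: _]addr0; apply: hS. Qed.
Lemma subspaceD S x y : subspace S -> S x -> S y -> S (x + y).
Proof. by case=> S0 hS Sx Sy; rewrite -[x]scale1r; apply: hS. Qed.
Lemma subspaceB S x y : subspace S -> S x -> S y -> S (x - y).
Proof.
by move=> hS Sx Sy; apply: subspaceD => //; rewrite -scaleN1r; apply: subspaceZ.
Qed.

End Subspace.

Section Complement.
Variables (k : fieldType) (Y : lmodType k).
Local Open Scope classical_set_scope.

(* Zorn_bigcup also applies to the empty chain, whence the union with {0}. *)
Lemma subspace_complement (S : set Y) : subspace S ->
  exists T, [/\ subspace T, (forall x, S x -> T x -> x = 0)
    & forall x, exists s t, [/\ S s, T t & x = s + t]].
Proof.
move=> hS; pose o (X : set Y) := X `|` [set 0].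
pose P (X : set Y) := subspace (o X) /\ forall x, S x -> o X x -> x = 0.
have [|X [[sX dX] mX]] := @Zorn_bigcup _ P.
  move=> F FP Fc.
  have o_in x : o (\bigcup_(X in F) X) x -> x = 0 \/ exists2 X, F X & o X x.
    by case=> [[X FX Xx]|->]; [right; exists X => //; left | left].
  split; first split; first by right.
    move=> a x y /o_in [->|[X FX Xx]] /o_in [->|[X' FX' Xy]].
    - by right; rewrite scaler0 addr0.
    - rewrite scaler0 add0r; case: Xy => [h|->]; last by right.
      by left; exists X'.
    - rewrite addr0; have [/subspaceZ hX _] := FP _ FX.
      by case: (hX a _ Xx) => [h|->]; [left; exists X | right].
    - have [hX _] := FP _ FX; have [hX' _] := FP _ FX'.
      have [s|s] := Fc _ _ FX FX'.
      + have Xx' : o X' x by case: Xx => [/s|]; [left | right].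
        by case: (hX'.2 a _ _ Xx' Xy) => [h|->]; [left; exists X' | right].
      + have Xy' : o X y by case: Xy => [/s|]; [left | right].
        by case: (hX.2 a _ _ Xx Xy') => [h|->]; [left; exists X | right].
  move=> x Sx /o_in[//|[X FX Xx]]; exact: (FP _ FX).2.
exists (o X); split=> // y.
have [//|hy] := pselect (exists s t, [/\ S s, o X t & y = s + t]).
pose X' : set Y := fun z => exists a x, o X x /\ z = a *: y + x.
have oX' z : o X' z -> X' z.
  by case=> // ->; exists 0, 0; rewrite scale0r addr0; split => //; right.
have X'y : X' y by exists 1, 0; rewrite scale1r addr0; split => //; right.
exfalso; apply: (mX X').
  split=> [x Xx|h]; first by exists 0, x; rewrite scale0r add0r; split => //; left.
  by apply: hy; exists 0, y; rewrite add0r; split=> //; [exact: hS.1 | left; apply: h].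
split; first split; first by right.
  move=> c u v /oX' [a [x [Xx ->]]] /oX' [b [x' [Xx' ->]]]; left.
  exists (c * a + b), (c *: x + x'); split; first exact: sX.2.
  by rewrite scalerDl scalerDr scalerA addrACA.
move=> u Su /oX' [a [x [Xx e]]].
have [a0|a0] := eqVneq a 0.
  by apply: dX => //; rewrite e a0 scale0r add0r.
case: hy; exists (a^-1 *: u), (- a^-1 *: x); split; [exact: subspaceZ | exact: subspaceZ |].
by rewrite e scalerDr scalerA mulVf // scale1r scaleNr addrK.
Qed.

(* The projection along S onto a complement: a substitute for Y / S. *)
Lemma subspace_projector (S : set Y) : subspace S ->
  exists r : khom Y Y, (forall x, S x -> r x = 0) /\ forall x, S (x - r x).
Proof.
move=> sS; have [T [sT dT cT]] := subspace_complement sS.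
have /choice[r hr] : forall y, exists z, T z /\ S (y - z).
  move=> y; have [s [t [Ss Tt ->]]] := cT y.
  by exists t; split; rewrite ?addrK.
have ur y z : T z -> S (y - z) -> r y = z.
  move=> Tz Sz; apply/eqP; rewrite -subr_eq0; apply/eqP/dT.
    have -> : r y - z = (y - z) - (y - r y) by rewrite opprB [RHS]addrC addrA subrK.
    by apply: subspaceB => //; apply: (hr y).2.
  by apply: subspaceB => //; apply: (hr y).1.
have r_lin : linear r.
  move=> a u v; apply: ur; first by apply: sT.2; apply: (hr _).1.
  have -> : a *: u + v - (a *: r u + r v) = a *: (u - r u) + (v - r v).
    by rewrite scalerBr opprD addrACA.
  by apply: sS.2; apply: (hr _).2.
exists (Khom r_lin); split=> [x Sx|x] /=; last exact: (hr x).2.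
by apply: ur; rewrite ?subr0 //; exact: sT.1.
Qed.

End Complement.

Section Splitting.
Variable k : fieldType.

(** With r the projection along the kernel of p, composing r with any set-theoretic section gives a
    result independent of the section, hence linear. *)
Lemma khom_section (X Y : lmodType k) (p : khom X Y) : (forall y, exists x, p x = y) ->
  exists s : khom Y X, forall y, p (s y) = y.
Proof.
move=> psurj; have [|r [r0 hr]] := @subspace_projector _ X (fun x => p x = 0).
  by split=> [|a x y /= hx hy]; rewrite ?kf0 // kfD kfZ hx hy scaler0 addr0.
have {}hr x : p (r x) = p x by apply/esym/eqP; rewrite -subr_eq0 -kfB hr.
have [s hs] := choice psurj.
have us x y : p x = y -> r x = r (s y).
  move=> e; apply/eqP; rewrite -subr_eq0 -kfB; apply/eqP/r0.
  by rewrite kfB hs e subrr.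
have s_lin : linear (fun y => r (s y)).
  by move=> a u v; rewrite -kfZ -kfD; apply/esym/us; rewrite kfD kfZ !hs.
by exists (Khom s_lin) => y; rewrite /= hr.
Qed.

(** Exactness of Hom_k(-, Z). With r the projection along the image of i and [s y] any preimage of y
    - r y, the value f (s y) does not depend on the choice, hence is linear in y. *)
Lemma khom_extend (X Y Z : lmodType k) (i : khom X Y) (f : khom X Z) :
  (forall x, i x = 0 -> f x = 0) -> exists g : khom Y Z, forall x, g (i x) = f x.
Proof.
move=> h; have [|r [r0 hr]] := @subspace_projector _ Y (fun y => exists x, i x = y).
  split=> [|a _ _ [x <-] [x' <-]]; first by exists 0; rewrite kf0.
  by exists (a *: x + x'); rewrite kfD kfZ.
have [s hs] := choice hr.
have ug y x : i x = y - r y -> f (s y) = f x.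
  move=> e; apply/eqP; rewrite -subr_eq0 -kfB; apply/eqP/h.
  by rewrite kfB hs e subrr.
have g_lin : linear (fun y => f (s y)).
  move=> a u v; rewrite -kfZ -kfD; apply: ug.
  by rewrite !kfD !kfZ !hs scalerBr opprD addrACA.
exists (Khom g_lin) => x /=; apply: ug.
by rewrite r0 ?subr0 //; exists x.
Qed.

Lemma khom_retraction (X Y : lmodType k) (i : khom X Y) : (forall x, i x = 0 -> x = 0) ->
  exists r : khom Y X, forall x, r (i x) = x.
Proof. by move=> hi; apply: (@khom_extend _ _ _ i (kid X)). Qed.

Lemma khom_lift (X Y Z : lmodType k) (i : khom Y Z) (f : khom X Z) :
  (forall y, i y = 0 -> y = 0) -> (forall x, exists y, i y = f x) ->
  exists g : khom X Y, forall x, i (g x) = f x.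
Proof.
move=> /khom_retraction[r hr] h; exists (kcomp r f) => x /=.
by have [y e] := h x; rewrite -e hr.
Qed.

(** This is what allows exactness of a complex to be read off its dual. *)
Lemma khom_separate (Y : lmodType k) (S : set Y) (y : Y) : subspace S -> ~ S y ->
  exists f : khom Y k^o, (forall x, S x -> f x = 0) /\ f y <> 0.
Proof.
move=> /subspace_projector[r [r0 hr]] Sy.
have ry : r y != 0 by apply/eqP => e; apply: Sy; rewrite -[y]subr0 -e.
have i_lin : linear (fun a : k^o => a *: r y).
  by move=> a b c; rewrite scalerDl scalerA.
have [|g hg] := @khom_extend _ _ _ (Khom i_lin) (kid k^o).
  by move=> a /= /eqP; rewrite scaler_eq0 (negPf ry) orbF => /eqP.
exists (kcomp g r); split=> [x Sx|] /=; first by rewrite r0 // kf0.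
by have := hg 1; rewrite /= scale1r => ->; apply/eqP/oner_neq0.
Qed.

End Splitting.

(** * Hochschild cohomology *)

(* Actions need not be unital: [tw] below produces a right action that is not. *)
Record bim_axioms k (L R : fdAlgType k) (D : lmodType k)
    (l : L -> D -> D) (r : D -> R -> D) : Prop := BimAxioms {
  axlDl : forall a b x, l (a + b) x = l a x + l b x;
  axlZl : forall c a x, l (c *: a) x = c *: l a x;
  axlDr : forall a x y, l a (x + y) = l a x + l a y;
  axlZr : forall a c x, l a (c *: x) = c *: l a x;
  axrDr : forall x a b, r x (a + b) = r x a + r x b;
  axrZr : forall x c a, r x (c *: a) = c *: r x a;
  axrDl : forall x y a, r (x + y) a = r x a + r y a;
  axrZl : forall c x a, r (c *: x) a = c *: r x a;
  axlA : forall a b x, l a (l b x) = l (a * b) x;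
  axrA : forall x a b, r (r x a) b = r x (a * b);
  axlr : forall a x b, l a (r x b) = r (l a x) b
}.

Record bim2 k (L R : fdAlgType k) := Bim {
  bcar :> lmodType k;
  bl : L -> bcar -> bcar;
  br : bcar -> R -> bcar;
  bimP : bim_axioms bl br
}.
Notation bim L := (bim2 L L).

Section BimTheory.
Variables (k : fieldType) (L R : fdAlgType k).
Implicit Types D : bim2 L R.

Lemma blDl D (a b : L) (x : D) : bl (a + b) x = bl a x + bl b x. Proof. exact: axlDl (bimP D) _ _ _. Qed.
Lemma blZl D c (a : L) (x : D) : bl (c *: a) x = c *: bl a x. Proof. exact: axlZl (bimP D) _ _ _. Qed.
Lemma blDr D (a : L) (x y : D) : bl a (x + y) = bl a x + bl a y. Proof. exact: axlDr (bimP D) _ _ _. Qed.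
Lemma blZr D (a : L) c (x : D) : bl a (c *: x) = c *: bl a x. Proof. exact: axlZr (bimP D) _ _ _. Qed.
Lemma brDr D (x : D) a b : br x (a + b) = br x a + br x b. Proof. exact: axrDr (bimP D) _ _ _. Qed.
Lemma brZr D (x : D) c a : br x (c *: a) = c *: br x a. Proof. exact: axrZr (bimP D) _ _ _. Qed.
Lemma brDl D (x y : D) a : br (x + y) a = br x a + br y a. Proof. exact: axrDl (bimP D) _ _ _. Qed.
Lemma brZl D c (x : D) a : br (c *: x) a = c *: br x a. Proof. exact: axrZl (bimP D) _ _ _. Qed.
Lemma blA D (a b : L) (x : D) : bl a (bl b x) = bl (a * b) x. Proof. exact: axlA (bimP D) _ _ _. Qed.
Lemma brA D (x : D) a b : br (br x a) b = br x (a * b). Proof. exact: axrA (bimP D) _ _ _. Qed.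
Lemma blr D a (x : D) b : bl a (br x b) = br (bl a x) b. Proof. exact: axlr (bimP D) _ _ _. Qed.

Lemma blNr D (a : L) (x : D) : bl a (- x) = - bl a x.
Proof. by rewrite -scaleN1r blZr scaleN1r. Qed.
Lemma brNl D (x : D) (a : R) : br (- x) a = - br x a.
Proof. by rewrite -scaleN1r brZl scaleN1r. Qed.
Lemma blBr D (a : L) (x y : D) : bl a (x - y) = bl a x - bl a y.
Proof. by rewrite blDr blNr. Qed.
Lemma brBl D (x y : D) a : br (x - y) a = br x a - br y a.
Proof. by rewrite brDl brNl. Qed.
Lemma bl0r D (a : L) : bl a (0 : D) = 0.
Proof. by rewrite -(scale0r (0 : D)) blZr !scale0r. Qed.
Lemma br0l D a : br (0 : D) a = 0.
Proof. by rewrite -(scale0r (0 : D)) brZl !scale0r. Qed.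

Definition bE := (blDl, blZl, blDr, blZr, brDr, brZr, brDl, brZl).

End BimTheory.

(** * The dimension shift of a bimodule *)

Section Twist.
Variables (k : fieldType) (L : fdAlgType k).
Section Def.
Variable D : bim L.

Fact tw_l_lin (a : L) (h : khom L D) : linear (fun x => bl a (h x)).
Proof. by apply: linearDZ => *; rewrite ?(kfD, kfZ) bE. Qed.
Definition tw_l (a : L) (h : khom L D) : khom L D := Khom (tw_l_lin a h).

Fact tw_r_lin (h : khom L D) (b : L) : linear (fun x : L => h (b * x) - br (h b) x).
Proof.
apply: linearDZ => *; rewrite ?(mulrDr, algZr) ?(kfD, kfZ) bE.
  by rewrite opprD addrACA.
by rewrite scalerBr.
Qed.
Definition tw_r (h : khom L D) (b : L) : khom L D := Khom (tw_r_lin h b).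

Fact tw_axioms : bim_axioms tw_l tw_r.
Proof.
split=> *; apply: khomP => ? /=; rewrite ?(kE, mulrDl, algZl) ?(kfD, kfZ) ?bE /= ?blA //.
- by rewrite opprD addrACA.
- by rewrite scalerBr.
- by rewrite opprD addrACA.
- by rewrite scalerBr.
- by rewrite brNl brA opprB addrA subrK mulrA.
- by rewrite blNr blr.
Qed.

(* The twisted right action makes the Hochschild complex of [D] in degree n+1
   the Hochschild complex of [tw D] in degree n. *)
Definition tw : bim L := Bim tw_axioms.

Definition der (h : khom L D) : Prop := forall a x : L, h (a * x) = bl a (h x) + br (h a) x.

Fact inn_lin (m : D) : linear (fun x : L => bl x m - br m x).
Proof.
apply: linearDZ => *; rewrite !bE; first by rewrite opprD addrACA.
by rewrite scalerBr.
Qed.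
Definition inn (m : D) : khom L D := Khom (inn_lin m).

Fact inn_linr : linear inn.
Proof.
apply: linearDZ => *; apply: khomP => ? /=; rewrite !bE.
  by rewrite opprD addrACA.
by rewrite scalerBr.
Qed.
Definition innh : khom D (tw) := Khom inn_linr.

Definition invar (m : D) : Prop := forall x, bl x m = br m x.

Definition H1 : Prop := forall h, der h -> exists m, forall x, h x = bl x m - br m x.

End Def.

(* [hv n D] says that the Hochschild cohomology of [D] vanishes in degree n+1. *)
Fixpoint hv n (D : bim L) : Prop := if n is n'.+1 then hv n' (tw D) else H1 D.

Lemma hvS n D : hv n.+1 D = hv n (tw D). Proof. by []. Qed.

Lemma inn_der D m : der (@inn D m).
Proof. by move=> a x /=; rewrite blBr brBl blA brA blr addrA subrK. Qed.

(** Degree 0 of the shifted complex: the 0-cocycles of [tw D] are the 1-cocycles of D. Inductions on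
    the degree start from this. *)
Lemma invar_tw D (h : tw D) : invar h <-> der h.
Proof.
split=> [hh a x|hh a]; last by apply: khomP => x /=; rewrite hh addrK.
by have /= := congr1 (fun f : khom L D => f x) (hh a); move=> ->; rewrite subrK.
Qed.

End Twist.

(** * Exact sequences of bimodules and the long exact sequence *)

Section BimMorphism.
Variables (k : fieldType) (L : fdAlgType k).

Record bmor (D D' : bim L) (g : khom D D') : Prop := Bmor {
  bmorl : forall a x, g (bl a x) = bl a (g x);
  bmorr : forall x a, g (br x a) = br (g x) a
}.

Record exact2 (X Y Z : lmodType k) (i : khom X Y) (p : khom Y Z) : Prop := Exact2 {
  ex_inj : forall x, i x = 0 -> x = 0;
  ex_mid : forall y, p y = 0 -> exists x, i x = y;
  ex_comp : forall x, p (i x) = 0;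
  ex_surj : forall z, exists y, p y = z
}.

Definition ses (D' D D'' : bim L) : Prop := exists (i : khom D' D) (p : khom D D''),
  [/\ bmor i, bmor p & exact2 i p].

Fact kpost_lin (X Y Z : lmodType k) (g : khom Y Z) : linear (fun h : khom X Y => kcomp g h).
Proof. by apply: linearDZ => *; apply: khomP => x; rewrite /= ?kfD ?kfZ. Qed.
Definition kpost X Y Z (g : khom Y Z) : khom (khom X Y) (khom X Z) := Khom (kpost_lin g).

Fact kpre_lin (X Y Z : lmodType k) (g : khom X Y) : linear (fun h : khom Y Z => kcomp h g).
Proof. by apply: linearDZ => *; apply: khomP. Qed.
Definition kpre X Y Z (g : khom X Y) : khom (khom Y Z) (khom X Z) := Khom (kpre_lin g).

Lemma kpost_exact X Y Y' Z i p : @exact2 Y Y' Z i p -> exact2 (@kpost X _ _ i) (@kpost X _ _ p).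
Proof.
move=> [ii im ic ps]; split=> /= h.
- by move=> e; apply: khomP => x; apply: ii; have /= -> := congr1 (fun f : khom _ _ => f x) e.
- move=> e; have [|g hg] := khom_lift ii (f := h).
    by move=> x; apply: im; have /= -> := congr1 (fun f : khom _ _ => f x) e.
  by exists g; apply: khomP.
- by apply: khomP => x /=.
- have [s hs] := khom_section ps.
  by exists (kcomp s h); apply: khomP => x /=.
Qed.

Lemma kpre_exact X Y Z W i p : @exact2 X Y Z i p -> exact2 (@kpre _ _ W p) (@kpre _ _ W i).
Proof.
move=> [ii im ic ps]; split=> /= h.
- move=> e; apply: khomP => z; have [y <-] := ps z.
  by have /= -> := congr1 (fun f : khom _ _ => f y) e.
- move=> e; have [|g hg] := @khom_extend _ _ _ _ p h.
    move=> y /im[x <-]; by have /= -> := congr1 (fun f : khom _ _ => f x) e.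
  by exists g; apply: khomP.
- by apply: khomP => x /=; rewrite ic kf0.
- have [r hr] := khom_retraction ii.
  by exists (kcomp h r); apply: khomP => x /=; rewrite hr.
Qed.

Lemma bmor_tw (D D' : bim L) (g : khom D D') : bmor g -> bmor (kpost L g : khom (tw D) (tw D')).
Proof.
by move=> [gl gr]; split=> *; apply: khomP => ? /=; rewrite ?kfB ?gl ?gr.
Qed.

Lemma ses_tw D' D D'' : ses D' D D'' -> ses (tw D') (tw D) (tw D'').
Proof.
move=> [i [p [hi hp e]]]; exists (kpost L i), (kpost L p).
by split; [exact: bmor_tw|exact: bmor_tw|exact: kpost_exact].
Qed.

Lemma der_comp (D D' : bim L) (g : khom D D') (h : khom L D) : bmor g -> der h -> der (kcomp g h : khom L D').
Proof. by move=> [gl gr] hd a x /=; rewrite hd kfD gl gr. Qed.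

End BimMorphism.

Lemma subr_swap (V : zmodType) (a b c d : V) : a - b = c - d -> a - c = b - d.
Proof.
by move/eqP; rewrite subr_eq => /eqP->; rewrite addrAC [c - d]addrC addrK addrC.
Qed.

Lemma subrBB (V : zmodType) (a b c : V) : a - c - (b - c) = a - b.
Proof. by rewrite opprB addrA subrK. Qed.

Section LongExact.
Variables (k : fieldType) (L : fdAlgType k).
Implicit Types D : bim L.

(** The connecting map H^0(D'') -> H^1(D') by hand: for x over y the derivation [inn x] takes values
    in D', and writing it as inner there corrects x by an element of D'. *)
Lemma ses_invar_lift D' D D'' (i : khom D' D) (p : khom D D'') :
  bmor i -> bmor p -> exact2 i p -> H1 D' ->
  forall y : D'', invar y -> exists2 x : D, invar x & p x = y.
Proof.
move=> [il ir] [pl pr] [ii im ic ps] hD' y hy; have [x e] := ps y.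
have [|g hg] := khom_lift ii (f := inn x).
  by move=> a; apply: im; rewrite /= kfB pl pr e hy subrr.
have gd : der g.
  move=> a b; apply/eqP; rewrite -subr_eq0; apply/eqP/ii.
  by rewrite kfB kfD il ir !hg inn_der subrr.
have [m hm] := hD' _ gd; exists (x - i m); last by rewrite kfB ic subr0.
move=> a; rewrite blBr brBl -il -ir; apply: subr_swap.
by have /= <- := hg a; rewrite hm kfB.
Qed.

Lemma ses_H1 D' D D'' (i : khom D' D) (p : khom D D'') :
  bmor i -> bmor p -> exact2 i p -> H1 D ->
  (forall y : D'', invar y -> exists2 x : D, invar x & p x = y) -> H1 D'.
Proof.
move=> [il ir] [pl pr] [ii im ic ps] hD hs h hd.
have [|m hm] := hD (kcomp i h); first exact: der_comp.
have [|x hx e] := hs (p m).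
  by move=> a; rewrite -pl -pr; apply/eqP; rewrite -subr_eq0 -kfB -hm /= ic.
have [|m' e'] := im (m - x); first by rewrite kfB e subrr.
exists m' => a; apply/eqP; rewrite -subr_eq0; apply/eqP/ii.
rewrite !kfB il ir e' blBr brBl hx -[i (h a)]/(kcomp i h a) hm.
by rewrite subrBB subrr.
Qed.

(** This lemma and the next two are the long exact sequence at its middle, left and right terms.
    Only the lowest degree needs an argument, since [ses_tw] shifts the whole sequence. *)
Lemma ses_hvC n D' D D'' : ses D' D D'' -> hv n D' -> hv n D'' -> hv n D.
Proof.
elim: n D' D D'' => [|n IH] D' D D'' s; last by apply: IH; apply: ses_tw.
move: s => [i [p [[il ir] [pl pr] [ii im ic ps]]]] hD' hD'' h hd.
have [|m'' hm] := hD'' (kcomp p h); first exact: der_comp.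
have [m e] := ps m''.
have [|g hg] := khom_lift ii (f := h - inn m).
  by move=> x; apply: im; rewrite kBE kfB -[p (h x)]/(kcomp p h x) hm /= kfB pl pr e subrr.
have gd : der g.
  move=> a b; apply/eqP; rewrite -subr_eq0; apply/eqP/ii.
  rewrite kfB kfD il ir !hg !kBE inn_der hd blBr brBl opprD addrACA.
  by rewrite subrr.
have [m' hm'] := hD' _ gd; exists (i m' + m) => x.
rewrite blDr brDl opprD addrACA -il -ir -kfB -hm' hg kBE /= subrK //.
Qed.

Lemma ses_hvA n D' D D'' : ses D' D D'' -> hv n D'' -> hv n.+1 D -> hv n.+1 D'.
Proof.
elim: n D' D D'' => [|n IH] D' D D'' s; last exact: (IH (tw D') _ _ (ses_tw s)).
move: s => [i [p [hi hp e]]] hD'' hD.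
(* An invariant of [tw D''] is a derivation, here inner, and an inner derivation lifts along with
   the element defining it. *)
apply: (ses_H1 (bmor_tw hi) (bmor_tw hp) (kpost_exact L e)) => // h /invar_tw/hD''[m hm].
have [x hx] := ex_surj e m; exists (inn x); first exact/invar_tw/inn_der.
by apply: khomP => a; rewrite hm -hx /= kfB (bmorl hp) (bmorr hp).
Qed.

Lemma ses_hvB n D' D D'' : ses D' D D'' -> hv n D -> hv n.+1 D' -> hv n D''.
Proof.
elim: n D' D D'' => [|n IH] D' D D'' s; last exact: (IH (tw D') _ _ (ses_tw s)).
move: s => [i [p [hi hp e]]] hD hD' h /invar_tw hh.
have [g /invar_tw/hD[m hm] <-] :=
  ses_invar_lift (bmor_tw hi) (bmor_tw hp) (kpost_exact L e) hD' hh.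
by exists (p m) => a; rewrite /= hm kfB (bmorl hp) (bmorr hp).
Qed.

End LongExact.

(** * Subspaces and kernels as modules *)

Section Subspaces.
Variables (R : pzRingType) (Y : lmodType R) (S : set Y) (hS : subspace S).

(** The proof that S is a subspace is a parameter of the type, so that the module structure can be
    attached to it. *)
Record subk (phS : subspace S) := Subk { skval :> Y; skP : S skval }.

Lemma skval_inj : injective (@skval hS).
Proof.
move=> [x hx] [y hy] /= e; rewrite e in hx *; congr Subk; exact: Prop_irrelevance.
Qed.

HB.instance Definition _ := gen_eqMixin (subk hS).
HB.instance Definition _ := gen_choiceMixin (subk hS).

Definition sk0 : subk hS := Subk hS hS.1.
Definition skD (x y : subk hS) : subk hS := Subk hS (subspaceD hS (skP x) (skP y)).
Definition skZ a (x : subk hS) : subk hS := Subk hS (subspaceZ a hS (skP x)).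
Definition skN (x : subk hS) : subk hS := skZ (-1) x.

Fact skDA : associative skD.
Proof. by move=> x y z; apply: skval_inj; rewrite /= addrA. Qed.
Fact skDC : commutative skD.
Proof. by move=> x y; apply: skval_inj; rewrite /= addrC. Qed.
Fact skD0 : left_id sk0 skD.
Proof. by move=> x; apply: skval_inj; rewrite /= add0r. Qed.
Fact skDN : left_inverse sk0 skN skD.
Proof. by move=> x; apply: skval_inj; rewrite /= scaleN1r addNr. Qed.
HB.instance Definition _ := GRing.isZmodule.Build (subk hS) skDA skDC skD0 skDN.
Fact skZA a b x : skZ a (skZ b x) = skZ (a * b) x.
Proof. by apply: skval_inj; rewrite /= scalerA. Qed.
Fact skZ1 : left_id 1 skZ.
Proof. by move=> x; apply: skval_inj; rewrite /= scale1r. Qed.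
Fact skZDr : right_distributive skZ +%R.
Proof. by move=> a x y; apply: skval_inj; rewrite /= scalerDr. Qed.
Fact skZDl x : {morph skZ^~ x : a b / a + b}.
Proof. by move=> a b; apply: skval_inj; rewrite /= scalerDl. Qed.
HB.instance Definition _ := GRing.Zmodule_isLmodule.Build R (subk hS)
  skZA skZ1 skZDr skZDl.

Fact skval_lin : linear (@skval hS). Proof. by []. Qed.
HB.instance Definition _ := GRing.isLinear.Build R (subk hS) Y _ (@skval hS) skval_lin.

End Subspaces.

Definition skinc (k : fieldType) (Y : lmodType k) (S : set Y) (hS : subspace S) :
  khom (subk hS) Y := Khom (@skval_lin _ _ _ hS).

Lemma subspace_ker (k : fieldType) (X Y : lmodType k) (g : khom X Y) : subspace (fun x => g x = 0).
Proof. by split=> [|a x y hx hy]; rewrite ?kf0 // kfD kfZ hx hy scaler0 addr0. Qed.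

Section KerBim.
Variables (k : fieldType) (L : fdAlgType k) (D D' : bim L) (g : khom D D') (hg : bmor g).
Local Notation K := (subk (subspace_ker g)).

Fact kerb_l_sub (a : L) (x : K) : g (bl a (x : D)) = 0.
Proof. by rewrite (bmorl hg) (skP x) bl0r. Qed.
Fact kerb_r_sub (x : K) (a : L) : g (br (x : D) a) = 0.
Proof. by rewrite (bmorr hg) (skP x) br0l. Qed.
Definition kerb_l a x : K := Subk (subspace_ker g) (kerb_l_sub a x).
Definition kerb_r x a : K := Subk (subspace_ker g) (kerb_r_sub x a).
Fact kerb_axioms : bim_axioms kerb_l kerb_r.
Proof.
by split=> *; apply: skval_inj; rewrite /= ?bE // ?blA ?brA ?blr.
Qed.
Definition kerb : bim L := Bim kerb_axioms.

End KerBim.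

Section Pointwise.
Variables (k : fieldType) (L : fdAlgType k) (X : lmodType k) (D : bim L).

Fact pw_l_lin (a : L) (h : khom X D) : linear (fun x => bl a (h x)).
Proof. by apply: linearDZ => *; rewrite ?(kfD, kfZ) !bE. Qed.
Fact pw_r_lin (h : khom X D) (a : L) : linear (fun x => br (h x) a).
Proof. by apply: linearDZ => *; rewrite ?(kfD, kfZ) !bE. Qed.
Fact pw_axioms : bim_axioms (fun a h => Khom (pw_l_lin a h)) (fun h a => Khom (pw_r_lin h a)).
Proof.
by split=> *; apply: khomP => ? /=; rewrite ?kE ?bE // ?blA ?brA ?blr.
Qed.
Definition pw : bim L := Bim pw_axioms.

End Pointwise.

(** * Retracts along a change of algebra *)

Section ChangeOfAlgebra.
Variables (k : fieldType) (L L' : fdAlgType k) (al : khom L' L) (be : khom L L').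
Hypotheses (alM : forall a b : L', al (a * b) = al a * al b).
Hypotheses (beM : forall a b : L, be (a * b) = be a * be b).
Hypothesis alK : forall a, be (al a) = a.

(** That is, g is a morphism of N-bimodules once D is restricted along f. *)
Record smor (M N : fdAlgType k) (f : N -> M) (D : bim M) (D' : bim N) (g : khom D D') : Prop :=
  Smor {
  smorl : forall a x, g (bl (f a) x) = bl a (g x);
  smorr : forall x a, g (br x (f a)) = br (g x) a
}.

Lemma smor_tw (M N : fdAlgType k) (f : khom N M) (D : bim M) (D' : bim N) (g : khom D D') :
  (forall a b : N, f (a * b) = f a * f b) -> smor f g ->
  smor f (kcomp (kpost N g) (kpre D f) : khom (tw D) (tw D')).
Proof.
move=> fM [gl gr]; split=> *; apply: khomP => x /=; first by rewrite gl.
by rewrite kfB gr fM.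
Qed.

(** A derivation h into D' yields the derivations g'_i h be into D; if these are inner by m_i, then
    h is inner by the sum of the g_i m_i. Allowing a sum, and not one retraction only, covers
    Hom_k(X, D) for X finite dimensional. *)
Lemma hv_sum_retract n (D : bim L) (D' : bim L') r
    (g : 'I_r -> khom D D') (g' : 'I_r -> khom D' D) :
  (forall i, smor al (g i)) -> (forall i, smor be (g' i)) ->
  (forall x, \sum_i g i (g' i x) = x) -> hv n D -> hv n D'.
Proof.
elim: n D D' g g' => [|n IH] D D' g g' hg hg' gg'.
  move=> hD h hd.
  have hm i : exists m, forall x, g' i (h (be x)) = bl x m - br m x.
    have [a x|m hm] := hD (kcomp (g' i) (kcomp h be)); last by exists m.
    by rewrite /= beM hd kfD (smorl (hg' i)) (smorr (hg' i)).
  have [m {}hm] := choice hm; exists (\sum_i g i (m i)) => x.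
  have -> : h x = \sum_i g i (g' i (h x)) by rewrite gg'.
  pose f := inn (\sum_i g i (m i)); rewrite -[RHS]/(innh D' (\sum_i g i (m i)) x).
  rewrite kf_sum ksumE; apply: eq_bigr => i _.
  by rewrite -[in LHS](alK x) hm kfB (smorl (hg i)) (smorr (hg i)).
apply: (IH (tw D) (tw D') (fun i => kcomp (kpost L' (g i)) (kpre D al))
  (fun i => kcomp (kpost L (g' i)) (kpre D' be))).
- by move=> i; apply: smor_tw.
- by move=> i; apply: smor_tw.
- move=> h; apply: khomP => x; rewrite ksumE /= alK.
  exact: gg'.
Qed.

Lemma hv_smor n (D : bim L) (D' : bim L') (g : khom D D') (g' : khom D' D) :
  smor al g -> smor be g' -> (forall x, g (g' x) = x) -> hv n D -> hv n D'.
Proof.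
move=> hg hg' gg'; apply: (@hv_sum_retract n D D' 1 (fun=> g) (fun=> g')) => // x.
by rewrite big_ord1.
Qed.

End ChangeOfAlgebra.

Section KMul.
Variables (k : fieldType) (L : fdAlgType k).
Fact kmulr_lin (a : L) : linear (fun x : L => x * a).
Proof. by apply: linearDZ => *; rewrite (mulrDl, algZl). Qed.
Fact kmull_lin (a : L) : linear (fun x : L => a * x).
Proof. by apply: linearDZ => *; rewrite (mulrDr, algZr). Qed.
Definition kmulr a := Khom (kmulr_lin a).
Definition kmull a := Khom (kmull_lin a).
End KMul.

(** * Coinduced bimodules are acyclic *)

Section Acyclic.
Variables (k : fieldType) (L : fdAlgType k).
Implicit Type D : bim L.

Lemma hv_retract n D D' (g : khom D D') (g' : khom D' D) :
  bmor g -> bmor g' -> (forall x, g (g' x) = x) -> hv n D -> hv n D'.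
Proof.
move=> [gl gr] [gl' gr'] gg'.
by apply: (@hv_smor _ _ _ (kid L) (kid L) _ _ _ n D D' g g') => //; split.
Qed.

(** [pw X D] is a finite sum of copies of D, one for each vector of a basis of X. *)
Lemma hv_pw n (X : vectType k) D : hv n D -> hv n (pw X D).
Proof.
pose v := vbasis {:X}.
have i_lin i (d : D) : linear (fun x : X => coord v i x *: d).
  apply: linearDZ => *; first by rewrite linearD scalerDl.
  by rewrite linearZ scalerA.
have g_lin i : linear (fun d : D => Khom (i_lin i d)).
  apply: linearDZ => *; apply: khomP => x /=; first by rewrite scalerDr.
  by rewrite !scalerA mulrC.
have g'_lin i : linear (fun h : khom X D => h v`_i) by [].
apply: (@hv_sum_retract _ _ _ (kid L) (kid L) _ _ _ n D (pw X D) _ (fun i => Khom (g_lin i))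
  (fun i => Khom (g'_lin i))) => //.
- by move=> i; split=> *; apply: khomP => x /=; rewrite bE.
- move=> h; apply: khomP => x; rewrite ksumE /=.
  rewrite {2}(coord_vbasis (memvf x)) kf_sum; apply: eq_bigr => i _.
  by rewrite kfZ.
Qed.

(* [D] is a retract of the bimodule of linear maps L -> D coinduced on the left. *)
Definition left_coinduced D := exists s : khom (khom L D) D,
  [/\ forall (h h' : khom L D) b, (forall y, h' y = br (h y) b) -> s h' = br (s h) b,
      forall (h h' : khom L D) a, (forall y : L, h' y = h (y * a)) -> s h' = bl a (s h)
    & forall (h : khom L D) m, (forall y, h y = bl y m) -> s h = m].

Fact kflip_lin1 (X Y Z : lmodType k) (H : khom X (khom Y Z)) y : linear (fun x => H x y).
Proof. by apply: linearDZ => *; rewrite (kfD, kfZ) kE. Qed.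
Fact kflip_lin2 (X Y Z : lmodType k) (H : khom X (khom Y Z)) :
  linear (fun y => Khom (kflip_lin1 H y)).
Proof. by apply: linearDZ => *; apply: khomP => x /=; rewrite (kfD, kfZ). Qed.
Definition kflip (X Y Z : lmodType k) (H : khom X (khom Y Z)) : khom Y (khom X Z) :=
  Khom (kflip_lin2 H).

(** Applying s to h (y x) = y h(x) + h(y) x, both sides read as maps in y, gives x s(h) = h(x) +
    s(h) x, so h is inner. The condition passes to [tw D] by applying s argumentwise. *)
Lemma left_coinduced_hv n D : left_coinduced D -> hv n D.
Proof.
elim: n D => [|n IH] D [s [sr sl s1]].
  move=> h hd; exists (s h) => x.
  pose hx : khom L D := kcomp h (kmulr x).
  have e1 : s hx = bl x (s h) by apply: sl.
  have r_lin : linear (fun y => br (h y) x) by apply: linearDZ => *; rewrite !(kfD, kfZ) bE.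
  have e2 : s (Khom r_lin) = br (s h) x by apply: sr.
  have l_lin : linear (fun y => bl y (h x)) by apply: linearDZ => *; rewrite bE.
  have e3 : s (Khom l_lin) = h x by apply: s1.
  have e : hx = Khom l_lin + Khom r_lin by apply: khomP => y; rewrite kE /= hd.
  by rewrite -e1 e kfD e2 e3 addrK.
apply: IH; pose s' (H : khom L (tw D)) : tw D := kcomp s (kflip H).
have s'_lin : linear s'.
  apply: linearDZ => *; apply: khomP => x; rewrite /s' /= ?kE /= -?kfD -?kfZ.
    by congr (s _); apply: khomP => y.
  by congr (s _); apply: khomP => y.
exists (Khom s'_lin); split=> [H H' b e|H H' a e|H h e]; apply: khomP => x /=.
- rewrite -[LHS]/(s (kflip H' x)) -[X in _ - br X _]/(s (kflip H b)).
  rewrite -(sr _ (Khom (pw_r_lin (kflip H b) x))) // -kfB; congr (s _).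
  by apply: khomP => y; rewrite kE /= e.
- by apply: sl => y /=; rewrite e.
- by apply: s1 => y /=; rewrite e.
Qed.

(* For [c = -1] this says that [D] is a retract of the bimodule of linear maps
   L -> D coinduced on the right. *)
Definition right_coinduced c D := exists s : khom (tw D) D,
  (forall a h, s (bl a h) = bl a (s h)) /\
  (forall h x, s (br h x) = br (s h) x + c *: (h : khom L D) x).

(** A derivation h satisfies x h = h x in [tw D], and s turns this into x s(h) = s(h) x + c h(x).
    The general constant serves the induction: the correction term of the twisted action changes c
    into -c at each shift. *)
Lemma right_coinduced_hv n c D : c != 0 -> right_coinduced c D -> hv n D.
Proof.
elim: n c D => [|n IH] c D c0 [s [sl sr]].
  move=> h hd; exists (c^-1 *: s h) => x.
  rewrite blZr brZl -scalerBr -sl.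
  by have /invar_tw -> := hd; rewrite sr addrC addKr scalerA mulVf // scale1r.
apply: (IH (- c)); first by rewrite oppr_eq0.
exists (kpost L s); split=> [a H|H x]; apply: khomP => y /=; first by rewrite sl.
by rewrite kfB sr opprD addrA scaleNr.
Qed.

Lemma hv_zero n D : (forall x : D, x = 0) -> hv n D.
Proof.
move=> h0; apply: left_coinduced_hv; exists 0.
by split=> *; rewrite kE [RHS]h0.
Qed.

End Acyclic.

Lemma innh0 k (L : fdAlgType k) (D : bim L) (m : D) : innh D m = 0 <-> invar m.
Proof.
split=> [e a|h]; last by apply: khomP => a; rewrite /= h subrr.
by apply/eqP; rewrite -subr_eq0 -[0]/((0 : khom L D) a) -e.
Qed.

(** Cuts the first short exact piece off 0 -> Z -> D0 -> D1 -> D2; the cokernel of Z in D0 is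
    realised as the cocycles of D1. *)
Lemma kerb_ses k (L : fdAlgType k) (Z D0 D1 D2 : bim L) (i : khom Z D0)
    (d0 : khom D0 D1) (d1 : khom D1 D2) (hi : bmor i) (h0 : bmor d0) (h1 : bmor d1) :
  (forall z, i z = 0 -> z = 0) -> (forall x, d0 x = 0 <-> exists z, i z = x) ->
  (forall x, d1 x = 0 <-> exists y, d0 y = x) ->
  exists p : khom D0 (kerb h1), [/\ forall x, skval (p x) = d0 x, bmor p & exact2 i p].
Proof.
move=> ii im ex; have [||p hp] := @khom_lift _ D0 (kerb h1) D1 (skinc _) d0.
- by move=> x /= e; apply: skval_inj.
- move=> x; have e0 : d1 (d0 x) = 0 by apply/ex; exists x.
  by exists (Subk (subspace_ker d1) e0).
have {}hp x : skval (p x) = d0 x := hp x.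
exists p; split=> //.
  by split=> *; apply: skval_inj; rewrite /= !hp ?(bmorl h0) ?(bmorr h0).
split=> [x /ii//|y e|x|z].
- by apply/im; rewrite -hp e.
- by apply: skval_inj; rewrite hp; apply/im; exists x.
- by have /ex[y e] := skP z; exists y; apply: skval_inj; rewrite hp.
Qed.

(** * Two commuting bimodule structures *)

Section TwoActions.
Variables (k : fieldType) (L1 L2 : fdAlgType k).

Record bibim := Bibim {
  bbcar :> lmodType k;
  bbl1 : L1 -> bbcar -> bbcar;
  bbr1 : bbcar -> L1 -> bbcar;
  bbl2 : L2 -> bbcar -> bbcar;
  bbr2 : bbcar -> L2 -> bbcar;
  bb1P : bim_axioms bbl1 bbr1;
  bb2P : bim_axioms bbl2 bbr2;
  bbll : forall a b x, bbl1 a (bbl2 b x) = bbl2 b (bbl1 a x);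
  bblr : forall a b x, bbl1 a (bbr2 x b) = bbr2 (bbl1 a x) b;
  bbrl : forall a b x, bbr1 (bbl2 b x) a = bbl2 b (bbr1 x a);
  bbrr : forall a b x, bbr1 (bbr2 x b) a = bbr2 (bbr1 x a) b
}.

Definition bb1 (E : bibim) : bim L1 := Bim (bb1P E).
Definition bb2 (E : bibim) : bim L2 := Bim (bb2P E).

Section Tw2.
Variable E : bibim.
Local Notation bl1 := (@bl _ _ _ (pw L2 (bb1 E))).
Local Notation br1 := (@br _ _ _ (pw L2 (bb1 E))).
Local Notation bl2 := (@bl _ _ _ (tw (bb2 E))).
Local Notation br2 := (@br _ _ _ (tw (bb2 E))).
Fact tw2ll a b h : bl1 a (bl2 b h) = bl2 b (bl1 a h).
Proof. by apply: khomP => x /=; rewrite bbll. Qed.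
Fact tw2lr a b h : bl1 a (br2 h b) = br2 (bl1 a h) b.
Proof.
by apply: khomP => x /=; rewrite [LHS](blBr (D := bb1 E)) /= bblr.
Qed.
Fact tw2rl a b h : br1 (bl2 b h) a = bl2 b (br1 h a).
Proof. by apply: khomP => x /=; rewrite bbrl. Qed.
Fact tw2rr a b h : br1 (br2 h b) a = br2 (br1 h a) b.
Proof.
by apply: khomP => x /=; rewrite [LHS](brBl (D := bb1 E)) /= bbrr.
Qed.
(** The dimension shift over L2 alone; L1 acts on values. *)
Definition tw2 : bibim := Bibim (bimP (pw L2 (bb1 E))) (bimP (tw (bb2 E)))
  tw2ll tw2lr tw2rl tw2rr.
End Tw2.

(** D and F are meant as two structures on one space, with [j] the identity between their carriers;
    [i] then identifies B with the invariants of D, keeping the action of N from F. *)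
Record invar_of (M N : fdAlgType k) (D : bim M) (F : bim N) (B : bim N)
    (i : khom B F) (j : F -> D) : Prop := InvOf {
  io_mor : bmor i;
  io_inj : forall x, i x = 0 -> x = 0;
  io_inv : forall b, invar (j (i b));
  io_img : forall x, invar (j x) -> exists b, i b = x
}.

Lemma inn1_bmor (E : bibim) : bmor (innh (bb2 E) : khom (bb1 E) (bb1 (tw2 E))).
Proof.
split=> *; apply: khomP => y /=.
  by rewrite [RHS](blBr (D := bb1 E)) /= bbll bblr.
by rewrite [RHS](brBl (D := bb1 E)) /= bbrl bbrr.
Qed.

(** A replacement for the double complex of E, whose total cohomology both sides compute. The
    L2-derivations B3 into E are the L2-invariants of [tw2 E] and, being all inner, also the
    cokernel of B2 in E; the L1-invariants of [tw2 E] are [tw B1]. So the induction passes from E to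
    [tw2 E]. *)
Lemma hv_two_actions n (E : bibim) (B1 : bim L2) (i1 : khom B1 E) (B2 : bim L1) (i2 : khom B2 E) :
  (forall m, hv m (bb1 E)) -> (forall m, hv m (bb2 E)) ->
  @invar_of _ _ (bb1 E) (bb2 E) B1 i1 id -> @invar_of _ _ (bb2 E) (bb1 E) B2 i2 id ->
  hv n B1 <-> hv n B2.
Proof.
elim: n E B1 i1 B2 i2 => [|n IH] E B1 i1 B2 i2 h1 h2 I1 I2;
  have dP (h : tw2 E) : innh (bb2 (tw2 E)) h = 0 <-> @der _ _ (bb2 E) h
    by apply: iff_trans (innh0 _) _; apply: (@invar_tw _ _ (bb2 E) h).
all: have im x : innh (bb2 E) x = 0 <-> exists z, i2 z = x
  by rewrite innh0; split=> [/(io_img I2)//|[z <-]]; exact: (io_inv I2).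
all: have ex h : innh (bb2 (tw2 E)) h = 0 <-> exists x, innh (bb2 E) x = h
  by rewrite dP; split=> [/(h2 0)[m hm]|[x <-]];
    [exists m; apply: khomP => a; rewrite hm | exact: inn_der].
all: have [p [hp p_mor e2]] := kerb_ses (io_mor I2) (inn1_bmor E) (inn1_bmor (tw2 E))
  (io_inj I2) im ex.
all: set B3 := kerb _ in p hp p_mor e2.
  (* In degree 1 both sides measure the derivations L2 -> B1 modulo the inner ones: an L1-invariant
     of B3 is a derivation with values in B1. *)
  have i2m : bmor (i2 : khom B2 (bb1 E)) := io_mor I2.
  split=> [hB1|hB2].
    apply: (ses_H1 i2m p_mor e2 (h1 0)) => y hy.
    have [|h hh] := @khom_lift _ L2 B1 E i1 (skval y) (io_inj I1).
      move=> a; apply: (io_img I1) => b.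
      by have /= := congr1 (fun z : B3 => kfun (skval z) a) (hy b).
    have [|b hb] := hB1 h.
      move=> a c; apply/eqP; rewrite -subr_eq0; apply/eqP/(io_inj I1).
      rewrite kfB kfD (bmorl (io_mor I1)) (bmorr (io_mor I1)) !hh.
      by have /dP -> := skP y; rewrite subrr.
    exists (i1 b); first exact: (io_inv I1).
    apply: skval_inj; rewrite hp; apply: khomP => a.
    by rewrite -hh hb kfB (bmorl (io_mor I1)) (bmorr (io_mor I1)).
  move=> h hd.
  have y0 : innh (bb2 (tw2 E)) (kcomp i1 h) = 0 by apply/dP/der_comp => //; exact: io_mor I1.
  have [|x hx e] := ses_invar_lift i2m p_mor e2 hB2 (y := Subk (subspace_ker _) y0).
    move=> b; apply: skval_inj; apply: khomP => a; exact: (io_inv I1).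
  have [b hb] := io_img I1 hx; exists b => a.
  apply/eqP; rewrite -subr_eq0; apply/eqP/(io_inj I1).
  rewrite !kfB (bmorl (io_mor I1)) (bmorr (io_mor I1)) hb.
  have := hp x; rewrite e => /(congr1 (fun f : khom _ _ => f a)) /= ->.
  by rewrite subrr.
have s : ses B2 (bb1 E) B3 by exists i2, p; split=> //; exact: (io_mor I2).
(* B2 and B3 are the ends of a short exact sequence whose middle term E is acyclic over L1. *)
have iff3 : hv n.+1 B2 <-> hv n B3.
  by split=> h; [apply: ses_hvB s _ h | apply: ses_hvA s h _].
rewrite iff3 hvS.
apply: (IH (tw2 E) (tw B1) (kpost L2 i1) B3 (skinc _)).
- by move=> m; apply: hv_pw.
- by move=> m; apply: (h2 m.+1).
- split.
  + exact: (bmor_tw (D := B1) (D' := bb2 E) (io_mor I1)).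
  + by move=> h e; apply: khomP => x; apply: (io_inj I1); have := congr1 (fun f : khom _ _ => f x) e.
  + by move=> h a; apply: khomP => x; apply: (io_inv I1).
  + move=> h hh; have [|g hg] := @khom_lift _ L2 B1 E i1 h (io_inj I1).
      by move=> a; apply: (io_img I1) => b; have := congr1 (fun f : khom _ _ => f a) (hh b).
    by exists g; apply: khomP.
- split.
  + by split.
  + by move=> x e; apply: skval_inj.
  + by move=> b; apply: (@invar_tw _ _ (bb2 E) _).2; apply/dP/(skP b).
  + by move=> x /(@invar_tw _ _ (bb2 E) _).1/dP h; exists (Subk (subspace_ker _) h).
Qed.

End TwoActions.

(** * Acyclic coresolutions *)

Section Resolution.
Variables (k : fieldType) (L : fdAlgType k).

(** Replacing Z by the cocycles in [D 1] and dropping [D 0] lowers the degree by one, until [ses_H1]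
    and [ses_invar_lift] settle degree 1. *)
Lemma hv_coresolution n (D : nat -> bim L) (d : forall q, khom (D q) (D q.+1))
    (Z : bim L) (i : khom Z (D 0)) :
  (forall q m, hv m (D q)) -> (forall q, bmor (d q)) ->
  (forall q x, d q.+1 x = 0 <-> exists y, d q y = x) ->
  bmor i -> (forall z, i z = 0 -> z = 0) -> (forall x, d 0 x = 0 <-> exists z, i z = x) ->
  hv n Z <-> (forall x : D n.+1, invar x -> d n.+1 x = 0 ->
    exists2 y : D n, invar y & d n y = x).
Proof.
elim: n D d Z i => [|n IH] D d Z i hD hd ex hi ii im;
  have [p [hp p_mor e2]] := kerb_ses hi (hd 0) (hd 1) ii im (ex 0);
  set K := kerb _ in p hp p_mor e2.
  split=> [hZ x hx dx|h].
    have [|y hy e] := ses_invar_lift hi p_mor e2 hZ (y := Subk (subspace_ker _) dx).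
      by move=> a; apply: skval_inj; apply: hx.
    by exists y => //; rewrite -hp e.
  apply: (ses_H1 hi p_mor e2 (hD 0 0)) => y hy.
  have [a|y' hy' e] := h _ _ (skP y); first exact: (congr1 (@skval _ _ _ _) (hy a)).
  by exists y' => //; apply: skval_inj; rewrite hp.
have s : ses Z (D 0) K by exists i, p; split.
have -> : hv n.+1 Z <-> hv n K.
  by split=> h; [apply: ses_hvB s (hD _ _) h | apply: ses_hvA s h (hD _ _)].
apply: (IH (fun q => D q.+1) (fun q => d q.+1) K (skinc _)) => //.
- by move=> z e; apply: skval_inj.
- by move=> x; split=> [h|[z <-]]; [exists (Subk (subspace_ker _) h) | exact: (skP z)].
Qed.

End Resolution.

(** * Projective modules and resolutions *)

Definition lin_of (R : pzRingType) (X Y : lmodType R) (f : X -> Y) (hf : linear f) :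
  {linear X -> Y} := HB.pack f (GRing.isLinear.Build R X Y *:%R f hf).

(** * Free modules as functions of finite support *)

Section FreeModule.
Variables (R : pzRingType) (X : eqType).

Definition fsupp (f : X -> R) (s : seq X) : Prop := forall x, x \notin s -> f x = 0.

Record fmod := Fmod { fmval :> X -> R; fmP : exists s, fsupp fmval s }.

Lemma fmod_inj (f g : fmod) : (forall x, f x = g x) -> f = g.
Proof.
case: f g => f hf [g hg] /= /funext e; rewrite e in hf *.
by congr Fmod; apply: Prop_irrelevance.
Qed.

HB.instance Definition _ := gen_eqMixin fmod.
HB.instance Definition _ := gen_choiceMixin fmod.

Fact fm0_subproof : exists s, fsupp (fun=> 0) s. Proof. by exists [::]. Qed.
Fact fmD_subproof (f g : fmod) : exists s, fsupp (fun x => f x + g x) s.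
Proof.
have [[s hs] [t ht]] := (fmP f, fmP g); exists (s ++ t) => x.
by rewrite mem_cat negb_or => /andP[/hs-> /ht->]; rewrite addr0.
Qed.
Fact fmZ_subproof a (f : fmod) : exists s, fsupp (fun x => a * f x) s.
Proof. by have [s hs] := fmP f; exists s => x /hs->; rewrite mulr0. Qed.
Definition fm0 := Fmod fm0_subproof.
Definition fmD f g := Fmod (fmD_subproof f g).
Definition fmZ a f := Fmod (fmZ_subproof a f).
Fact fmDA : associative fmD.
Proof. by move=> f g h; apply: fmod_inj => x /=; rewrite addrA. Qed.
Fact fmDC : commutative fmD.
Proof. by move=> f g; apply: fmod_inj => x /=; rewrite addrC. Qed.
Fact fmD0 : left_id fm0 fmD.
Proof. by move=> f; apply: fmod_inj => x /=; rewrite add0r. Qed.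
Fact fmDN : left_inverse fm0 (fmZ (-1)) fmD.
Proof. by move=> f; apply: fmod_inj => x /=; rewrite mulN1r addNr. Qed.
HB.instance Definition _ := GRing.isZmodule.Build fmod fmDA fmDC fmD0 fmDN.
Fact fmZA a b f : fmZ a (fmZ b f) = fmZ (a * b) f.
Proof. by apply: fmod_inj => x /=; rewrite mulrA. Qed.
Fact fmZ1 : left_id 1 fmZ.
Proof. by move=> f; apply: fmod_inj => x /=; rewrite mul1r. Qed.
Fact fmZDr : right_distributive fmZ +%R.
Proof. by move=> a f g; apply: fmod_inj => x /=; rewrite mulrDr. Qed.
Fact fmZDl f : {morph fmZ^~ f : a b / a + b}.
Proof. by move=> a b; apply: fmod_inj => x /=; rewrite mulrDl. Qed.
HB.instance Definition _ := GRing.Zmodule_isLmodule.Build R fmod fmZA fmZ1 fmZDr fmZDl.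

(** The summand g is later only assumed additive in the coefficient, because it will be a map such
    as c |-> h c q, which is not R-linear. A support is picked by choice; [fsumE] makes the value
    independent of it. *)
Definition fsum (W : zmodType) (g : X -> R -> W) (f : fmod) : W :=
  \sum_(x <- undup (sval (cid (fmP f)))) g x (f x).

Section FsumTheory.
Variables (W : zmodType) (g : X -> R -> W).
Hypothesis gD : forall x a b, g x (a + b) = g x a + g x b.

Lemma fsum_g0 x : g x 0 = 0.
Proof. by apply: (addrI (g x 0)); rewrite -gD !addr0. Qed.

Lemma fsumE (f : fmod) s : uniq s -> fsupp f s -> fsum g f = \sum_(x <- s) g x (f x).
Proof.
have H s1 s2 : fsupp f s1 -> fsupp f s2 ->
    \sum_(x <- s1) g x (f x) = \sum_(x <- [seq x <- s1 | x \in s2]) g x (f x).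
  move=> _ h2; rewrite big_filter [LHS](bigID (mem s2)) /= [X in _ + X]big1 ?addr0 //.
  by move=> x /h2->; exact: fsum_g0.
rewrite /fsum; set t := sval _; have ht : fsupp f (undup t).
  by move=> x; rewrite mem_undup => h; apply: (svalP (cid (fmP f))).
move=> us hs; rewrite (H _ _ ht hs) (H _ _ hs ht); apply: perm_big.
apply: uniq_perm; rewrite ?filter_uniq ?undup_uniq // => x.
by rewrite !mem_filter andbC.
Qed.

Lemma fsumD f1 f2 : fsum g (f1 + f2) = fsum g f1 + fsum g f2.
Proof.
have [[s hs] [t ht]] := (fmP f1, fmP f2).
have us := undup_uniq (s ++ t); have mem x : x \notin undup (s ++ t) -> f1 x = 0 /\ f2 x = 0.
  by rewrite mem_undup mem_cat negb_or => /andP[/hs-> /ht->].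
rewrite !(fsumE us) => [|x /mem[]//|x /mem[]//|x /mem[e1 e2]]; last first.
  by rewrite -[_ x]/(f1 x + f2 x) e1 e2 addr0.
by rewrite -big_split; apply: eq_bigr => x _; exact: gD.
Qed.

End FsumTheory.

Lemma eq_fsum (W : zmodType) (g g' : X -> R -> W) f :
  (forall x a, g x a = g' x a) -> fsum g f = fsum g' f.
Proof. by move=> e; apply: eq_bigr => x _; apply: e. Qed.

Lemma fsumZ (W : zmodType) (g : X -> R -> W) a (f : fmod) :
  (forall x b c, g x (b + c) = g x b + g x c) ->
  fsum g (a *: f) = fsum (fun x b => g x (a * b)) f.
Proof.
move=> gD; have [s hs] := fmP f; have us := undup_uniq s.
have h x : x \notin undup s -> f x = 0 by rewrite mem_undup => /hs.
rewrite (fsumE gD us) => [|x /h]; last by rewrite -[(a *: f) x]/(a * f x) => ->; rewrite mulr0.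
by rewrite (fsumE _ us) // => x b c; rewrite mulrDr gD.
Qed.

Lemma fsum_morph (W W' : zmodType) (F : W -> W') (g : X -> R -> W) f :
  F 0 = 0 -> (forall u v, F (u + v) = F u + F v) -> F (fsum g f) = fsum (fun x a => F (g x a)) f.
Proof. by move=> F0 FD; rewrite /fsum (big_morph F FD F0). Qed.

Fact fmdelta_subproof (x : X) : exists s, fsupp (fun y => (y == x)%:R : R) s.
Proof. by exists [:: x] => y; rewrite inE => /negPf->. Qed.
Definition fmdelta x := Fmod (fmdelta_subproof x).

Lemma fsum_delta (W : zmodType) (g : X -> R -> W) x :
  (forall y b c, g y (b + c) = g y b + g y c) -> fsum g (fmdelta x) = g x 1.
Proof.
move=> gD; rewrite (@fsumE _ _ gD _ [:: x]) ?big_seq1 /= ?eqxx //.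
by move=> y; rewrite inE /= => /negPf->.
Qed.

Lemma fmod_decomp (f : fmod) : fsum (fun x a => a *: fmdelta x) f = f.
Proof.
have [s hs] := fmP f; have us := undup_uniq s.
rewrite (fsumE _ us) => [|x a b|x]; last by rewrite mem_undup => /hs.
  apply: fmod_inj => y.
  rewrite (big_morph (fun h : fmod => h y) (_ : {morph _ : u v / u + v >-> u + v}) (_ : _ = 0)) //.
  rewrite (eq_bigr (fun x => if x == y then f y else 0)); last first.
    move=> x _; rewrite -[LHS]/(f x * (y == x)%:R) eq_sym.
    by case: eqP => [->|_]; rewrite ?mulr1 ?mulr0.
  have [yt|yt] := boolP (y \in undup s).
    rewrite (bigD1_seq y) //= eqxx big1 ?addr0 // => x /negPf->//.
  have fy : f y = 0 by apply: hs; rewrite -mem_undup.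
  by rewrite fy big1 // => x _; case: eqP.
exact: scalerDl.
Qed.

End FreeModule.

Section FreeLift.
Variables (R : pzRingType) (X : eqType) (M : lmodType R) (h : X -> M).

Definition flift (f : fmod R X) : M := fsum (fun x a => a *: h x) f.

Fact flift_lin : linear flift.
Proof.
have D x (a b : R) : (a + b) *: h x = a *: h x + b *: h x by exact: scalerDl.
move=> a f g; rewrite /flift fsumD // fsumZ //.
rewrite (fsum_morph (F := fun u => a *: u)) ?scaler0 // => [|u v]; last exact: scalerDr.
by congr (_ + _); apply: eq_fsum => x b; rewrite scalerA.
Qed.
HB.instance Definition _ := GRing.isLinear.Build R (fmod R X) M _ flift flift_lin.

Lemma flift_delta x : flift (fmdelta R x) = h x.
Proof. by rewrite /flift fsum_delta ?scale1r // => *; exact: scalerDl. Qed.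

End FreeLift.

(** * Projective covers, resolutions and projective dimension *)

Section Projectives.
Variable R : pzRingType.
Implicit Types M : lmodType R.

Lemma fmod_ext X M (f g : {linear fmod R X -> M}) :
  (forall x, f (fmdelta R x) = g (fmdelta R x)) -> f =1 g.
Proof.
move=> e u; rewrite -(fmod_decomp u) !(fsum_morph (F := f), fsum_morph (F := g)) ?linear0 //;
  try by move=> *; rewrite linearD.
by apply: eq_fsum => x a; rewrite !linearZ /= e.
Qed.

Lemma fmod_projective X : projective (fmod R X).
Proof.
move=> U V g f gs; have [h hh] := choice (fun x : X => gs (f (fmdelta R x))).
exists (flift h) => u; pose gh : {linear fmod R X -> V} := g \o flift h.
by rewrite -[LHS]/(gh u); apply: fmod_ext => x; rewrite /= flift_delta.
Qed.

Definition fcover M : {linear fmod R M -> M} := flift (fun x : M => x).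

Lemma fcover_surj M (x : M) : exists u, fcover M u = x.
Proof. by exists (fmdelta R x); rewrite /= flift_delta. Qed.

(** The free module is on the underlying set of P, so t p writes p as a finite sum of c_q q with q
    in P. The retractions that prove acyclicity are built from these coefficients. *)
Lemma projective_section (P : lmodType R) : projective P ->
  exists t : {linear P -> fmod R P}, forall x, fcover P (t x) = x.
Proof. by move=> hP; apply: (hP _ _ (fcover P) idfun (@fcover_surj P)). Qed.

Lemma projective_retract (P Q : lmodType R) (i : {linear P -> Q}) (r : {linear Q -> P}) :
  (forall x, r (i x) = x) -> projective Q -> projective P.
Proof.
move=> ri hQ U V g f gs; have [h hh] := hQ U V g (f \o r) gs.
by exists (h \o i) => x; rewrite /= hh /= ri.
Qed.

Lemma subspace_mker M (N : lmodType R) (f : {linear M -> N}) : subspace (fun x => f x = 0).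
Proof. by split=> [|a x y hx hy]; rewrite ?linear0 // linearP hx hy scaler0 addr0. Qed.

Definition mker M (N : lmodType R) (f : {linear M -> N}) : lmodType R := subk (subspace_mker f).
Definition mkinc M (N : lmodType R) (f : {linear M -> N}) : {linear mker f -> M} :=
  @skval _ _ _ (subspace_mker f).

Section Builder.
Variables (M : lmodType R) (cov : nat -> forall K : lmodType R, {Q : lmodType R & {linear Q -> K}}).

Fixpoint syzygy n : lmodType R :=
  if n is n'.+1 then mker (projT2 (cov n' (syzygy n'))) else M.

Hypothesis cov_surj : forall n (K : lmodType R) (x : K), exists y, projT2 (cov n K) y = x.
Hypothesis cov_proj : forall n, projective (projT1 (cov n (syzygy n))).

(** The cover depends on the degree, so that a resolution can be stopped by taking an identity map
    as cover once a syzygy is projective. *)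
Lemma build_resolution : exists P : proj_resolution M,
  forall n, P n = projT1 (cov n (syzygy n)).
Proof.
pose d n : {linear projT1 (cov n.+1 (syzygy n.+1)) -> projT1 (cov n (syzygy n))} :=
  mkinc _ \o projT2 (cov n.+1 (syzygy n.+1)).
have hx n x : projT2 (cov n (syzygy n)) x = 0 <-> exists y, d n y = x.
  split=> [h|[y <-]]; last by rewrite /d /=; apply: (skP (projT2 (cov n.+1 (syzygy n.+1)) y)).
  have [y e] := @cov_surj n.+1 (syzygy n.+1) (Subk (subspace_mker _) h : mker _).
  by exists y; rewrite /d /= e.
have hS n x : d n x = 0 <-> exists y, d n.+1 y = x.
  rewrite -hx /d /=; split=> [h|->]; last exact: linear0.
  exact: skval_inj.
by exists (@ProjResolution R M (fun n => projT1 (cov n (syzygy n))) d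
  (projT2 (cov 0 M)) cov_proj (@cov_surj 0 M) (hx 0) hS).
Qed.

End Builder.

Lemma resolution_exists M : exists P : proj_resolution M, True.
Proof.
have [|n|P _] := @build_resolution M (fun _ K => existT (fun Q : lmodType R => {linear Q -> K}) (fmod R K : lmodType R) (fcover K)).
- by move=> n K; apply: fcover_surj.
- exact: fmod_projective.
- by exists P.
Qed.

(* The projective dimension of [Y] is less than [n]. *)
Fixpoint pdlt n (Y : lmodType R) : Prop :=
  if n is n'.+1 then exists (Q K : lmodType R) (i : {linear K -> Q}) (p : {linear Q -> Y}),
    [/\ projective Q, forall x, i x = 0 -> x = 0, forall x, p x = 0 <-> (exists y, i y = x),
        forall y, (exists x, p x = y) & pdlt n' K]
  else forall y : Y, y = 0.

(** Dropping [P 0] leaves a resolution, shorter by one, of the kernel of the augmentation. *)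
Lemma resolution_pdlt n M (P : proj_resolution M) :
  (forall m, (n <= m)%N -> forall x : P m, x = 0) -> pdlt n M.
Proof.
elim: n M P => [|n IH] M P h.
  by move=> y; have [x <-] := res_aug_surj P y; rewrite (h 0 isT x) linear0.
exists (P 0), (mker (res_aug P)), (mkinc _), (res_aug P); split=> //.
- exact: res_projective.
- by move=> x e; apply: skval_inj.
- by move=> x; split=> [e|[y <-]]; [exists (Subk (subspace_mker _) e) | exact: (skP y)].
- exact: res_aug_surj.
have h0 x : res_aug P (res_d P 0 x) = 0 by apply/res_exact0; exists x.
pose a x : mker (res_aug P) := Subk (subspace_mker _) (h0 x).
have a_lin : linear a by move=> c x y; apply: skval_inj; rewrite /= linearP.
have a_surj y : exists x, lin_of a_lin x = y.
  by have /res_exact0[x e] := skP y; exists x; apply: skval_inj.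
have a0 x : lin_of a_lin x = 0 <-> exists y, res_d P 1 y = x.
  rewrite -res_exactS; split=> [e|e]; last exact: skval_inj.
  exact: (congr1 (@skval _ _ _ _) e).
apply: (IH _ (@ProjResolution R _ (fun m => P m.+1) (fun m => res_d P m.+1) (lin_of a_lin)
  (fun m => @res_projective _ _ P m.+1) a_surj a0 (fun m => @res_exactS _ _ P m.+1))).
by move=> m hm; apply: h.
Qed.

Lemma gldim_pdlt : gldim_finite R -> exists d, forall M, pdlt d M.
Proof.
by move=> [d hd]; exists d.+1 => M; have [P hP] := hd M; apply: resolution_pdlt hP.
Qed.

End Projectives.

(** * Ext over an algebra as Hochschild cohomology *)

(** The module M seen over k. Having [j] as an argument lets one construction serve algebras, their
    converses and enveloping algebras. *)
Definition kres (k : fieldType) (S : pzRingType) (j : {rmorphism k -> S}) (M : lmodType S) :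
  Type := M.

Section RestrictScalars.
Variables (k : fieldType) (S : pzRingType) (j : {rmorphism k -> S}) (M : lmodType S).
Local Notation kres := (kres j M).

HB.instance Definition _ := GRing.Zmodule.on kres.
Definition kres_scale (a : k) (m : kres) : kres := j a *: (m : M).
Fact kres_scaleA a b m : kres_scale a (kres_scale b m) = kres_scale (a * b) m.
Proof. by rewrite /kres_scale scalerA rmorphM. Qed.
Fact kres_scale1 : left_id 1 kres_scale.
Proof. by move=> m; rewrite /kres_scale rmorph1 scale1r. Qed.
Fact kres_scaleDr : right_distributive kres_scale +%R.
Proof. by move=> a m n; rewrite /kres_scale scalerDr. Qed.
Fact kres_scaleDl m : {morph kres_scale^~ m : a b / a + b}.
Proof. by move=> a b; rewrite /kres_scale rmorphD scalerDl. Qed.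
HB.instance Definition _ := GRing.Zmodule_isLmodule.Build k kres
  kres_scaleA kres_scale1 kres_scaleDr kres_scaleDl.

Lemma kresZ a (m : kres) : a *: m = j a *: (m : M). Proof. by []. Qed.

End RestrictScalars.

Section KresMap.
Variables (k : fieldType) (S : pzRingType) (j : {rmorphism k -> S}) (M N : lmodType S).
Fact klin_lin (f : {linear M -> N}) : linear (f : kres j M -> kres j N).
Proof. by move=> a x y; rewrite kresZ linearP. Qed.
Definition klin f : khom (kres j M) (kres j N) := Khom (klin_lin f).
End KresMap.

Section AlgebraScalars.
Variables (k : fieldType) (L : fdAlgType k).

Definition kin (a : k) : L := a *: (1 : L).
Fact kin_zmod : zmod_morphism kin. Proof. by move=> a b; rewrite /kin scalerBl. Qed.
Fact kin_monoid : monoid_morphism kin.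
Proof. by split=> [|a b]; rewrite /kin ?scale1r // algZl mul1r scalerA. Qed.
HB.instance Definition _ := GRing.isZmodMorphism.Build k L kin kin_zmod.
HB.instance Definition _ := GRing.isMonoidMorphism.Build k L kin kin_monoid.

Lemma kinl a (x : L) : kin a * x = a *: x. Proof. by rewrite algZl mul1r. Qed.
Lemma kinr a (x : L) : x * kin a = a *: x. Proof. by rewrite algZr mulr1. Qed.

(* The action need not be unital; [lm0] below is an instance. *)
Record lm_axioms (M : lmodType k) (l : L -> M -> M) : Prop := LmAxioms {
  axaDl : forall a b x, l (a + b) x = l a x + l b x;
  axaZl : forall c a x, l (c *: a) x = c *: l a x;
  axaDr : forall a x y, l a (x + y) = l a x + l a y;
  axaZr : forall a c x, l a (c *: x) = c *: l a x;
  axaA : forall a b x, l a (l b x) = l (a * b) x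
}.

Record lm := Lm { lmcar :> lmodType k; la : L -> lmcar -> lmcar; lmP : lm_axioms la }.

Implicit Types M N W : lm.
Lemma laDl M a b (x : M) : la (a + b) x = la a x + la b x. Proof. exact: axaDl (lmP M) _ _ _. Qed.
Lemma laZl M c a (x : M) : la (c *: a) x = c *: la a x. Proof. exact: axaZl (lmP M) _ _ _. Qed.
Lemma laDr M a (x y : M) : la a (x + y) = la a x + la a y. Proof. exact: axaDr (lmP M) _ _ _. Qed.
Lemma laZr M a c (x : M) : la a (c *: x) = c *: la a x. Proof. exact: axaZr (lmP M) _ _ _. Qed.
Lemma laA M a b (x : M) : la a (la b x) = la (a * b) x. Proof. exact: axaA (lmP M) _ _ _. Qed.
Definition laE := (laDl, laZl, laDr, laZr).
Lemma la0r M a : la a (0 : M) = 0.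
Proof. by rewrite -(scale0r (0 : M)) laZr !scale0r. Qed.
Lemma la0l M (x : M) : la 0 x = 0.
Proof. by apply: (addrI (la 0 x)); rewrite -laDl !addr0. Qed.
Lemma laNr M a (x : M) : la a (- x) = - la a x.
Proof. by rewrite -scaleN1r laZr scaleN1r. Qed.
Lemma laNl M a (x : M) : la (- a) x = - la a x.
Proof. by apply/eqP; rewrite -addr_eq0 -laDl addNr la0l. Qed.
Lemma laBr M a (x y : M) : la a (x - y) = la a x - la a y.
Proof. by rewrite laDr laNr. Qed.
Lemma laBl M a b (x : M) : la (a - b) x = la a x - la b x.
Proof. by rewrite laDl laNl. Qed.

Section Lhom.
Variables M W : lm.
Fact lhom_l_lin (a : L) (h : khom M W) : linear (fun x => la a (h x)).
Proof. by apply: linearDZ => *; rewrite ?(kfD, kfZ) laE. Qed.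
Fact lhom_r_lin (h : khom M W) (a : L) : linear (fun x => h (la a x)).
Proof. by apply: linearDZ => *; rewrite laE ?(kfD, kfZ). Qed.
Fact lhom_axioms :
  bim_axioms (fun a h => Khom (lhom_l_lin a h)) (fun h a => Khom (lhom_r_lin h a)).
Proof.
by split=> *; apply: khomP => ? /=; rewrite ?kE ?laE ?(kfD, kfZ) ?laA.
Qed.
(* The Hochschild cohomology of [lhom M W] is Ext(M, W). *)
Definition lhom : bim L := Bim lhom_axioms.
End Lhom.

Lemma lhom_ses (K M N W : lm) (i : khom K M) (p : khom M N) :
  (forall (a : L) x, i (la a x) = la a (i x)) -> (forall (a : L) x, p (la a x) = la a (p x)) ->
  exact2 i p -> ses (lhom N W) (lhom M W) (lhom K W).
Proof.
move=> hi hp e; exists (kpre W p), (kpre W i); split; last exact: kpre_exact.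
  by split=> *; apply: khomP => x /=; rewrite ?hp.
by split=> *; apply: khomP => x /=; rewrite ?hi.
Qed.

End AlgebraScalars.

Lemma fsumB (R : pzRingType) (X : eqType) (W : zmodType) (g1 g2 : X -> R -> W) (f : fmod R X) :
  fsum (fun x a => g1 x a - g2 x a) f = fsum g1 f - fsum g2 f.
Proof. by rewrite /fsum sumrB. Qed.

(** * Modules pulled back along an algebra map, and dimension shifting *)

Section ModulesOfAlgebra.
Variables (k : fieldType) (N L : fdAlgType k) (al : khom N L).
Hypothesis alM : forall a b : N, al (a * b) = al a * al b.

Fact ofmod_axioms (M : lmodType L) :
  lm_axioms (fun (a : N) (m : kres (@kin k L) M) => al a *: (m : M) : kres (@kin k L) M).
Proof.
split=> *; rewrite ?(kfD, kfZ) ?kresZ ?scalerDl ?scalerDr ?scalerA ?alM //.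
  by rewrite kinl.
by rewrite kinl kinr.
Qed.
Definition ofmod (M : lmodType L) : lm N := Lm (ofmod_axioms M).

Lemma ofmod_ses (K M P : lmodType L) (W : lm N) (i : {linear K -> M}) (p : {linear M -> P}) :
  (forall x, i x = 0 -> x = 0) -> (forall x, p x = 0 <-> exists y, i y = x) ->
  (forall y, exists x, p x = y) ->
  ses (lhom (ofmod P) W) (lhom (ofmod M) W) (lhom (ofmod K) W).
Proof.
move=> ii ex ps; apply: (@lhom_ses _ _ (ofmod K) (ofmod M) (ofmod P) W (klin (@kin k L) i) (klin (@kin k L) p)).
- by move=> a x /=; rewrite linearZ.
- by move=> a x /=; rewrite linearZ.
- split=> //= x; first by move/ex.
  by apply/ex; exists x.
Qed.

(** The offset c allows for projective L-modules that are no longer projective after pulling back to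
    N; each syzygy step then costs one degree. *)
Lemma hv_pdlt (W : lm N) c : (forall Q : lmodType L, projective Q ->
    forall n, (c <= n)%N -> hv n (lhom (ofmod Q) W)) ->
  forall d (Y : lmodType L), pdlt d Y -> forall n, (c + d <= n)%N -> hv n (lhom (ofmod Y) W).
Proof.
move=> hQ; elim=> [|d IH] Y.
  by move=> Y0 n _; apply: hv_zero => h; apply: khomP => x; rewrite (Y0 x : x = 0 :> ofmod Y) kf0.
move=> [Q [K [i [p [Qp ii ex ps Kd]]]]] [|n]; rewrite addnS // ltnS => hn.
apply: (ses_hvA (ofmod_ses W ii ex ps)); first exact: IH.
by apply: hQ => //; apply: leq_trans (leqW hn); apply: leq_addr.
Qed.

End ModulesOfAlgebra.

(** * Projectivity and global dimension through Ext *)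

Section ExtProjective.
Variables (k : fieldType) (L : fdAlgType k).
Local Notation md M := (@ofmod k L L (kid L) (fun a b => erefl) M).

(** If t p is the sum of the c_q q, then s h p is the sum of the h(c_q)(q). This retracts the right
    coinduced bimodule onto Hom_k(P, W). *)
Lemma lhom_projective (P : lmodType L) (W : lm L) n : projective P -> hv n (lhom (md P) W).
Proof.
move=> /projective_section[t ht]; apply: (@right_coinduced_hv _ _ n (-1)).
  by rewrite oppr_eq0 oner_neq0.
pose D := lhom (md P) W.
have gD (h : khom L D) q a b : h (a + b) q = h a q + h b q by rewrite kfD.
pose s0 (h : khom L D) (p : md P) : W := fsum (fun q c => h c q) (t p).
have s0_lin h : linear (s0 h).
  apply: linearDZ => [x y|a x]; rewrite /s0; first by rewrite linearD fsumD.
  rewrite kresZ linearZ /= fsumZ // (fsum_morph (F := fun u : W => a *: u)) ?scaler0 //.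
    by apply: eq_fsum => q c; rewrite kinl kfZ.
  exact: scalerDr.
have s_lin : linear (fun h => Khom (s0_lin h) : D).
  apply: linearDZ => [h h'|a h]; apply: khomP => x; rewrite kE /= /s0.
    by rewrite /fsum -big_split.
  by rewrite (fsum_morph (F := fun u : W => a *: u)) ?scaler0 // => *; rewrite scalerDr.
exists (Khom s_lin); split=> [a h|h x]; apply: khomP => p /=; rewrite /s0.
  by rewrite (fsum_morph (F := la a)) ?la0r // => u v; rewrite laDr.
rewrite fsumB scaleN1r; congr (_ - _).
  by rewrite linearZ fsumZ.
rewrite -[in RHS](ht p) /fcover /= /flift (fsum_morph (F := h x)) ?kf0 //.
by move=> u v; rewrite -kfD.
Qed.

Lemma gldim_hv : gldim_finite L ->
  exists d, forall n (Y : lmodType L) (W : lm L), (d <= n)%N -> hv n (lhom (md Y) W).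
Proof.
move=> /gldim_pdlt[d hd]; exists d => n Y W hn.
apply: (@hv_pdlt _ _ _ _ _ W 0 _ d) => // Q Qp m _; exact: lhom_projective.
Qed.

(** Let K be the kernel of the free cover of Z. Vanishing for W = K extends the identity of K to a
    linear map r on the free module, and z |-> s z - r (s z) is independent of the lift s, hence a
    splitting. *)
Lemma projective_H1 (Z : lmodType L) :
  (forall W : lmodType L, H1 (lhom (md Z) (md W))) -> projective Z.
Proof.
move=> h; pose K := mker (fcover Z); pose i := mkinc (fcover Z).
pose I := klin (@kin k L) i; pose F := klin (@kin k L) (fcover Z).
have hI a x : I (@la _ _ (md K) a x) = @la _ _ (md (fmod L Z)) a (I x) by exact: (linearZ_LR i).
have hF a x : F (@la _ _ (md (fmod L Z)) a x) = @la _ _ (md Z) a (F x) by exact: (linearZ_LR (fcover Z)).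
have e : exact2 I F.
  split=> [x|y|x|z] /=.
  - by move=> e; apply: skval_inj.
  - by move=> e; exists (Subk (subspace_mker (fcover Z)) e : K).
  - exact: skP x.
  - exact: fcover_surj.
have m1 : bmor (kpre (md K) F : khom (lhom (md Z) (md K)) (lhom (md (fmod L Z)) (md K))).
  by split=> *; apply: khomP => x; rewrite /= ?linearZ.
have m2 : bmor (kpre (md K) I : khom (lhom (md (fmod L Z)) (md K)) (lhom (md K) (md K))).
  by split=> *; apply: khomP => x; rewrite /= ?linearZ.
have [|r hr e2] := ses_invar_lift m1 m2 (kpre_exact (md K) e) (h K) (y := kid (md K)).
  by move=> a; apply: khomP.
have rK x : r (I x) = x by rewrite -[X in _ = X]/(kid (md K) x) -e2.
have rZ a x : r (a *: x : fmod L Z) = a *: (r x : K).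
  by have /= := congr1 (fun f : khom (md (fmod L Z)) (md K) => f x) (hr a).
have [s hs] := choice (@fcover_surj L Z).
have us z u : fcover Z u = z -> u - i (r u) = s z - i (r (s z)).
  move=> eu; apply: subr_swap.
  have e0 : fcover Z (u - s z) = 0 by rewrite linearB eu hs subrr.
  have [w hw] := ex_mid e e0.
  have rw : r (u - s z) = w by rewrite -hw rK.
  have rB : r u - r (s z) = w by rewrite -rw kfB.
  by rewrite -linearB rB -hw.
have s_lin : linear (fun z => s z - i (r (s z))).
  move=> a x y; rewrite -(us _ (a *: s x + s y)); last by rewrite linearP !hs.
  have -> : r (a *: s x + s y) = a *: r (s x) + r (s y) :> K by rewrite (kfD r) rZ.
  by rewrite (linearP i) opprD addrACA scalerBr.
apply: (@projective_retract _ _ _ (lin_of s_lin) (fcover Z)); last exact: fmod_projective.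
by move=> x; rewrite /= linearB hs (skP (r (s x))) subr0.
Qed.

(** A single degree suffices: shifting down to the n-th syzygy gives Ext^1 = 0 there, so it is
    projective. The resolution uses free covers below n, the identity at n, and is zero beyond. *)
Lemma gldim_of_hv n :
  (forall M W : lmodType L, hv n (lhom (md M) (md W))) -> gldim_finite L.
Proof.
move=> h; exists n => M.
pose cov (m : nat) (K : lmodType L) : {Q : lmodType L & {linear Q -> K}} := if (m < n)%N
  then existT (fun Q : lmodType L => {linear Q -> K}) (fmod L K : lmodType L) (fcover K)
  else existT (fun Q : lmodType L => {linear Q -> K}) K idfun.
have cov_surj m (K : lmodType L) (x : K) : exists y, projT2 (cov m K) y = x.
  by rewrite /cov; case: ifP => _; [exact: fcover_surj | exists x].
have cov_proj m (K : lmodType L) : (m < n)%N -> projective (projT1 (cov m K)).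
  by rewrite /cov => ->; exact: fmod_projective.
pose syz := syzygy M cov.
have hsyz m W : (m <= n)%N -> hv (n - m) (lhom (md (syz m)) (md W)).
  elim: m => [|m IH] mn; first by rewrite subn0.
  have := IH (ltnW mn); rewrite -[(n - m)%N]prednK ?subn_gt0 // -subnS => hm.
  have s : ses (lhom (md (syz m)) (md W)) (lhom (md (projT1 (cov m (syz m)))) (md W))
      (lhom (md (syz m.+1)) (md W)).
    apply: (@ofmod_ses _ _ _ _ _ _ _ _ (md W) (mkinc (projT2 (cov m (syz m))))).
    - by move=> x e; apply: skval_inj.
    - by move=> x; split=> [e|[y <-]]; [exists (Subk (subspace_mker _) e) | exact: (skP y)].
    - exact: cov_surj.
  apply: (ses_hvB s _ hm); apply: lhom_projective; exact: cov_proj.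
have projn : projective (syz n).
  by apply: projective_H1 => W; have := hsyz n W (leqnn n); rewrite subnn.
(* From degree n on the cover is an identity map, so the next syzygy, its kernel, is zero. *)
have zero m x : (n < m)%N -> x = 0 :> syz m.
  case: m x => // m; rewrite ltnS leqNgt => x mn; apply: skval_inj.
  by move: x; rewrite /= /cov (negPf mn) /= => x; exact: (skP x).
have proj m : projective (projT1 (cov m (syz m))).
  have [/cov_proj//|nm] := ltnP m n; rewrite /cov ltnNge nm /=.
  case: ltngtP nm => // [nm|<-//] _ X Y g f _.
  exists \0 => p; by rewrite (zero _ p nm) !linear0.
have [P hP] := build_resolution cov_surj proj; exists P => m nm.
rewrite hP /cov ltnNge (ltnW nm) /= => x; exact: zero.
Qed.

End ExtProjective.

(** * Tensor products and their duals *)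

Section TensorBasics.
Variables (R : pzRingType) (M : lmodType R^c) (N : lmodType R).

Lemma tensor_pureDl (m m' : M) (n : N) :
  tensor_pure (m + m') n = tensor_pure m n + tensor_pure m' n.
Proof.
rewrite -[RHS]raddfD; apply/tensor_piP; rewrite opprD addrA; exact: TRelDl.
Qed.

Lemma tensor_pureDr (m : M) (n n' : N) :
  tensor_pure m (n + n') = tensor_pure m n + tensor_pure m n'.
Proof.
rewrite -[RHS]raddfD; apply/tensor_piP; rewrite opprD addrA; exact: TRelDr.
Qed.

Lemma tensor_pureA (m : M) (r : R) (n : N) :
  tensor_pure ((r : R^c) *: m) n = tensor_pure m (r *: n).
Proof. by apply/tensor_piP; exact: TRelA. Qed.

Lemma tensor_ind (P : tensor M N -> Prop) :
  (forall m n, P (tensor_pure m n)) -> P 0 -> (forall s t, P s -> P t -> P (s - t)) ->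
  forall t, P t.
Proof.
move=> hp h0 hB t; rewrite -(tensor_repr t); move: (repr t) => {t} D.
have hN s : P s -> P (- s) by rewrite -sub0r; apply: hB.
have hD s t : P s -> P t -> P (s + t) by move=> hs ht; rewrite -[t]opprK; apply/hB/hN.
rewrite -(freeg_sumE D) raddf_sum; elim/big_ind: _ => // -[m n] _.
rewrite -[coeff _ _]intz -freegU_mulz raddfMz.
have hM i : P (tensor_pi << (m, n) >> *+ i).
  by elim: i => [|i IH]; rewrite ?mulr0n // mulrS; apply: hD => //; apply: hp.
by case: (coeff _ _) => i; [exact: hM | rewrite NegzE mulrNz; apply/hN/hM].
Qed.

Lemma tensor_ext (W : zmodType) (f g : tensor M N -> W) :
  zmod_morphism f -> zmod_morphism g ->
  (forall m n, f (tensor_pure m n) = g (tensor_pure m n)) -> f =1 g.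
Proof.
move=> hf hg e; apply: tensor_ind => // [|s t es et]; last by rewrite hf hg es et.
by rewrite -(subrr 0) hf hg !subrr.
Qed.

End TensorBasics.

Section ConverseScalars.
Variables (k : fieldType) (R : pzRingType) (j : {rmorphism k -> R}).
Definition cj (a : k) : R^c := j a.
Fact cj_zmod : zmod_morphism cj. Proof. by move=> a b; apply: (raddfB j). Qed.
Fact cj_monoid : monoid_morphism cj.
Proof. by split=> [|a b]; rewrite /cj ?[a * b]mulrC; [exact: (rmorph1 j) | exact: (rmorphM j)]. Qed.
HB.instance Definition _ := GRing.isZmodMorphism.Build k R^c cj cj_zmod.
HB.instance Definition _ := GRing.isMonoidMorphism.Build k R^c cj cj_monoid.
Definition cjr : {rmorphism k -> R^c} := cj.
End ConverseScalars.

Definition central (k : fieldType) (R : pzRingType) (j : {rmorphism k -> R}) : Prop :=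
  forall a x, j a * x = x * j a.

(** The same group as [tensor]; centrality of [j] is recorded in the type because the k-module
    structure depends on it. *)
Definition ktens (k : fieldType) (R : pzRingType) (j : {rmorphism k -> R}) (jC : central j)
  (M : lmodType R^c) (N : lmodType R) : Type := tensor M N.

Section KTensor.
Variables (k : fieldType) (R : pzRingType) (j : {rmorphism k -> R}) (jC : central j).
Variables (M : lmodType R^c) (N : lmodType R).
Local Notation T := (ktens jC M N).
HB.instance Definition _ := GRing.Zmodule.on T.

Fact ktens_act_lin a : linear (fun m : M => cjr j a *: m).
Proof.
move=> r x y; rewrite scalerDr !scalerA; congr (_ *: _ + _).
exact: (esym (jC a r)).
Qed.
Definition ktens_act a : {linear M -> M} := lin_of (ktens_act_lin a).

Definition ktens_scale a (t : T) : T := tensor_map (ktens_act a) t.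

Lemma ktens_scaleE a m n : ktens_scale a (tensor_pure m n) = tensor_pure (cjr j a *: m) n.
Proof. exact: tensor_mapE. Qed.

Fact ktens_scaleA a b t : ktens_scale a (ktens_scale b t) = ktens_scale (a * b) t.
Proof.
move: t; apply: tensor_ext => [s t|s t|m n]; rewrite /ktens_scale ?raddfB //.
by rewrite !tensor_mapE /= scalerA -rmorphM.
Qed.
Fact ktens_scale1 : left_id 1 ktens_scale.
Proof.
apply: (@tensor_ext _ _ _ _ (ktens_scale 1) id) => [s t|s t|m n]; rewrite /ktens_scale ?raddfB //.
by rewrite !tensor_mapE /= rmorph1 scale1r.
Qed.
Fact ktens_scaleDr : right_distributive ktens_scale +%R.
Proof. by move=> a s t; rewrite /ktens_scale raddfD. Qed.
Fact ktens_scaleDl t : {morph ktens_scale^~ t : a b / a + b}.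
Proof.
move=> a b; move: t; apply: (@tensor_ext _ _ _ _ (ktens_scale (a + b))
  (fun t => ktens_scale a t + ktens_scale b t)) => [s t|s t|m n].
- by rewrite /ktens_scale raddfB.
- by rewrite /ktens_scale !raddfB /= opprD addrACA.
- by rewrite !ktens_scaleE rmorphD scalerDl tensor_pureDl.
Qed.
HB.instance Definition _ := GRing.Zmodule_isLmodule.Build k T
  ktens_scaleA ktens_scale1 ktens_scaleDr ktens_scaleDl.

Definition tpure (m : M) (n : N) : T := tensor_pure m n.

Lemma tpureZl a m n : tpure (cjr j a *: m) n = a *: tpure m n.
Proof. exact: (esym (ktens_scaleE a m n)). Qed.
Lemma tpureZr a m n : tpure m (j a *: n) = a *: tpure m n.
Proof. by rewrite -tpureZl -[LHS]tensor_pureA. Qed.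

Lemma ktens_ext (W : lmodType k) (f g : khom T W) :
  (forall m n, f (tpure m n) = g (tpure m n)) -> f = g.
Proof.
move=> e; apply: khomP; apply: (@tensor_ext _ _ _ _ f g) => //.
  exact: (kfB f).
exact: (kfB g).
Qed.

Fact tpure_lin2 m : linear (tpure m : kres j N -> T).
Proof.
by apply: linearDZ => [x y|a x]; rewrite ?kresZ ?tpureZr // /tpure tensor_pureDr.
Qed.
Fact tpure_lin : linear (fun m : kres (cjr j) M => Khom (tpure_lin2 m)).
Proof.
apply: linearDZ => [x y|a x]; apply: khomP => n; rewrite ?kE /= ?kresZ ?tpureZl //.
by rewrite /tpure tensor_pureDl.
Qed.
Definition tpureh : khom (kres (cjr j) M) (khom (kres j N) T) := Khom tpure_lin.

Definition balanced (W : lmodType k) (b : khom (kres (cjr j) M) (khom (kres j N) W)) : Prop :=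
  forall (m : M) (r : R) (n : N), b ((r : R^c) *: m) n = b m (r *: n).

Section Lift.
Variables (W : lmodType k) (b : khom (kres (cjr j) M) (khom (kres j N) W)).
Hypothesis hb : balanced b.

Let pre (x : {freeg (M * N)%type / int}) : zmodule W :=
  fglift (fun mn => b mn.1 mn.2 : zmodule W) x.

Fact pre_additive : zmod_morphism pre. Proof. exact: lift_is_additive. Qed.
HB.instance Definition _ := GRing.isZmodMorphism.Build _ _ pre pre_additive.

Fact preU m n : pre << (m, n) >> = b m n.
Proof. by rewrite /pre liftU scale1r. Qed.

Fact pre_rel x : tensor_relation x -> pre x = 0.
Proof.
elim=> [|{}x y _ hx _ hy|m m' n|m n n'|m r n].
- exact: raddf0.
- by rewrite raddfB /= hx hy subr0.
- by rewrite !raddfB /= !preU (kfD b m m') kE addrAC addrK subrr.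
- by rewrite !raddfB /= !preU (kfD (b m) n n') addrAC addrK subrr.
- by rewrite !raddfB /= !preU hb subrr.
Qed.

Definition tlift_fun (t : T) : W := pre (repr t).

Fact tlift_pi x : tlift_fun (tensor_pi x) = pre x.
Proof.
apply/eqP; rewrite -subr_eq0 -[_ - _]/(pre _ - pre _) -raddfB; apply/eqP/pre_rel/tensor_piP.
exact: tensor_repr.
Qed.

Fact tlift_pure m n : tlift_fun (tpure m n) = b m n.
Proof. by rewrite /tpure /tensor_pure tlift_pi preU. Qed.

Fact tlift_zmod : zmod_morphism tlift_fun.
Proof.
move=> s t; rewrite -[s]tensor_repr -[t]tensor_repr -[_ - _]raddfB !tlift_pi.
exact: raddfB.
Qed.

Fact tlift_lin : linear tlift_fun.
Proof.
have D s t : tlift_fun (s + t) = tlift_fun s + tlift_fun t.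
  have h0 : tlift_fun 0 = 0 by rewrite -(subrr 0) tlift_zmod subrr.
  by rewrite -[t in LHS]opprK tlift_zmod -[- t]sub0r tlift_zmod h0 sub0r opprK.
apply: linearDZ => // a t; move: t.
apply: (@tensor_ext _ _ _ _ (fun t => tlift_fun (a *: (t : T))) (fun t => a *: tlift_fun t)).
- by move=> s t; rewrite scalerBr tlift_zmod.
- by move=> s t; rewrite tlift_zmod scalerBr.
- by move=> m n; rewrite -tpureZl !tlift_pure -[in RHS]kE -kfZ.
Qed.

Definition tlift : khom T W := Khom tlift_lin.

End Lift.
End KTensor.

Section TensorFunctor.
Variables (k : fieldType) (R : pzRingType) (j : {rmorphism k -> R}) (jC : central j).
Variables (M M' : lmodType R^c) (N : lmodType R) (f : {linear M -> M'}).

Fact tmap_lin : linear (tensor_map f : ktens jC M N -> ktens jC M' N).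
Proof.
apply: linearDZ => [s t|a t]; first exact: raddfD.
move: t; apply: (@tensor_ext _ _ _ _ (fun t => tensor_map f (a *: (t : ktens jC M N)) : ktens jC M' N)
   (fun t => a *: (tensor_map f t : ktens jC M' N))).
- by move=> s t; rewrite scalerBr raddfB.
- by move=> s t; rewrite raddfB scalerBr.
- move=> m n; rewrite -[a *: _]/(ktens_scale a _) ktens_scaleE !tensor_mapE.
  by rewrite -[RHS]/(ktens_scale a _) ktens_scaleE linearZ.
Qed.
Definition tmap : khom (ktens jC M N) (ktens jC M' N) := Khom tmap_lin.

End TensorFunctor.

(** * Complexes of balanced maps *)

Section DualComplex.
Variables (k : fieldType) (R : pzRingType) (j : {rmorphism k -> R}) (jC : central j).
Variables (M : lmodType R^c) (P : proj_resolution M) (N : lmodType R).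

Definition tensor_exact n := forall z : tensor (P n.+1) N, tensor_map (res_d P n) z = 0 ->
  exists w, tensor_map (res_d P n.+1) w = z.

(** Exactness at the same spot of the complex of k-linear maps from P (x) N to W, written with
    balanced maps. *)
Definition bal_exact (W : lmodType k) n :=
  forall b : khom (kres (cjr j) (P n.+1)) (khom (kres j N) W), balanced b ->
  (forall p, b (res_d P n.+1 p) = 0) ->
  exists2 b' : khom (kres (cjr j) (P n)) (khom (kres j N) W), balanced b' &
    forall p, b p = b' (res_d P n p).

(** Seen on the tensor product, a balanced cocycle kills the image of d (n+1), which is the kernel
    of d n, so it extends along d n. *)
Lemma tensor_exact_bal W n : tensor_exact n -> bal_exact W n.
Proof.
move=> ex b hb b0; pose d m := tmap jC N (res_d P m).
have [|g hg] := @khom_extend _ _ _ W (d n) (tlift jC hb).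
  move=> z /ex[w <-]; pose f := kcomp (tlift jC hb) (d n.+1).
  rewrite -[LHS]/(f w) (_ : f = 0) //; apply: ktens_ext => m t.
  rewrite /= -[tensor_map _ _]/(tensor_map _ (tensor_pure _ _)) tensor_mapE (tlift_pure jC hb).
  exact: (congr1 (fun f : khom (kres j N) W => f t) (b0 m)).
exists (kcomp (kpost (kres j N) g) (tpureh jC (P n) N)).
  by move=> m r t /=; congr (g _); apply: tensor_pureA.
move=> p; apply: khomP => t /=.
rewrite -(tlift_pure jC hb) -[LHS]/(tlift jC hb _) -hg /=; congr (g _).
exact: tensor_mapE.
Qed.

(** A linear form separating a cycle from the boundaries would be a balanced cocycle, hence a
    coboundary, and so vanish on that cycle. *)
Lemma bal_tensor_exact n : bal_exact k^o n -> tensor_exact n.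
Proof.
move=> ex z z0; apply: contrapT => hz; pose d m := tmap jC N (res_d P m).
have [||F [F0 Fz]] := @khom_separate _ _ (fun z => exists w, d n.+1 w = z) z.
- split=> [|a _ _ [x <-] [y <-]]; first by exists 0; rewrite kf0.
  by exists (a *: x + y); rewrite kfD kfZ.
- by [].
pose b := kcomp (kpost (kres j N) F) (tpureh jC (P n.+1) N).
have [||b' hb' e] := ex b.
- by move=> m r t /=; congr (F _); apply: tensor_pureA.
- move=> p; apply: khomP => t /=; apply: F0; exists (tpure jC p t); exact: tensor_mapE.
case: Fz; have -> : F = kcomp (tlift jC hb') (d n).
  apply: ktens_ext => m t; rewrite -[LHS]/(b m t) e /=.
  by rewrite -[tensor_map _ _]/(tensor_map _ (tensor_pure _ _)) tensor_mapE (tlift_pure jC hb').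
have dz : d n z = 0 by exact: z0.
by rewrite -[LHS]/(tlift jC hb' (d n z)) dz kf0.
Qed.

End DualComplex.

Lemma kpre_coexact (k : fieldType) (X Y Z W : lmodType k) (f : khom X Y) (g : khom Y Z) :
  (forall y, g y = 0 <-> exists x, f x = y) ->
  forall h, kpre W f h = 0 <-> exists h', kpre W g h' = h.
Proof.
move=> ex h; split=> [e|[h' <-]].
  have [|h' e'] := @khom_extend _ _ _ _ g h; last by exists h'; apply: khomP.
  by move=> y /ex[x <-]; apply: (congr1 (fun u : khom X W => u x) e).
apply: khomP => x /=; have e0 : g (f x) = 0 by apply/ex; exists x.
by rewrite e0 kf0.
Qed.

(** * Tor over an algebra *)

Section TorBimodule.
Variables (k : fieldType) (L : fdAlgType k).
Local Notation j := (kin L : {rmorphism k -> L}).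
Local Notation kr M := (kres (cjr j) M).
Local Notation kl N := (kres j N).

Lemma kin_central : central j.
Proof. by move=> a x; rewrite kinl kinr. Qed.

Lemma krE (M : lmodType L^c) a (m : kr M) : a *: m = ((a *: (1 : L) : L) : L^c) *: (m : M).
Proof. by []. Qed.

Section Def.
Variables (M : lmodType L^c) (N : lmodType L) (W : lmodType k).
Local Notation D := (khom (kr M) (khom (kl N) W)).

Fact rb_l_lin (a : L) (g : D) : linear (fun p : kr M => g ((a : L^c) *: (p : M))).
Proof.
apply: linearDZ => [x y|c x]; first by rewrite scalerDr (kfD g).
rewrite -kfZ !krE !scalerA; congr (kfun g _).
exact: (congr1 (fun r : L^c => r *: (x : M)) (kin_central c a)).
Qed.
Fact rb_r_lin2 (g : D) (b : L) p : linear (fun t : kl N => g p (b *: (t : N))).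
Proof.
apply: linearDZ => [x y|c x]; first by rewrite scalerDr (kfD (g p)).
by rewrite -kfZ !kresZ !scalerA (kinr c b) -(kinl c b).
Qed.
Fact rb_r_lin (g : D) (b : L) : linear (fun p => Khom (rb_r_lin2 g b p)).
Proof. by apply: linearDZ => *; apply: khomP => t; rewrite /= ?(kfD, kfZ). Qed.

Fact rbim_axioms : bim_axioms (fun a g => Khom (rb_l_lin a g)) (fun g b => Khom (rb_r_lin g b)).
Proof.
split=> [a b g|c a g|a g g'|a c g|g a b|g c a|g g' a|c g a|a b g|g a b|a g b];
  apply: khomP => p //=; try (by apply: khomP).
- by rewrite scalerDl (kfD g).
- rewrite -kfZ krE scalerA; congr (kfun g _).
  exact: (congr1 (fun r : L^c => r *: (p : M)) (esym (kinr c a))).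
- by apply: khomP => t /=; rewrite scalerDl (kfD (g p)).
- apply: khomP => t /=; rewrite -kfZ kresZ scalerA; congr (kfun (g p) _).
  exact: (congr1 (fun r : L => r *: (t : N)) (esym (kinl c a))).
- by rewrite scalerA.
- by apply: khomP => t /=; rewrite scalerA.
Qed.
(** Its invariants are the balanced maps M x N -> W, and its cohomology is Hom_k(Tor(M, N), W). *)
Definition rbim : bim L := Bim rbim_axioms.

End Def.

(** The sum is the one of [lhom_projective], but the left action now comes from P, so the retraction
    is from the left coinduced bimodule. *)
Lemma rbim_projective (P : lmodType L^c) (N : lmodType L) (W : lmodType k) n :
  projective P -> hv n (rbim P N W).
Proof.
move=> /projective_section[t ht]; apply: left_coinduced_hv.
pose D := rbim P N W.
have gD (h : khom L D) q a b : h (a + b) q = h a q + h b q by rewrite kfD.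
pose s0 (h : khom L D) (p : kr P) : khom (kl N) W := fsum (fun q (c : L^c) => h c q) (t p).
have tZ (a : L^c) p : t (a *: p) = a *: t p by rewrite linearZ.
have s0_lin h : linear (s0 h).
  apply: linearDZ => [x y|a x]; rewrite /s0; first by rewrite linearD fsumD.
  rewrite krE tZ fsumZ // (fsum_morph (F := fun u : khom (kl N) W => a *: u)) ?scaler0 //.
    apply: eq_fsum => q c /=; rewrite -[RHS]/((a *: h c) q) -kfZ.
    exact: (congr1 (fun r : L => h r q) (kinr a c)).
  exact: scalerDr.
have s_lin : linear (fun h => Khom (s0_lin h) : D).
  apply: linearDZ => [h h'|a h]; apply: khomP => x; rewrite kE /= /s0.
    by rewrite /fsum -big_split.
  rewrite (fsum_morph (F := fun u : khom (kl N) W => a *: u)) ?scaler0 // => *.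
  by rewrite scalerDr.
exists (Khom s_lin); split=> [h h' b e|h h' a e|h m e]; apply: khomP => p /=; rewrite /s0.
- apply: khomP => x /=; rewrite !(fsum_morph (F := fun u : khom (kl N) W => u _)) //.
  by apply: eq_fsum => q c; rewrite e.
- by rewrite tZ fsumZ //; apply: eq_fsum => q c; rewrite e.
- rewrite -[in RHS](ht p) /fcover /= /flift (fsum_morph (F := m)) ?kf0 //.
    by apply: eq_fsum => q c; rewrite e.
  by move=> u v; rewrite -kfD.
Qed.

Section Coresolution.
Variables (M : lmodType L^c) (P : proj_resolution M) (N : lmodType L) (W : lmodType k).

Let d q : khom (rbim (P q) N W) (rbim (P q.+1) N W) := kpre _ (klin (cjr j) (res_d P q)).
Let i : khom (rbim M N W) (rbim (P 0) N W) := kpre _ (klin (cjr j) (res_aug P)).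

Lemma rbim_hv n : bal_exact j P N W n -> hv n (rbim M N W).
Proof.
have mor (X Y : lmodType L^c) (f : {linear X -> Y}) :
    bmor (kpre _ (klin (cjr j) f) : khom (rbim Y N W) (rbim X N W)).
  split=> [a g|g b]; apply: khomP => p /=; first by rewrite linearZ.
  exact: khomP.
move=> ex; refine ((@hv_coresolution _ _ n (fun q => rbim (P q) N W) d _ i _ _ _ _ _ _).2 _).
- by move=> q m; apply: rbim_projective; apply: res_projective.
- by move=> q; apply: mor.
- by move=> q; apply: kpre_coexact => x; apply: res_exactS.
- exact: mor.
- move=> z e; apply: khomP => x; have [y <-] := res_aug_surj P x.
  exact: (congr1 (fun u : khom (kr (P 0)) (khom (kl N) W) => u y) e).
- by apply: kpre_coexact => x; exact: (@res_exact0 _ _ P x).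
move=> b hb b0; have [||b' hb' e] := ex b.
- by move=> p r t; apply: (congr1 (fun u : khom (kr (P n.+1)) (khom (kl N) W) => u p t) (hb r)).
- by move=> p; apply: (congr1 (fun u : khom (kr (P n.+2)) (khom (kl N) W) => u p) b0).
exists b'; last by apply: khomP => p; rewrite e.
by move=> r; apply: khomP => p; apply: khomP => t; apply: hb'.
Qed.

End Coresolution.

Lemma tor_hv (M : lmodType L^c) (N : lmodType L) (W : lmodType k) n :
  tor_zero M N n.+1 -> hv n (rbim M N W).
Proof.
move=> [P hP]; apply: (@rbim_hv _ P); apply: (tensor_exact_bal kin_central).
by move=> z hz; apply: hP.
Qed.

End TorBimodule.

(** * Hochschild homology *)

Section DualBimodule.
Variables (k : fieldType) (L R : fdAlgType k) (D : bim2 L R).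
Fact kbl_lin (a : L) : linear (fun x : D => bl a x).
Proof. by apply: linearDZ => *; rewrite bE. Qed.
Definition kbl a := Khom (kbl_lin a).
Fact kbr_lin (a : R) : linear (fun x : D => br x a).
Proof. by apply: linearDZ => *; rewrite bE. Qed.
Definition kbr a := Khom (kbr_lin a).

Fact kdual_axioms : bim_axioms (fun (a : R) (t : khom D k^o) => kcomp t (kbr a))
  (fun (t : khom D k^o) (a : L) => kcomp t (kbl a)).
Proof.
by split=> *; apply: khomP => x; rewrite /= ?bE ?(kfD, kfZ) ?blA ?brA ?blr.
Qed.
Definition kdual : bim2 R L := Bim kdual_axioms.

End DualBimodule.

Fact regb_axioms k (L : fdAlgType k) : bim_axioms (fun a x : L => a * x) (fun x a : L => x * a).
Proof. by split=> *; rewrite ?mulrDl ?mulrDr ?algZl ?algZr ?mulrA. Qed.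
Definition regb k (L : fdAlgType k) : bim L := Bim (@regb_axioms k L).
Definition dualb k (L : fdAlgType k) : bim L := kdual (regb L).

Section EnvScalars.
Variables (k : fieldType) (A : fdAlgType k).
Definition ekin (a : k) : env A := a *: (1 : env A).
Lemma ekinl a (x : env A) : ekin a * x = a *: x.
Proof.
transitivity (a *: ((1 : env A) * x)); last by rewrite mul1r.
exact: (linearZ_LR (env_mull_linear x) a 1).
Qed.
Lemma ekinr a (x : env A) : x * ekin a = a *: x.
Proof.
transitivity (a *: (x * (1 : env A))); last by rewrite mulr1.
exact: (linearZ_LR (env_mulr_linear x) a 1).
Qed.
Fact ekin_zmod : zmod_morphism ekin. Proof. by move=> a b; rewrite /ekin scalerBl. Qed.
Fact ekin_monoid : monoid_morphism ekin.
Proof. by split=> [|a b]; rewrite ?ekinl /ekin ?scale1r // scalerA. Qed.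
HB.instance Definition _ := GRing.isZmodMorphism.Build k (env A) ekin ekin_zmod.
HB.instance Definition _ := GRing.isMonoidMorphism.Build k (env A) ekin ekin_monoid.
Definition ej : {rmorphism k -> env A} := ekin.
Lemma ej_central : central ej.
Proof. by move=> a x; rewrite [LHS]ekinl [RHS]ekinr. Qed.
End EnvScalars.

Section HochschildHomology.
Variables (k : fieldType) (A : fdAlgType k).
Local Notation E := (env A).
Local Notation j := (@ej k A).
Local Notation kr M := (kres (cjr j) M).
Local Notation kl N := (kres j N).
Local Notation ep x y := (env_pure (x : A) (y : A) : (env A)^c).

Lemma epM (x y z w : A) : ep x y * ep z w = ep (z * x) (y * w).
Proof. exact: env_mul_pure. Qed.

Lemma ekrE (M : lmodType E^c) a (m : kr M) : a *: m = (ekin A a : E^c) *: (m : M).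
Proof. by []. Qed.

Section Bimodule.
Variable P : lmodType E^c.
Local Notation D := (khom (kr P) k^o).

Lemma eact_lin (r : E^c) : linear (fun p : kr P => r *: (p : P) : kr P).
Proof.
apply: linearDZ => [x y|c x]; first by rewrite scalerDr.
rewrite !ekrE !scalerA; exact: (congr1 (fun r : E^c => r *: (x : P)) (ej_central c r)).
Qed.
Definition eact r : khom (kr P) (kr P) := Khom (eact_lin r).

Lemma epZl c (x y : A) : ep (c *: x) y = (c *: (env_pure x y) : E).
Proof.
have h0 : env_pure 0 y = 0 :> E by have := env_pure_l y 1 0 0; rewrite !scale1r !addr0 -{1}[env_pure 0 y]addr0 => /addrI.
by have := env_pure_l y c x 0; rewrite h0 !addr0.
Qed.
Lemma epDl (x x' y : A) : ep (x + x') y = (env_pure x y + env_pure x' y : E).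
Proof. by have := env_pure_l y 1 x x'; rewrite !scale1r. Qed.
Lemma epDr (x y y' : A) : ep x (y + y') = (env_pure x y + env_pure x y' : E).
Proof. by have := env_pure_r x 1 y y'; rewrite !scale1r. Qed.
Lemma epZr c (x y : A) : ep x (c *: y) = (c *: (env_pure x y) : E).
Proof.
have h0 : env_pure x 0 = 0 :> E by have := env_pure_r x 1 0 0; rewrite !scale1r !addr0 -{1}[env_pure x 0]addr0 => /addrI.
by have := env_pure_r x c y 0; rewrite h0 !addr0.
Qed.

Lemma eactD (r s : E) (p : P) : ((r + s : E) : E^c) *: p = (r : E^c) *: p + (s : E^c) *: p.
Proof. exact: scalerDl. Qed.
Lemma eactZ c (r : E) (p : P) : ((c *: r : E) : E^c) *: p = (c *: ((r : E^c) *: p : kr P) : kr P).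
Proof.
rewrite ekrE scalerA; exact: (congr1 (fun r : E^c => r *: p) (esym (ekinr c r))).
Qed.
Lemma eactA (r s : E^c) (p : P) : r *: (s *: p) = (r * s) *: p.
Proof. exact: scalerA. Qed.

Fact pe_axioms : bim_axioms (fun (a : A) (t : D) => kcomp t (eact (ep a 1)))
  (fun (t : D) (a : A) => kcomp t (eact (ep 1 a))).
Proof.
split=> [a b t|c a t|a t t'|a c t|t a b|t c a|t t' a|c t a|a b t|t a b|a t b];
  apply: khomP => p //=.
- by rewrite epDl eactD (kfD t).
- by rewrite epZl eactZ (kfZ t).
- by rewrite epDr eactD (kfD t).
- by rewrite epZr eactZ (kfZ t).
- by rewrite eactA epM mulr1.
- by rewrite eactA epM mulr1.
- by rewrite !eactA !epM !mulr1 !mul1r.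
Qed.
(** A right module over [env A] is an A-bimodule; this is its k-dual. *)
Definition pebim : bim A := Bim pe_axioms.

End Bimodule.

Lemma elift_ext (P : lmodType E^c) (V : lmodType k) (f g : E -> V) :
  linear f -> linear g -> (forall x y, f (env_pure x y) = g (env_pure x y)) -> f =1 g.
Proof. by move=> hf hg; apply: (@env_ext _ _ _ (lin_of hf) (lin_of hg)). Qed.

(** P is a summand of a sum of copies of A (x) A. For a coefficient x (x) y of q, the factor x is
    fed to h while y acts on q. *)
Lemma pebim_projective (P : lmodType E^c) n : projective P -> hv n (pebim P).
Proof.
move=> /projective_section[t ht]; apply: left_coinduced_hv.
pose D := pebim P.
pose ev (h : khom A D) (q : P) (c : E) : k^o :=
  env_lift (fun x y : A => (h x : khom (kr P) k^o) (ep 1 y *: q)) c.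
have ev_pure h q x y : ev h q (env_pure x y) = (h x : khom (kr P) k^o) (ep 1 y *: q).
  rewrite /ev env_lift_pure // => z; first by apply: linearDZ => *; rewrite (kfD, kfZ).
  apply: linearDZ => [u v|c u]; first by rewrite epDr eactD (kfD (h z : khom (kr P) k^o)).
  by rewrite epZr eactZ (kfZ (h z : khom (kr P) k^o)).
have ev_lin h q : linear (ev h q) by apply: env_lift_lin.
have evD h q (a b : E^c) : ev h q (a + b) = ev h q a + ev h q b.
  by have := ev_lin h q 1 a b; rewrite !scale1r.
have evZ h q c (a : E) : ev h q (c *: a) = c *: ev h q a.
  exact: (linearZ_LR (lin_of (ev_lin h q)) c a).
have evr_lin (f : E -> k^o) (r : E) : linear f -> linear (fun c : E => f (c * r)).
  by move=> hf a x y; rewrite -hf; congr (f _); apply: env_mul_l.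
pose s0 (h : khom A D) (p : kr P) : k^o := fsum (fun q (c : E^c) => ev h q c) (t p).
have tZ (a : E^c) p : t (a *: p) = a *: t p by rewrite linearZ.
have s0_lin h : linear (s0 h).
  apply: linearDZ => [x y|a x]; rewrite /s0; first by rewrite linearD fsumD.
  rewrite ekrE tZ fsumZ // (fsum_morph (F := fun u : k^o => a *: u)) ?scaler0 //.
    by apply: eq_fsum => q c; rewrite -evZ; congr (ev h q _); apply: ekinr.
  exact: scalerDr.
have s_lin : linear (fun h => Khom (s0_lin h) : D).
  apply: linearDZ => [h h'|a h]; apply: khomP => x; rewrite kE /= /s0.
    rewrite /fsum -big_split; apply: eq_bigr => q _; move: (t x q); rewrite /=.
    apply: elift_ext => //; first by move=> c u v; rewrite !ev_lin scalerDr addrACA.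
    by move=> u v; rewrite !ev_pure.
  rewrite (fsum_morph (F := fun u : k^o => a *: u)) ?scaler0 // => [|*]; last by rewrite scalerDr.
  apply: eq_fsum => q; apply: elift_ext => //.
    by move=> c u v; rewrite !ev_lin scalerDr !scalerA mulrC.
  by move=> u v; rewrite !ev_pure.
exists (Khom s_lin); split=> [h h' b e|h h' a e|h m e]; apply: khomP => p /=; rewrite /s0.
- rewrite tZ fsumZ //; apply: eq_fsum => q.
  apply: (@elift_ext P _ (ev h' q) (fun c : E => ev h q (c * env_pure 1 b))) => //.
    exact: evr_lin.
  move=> x y; rewrite [env_pure x y * _]env_mul_pure mulr1 !ev_pure e /=.
  by rewrite eactA epM mulr1.
- rewrite tZ fsumZ //; apply: eq_fsum => q.
  apply: (@elift_ext P _ (ev h' q) (fun c : E => ev h q (c * env_pure a 1))) => //.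
    exact: evr_lin.
  by move=> x y; rewrite [env_pure x y * _]env_mul_pure mul1r !ev_pure e.
- have m_lin q : linear (fun c : E => m ((c : E^c) *: q)).
    apply: linearDZ => [u v|c u]; first by rewrite eactD (kfD m).
    by rewrite eactZ (kfZ m).
  rewrite -[in RHS](ht p) /fcover /= /flift (fsum_morph (F := m)) ?(kf0 m) //.
    apply: eq_fsum => q; apply: elift_ext => // x y.
    by rewrite ev_pure e /= eactA epM !mul1r.
  by move=> u v; rewrite -(kfD m).
Qed.

Fact elmodZ c (t : kl (env_lmod A)) : c *: t = c *: (t : A) :> A.
Proof.
transitivity (c *: env_lact 1 t : A); last by congr (c *: _); apply: env_lact1.
exact: (linearZ_LR (env_lact_linear_l t) c 1).
Qed.

Fact ermod_lin : linear (fun x : kr (env_rmod A) => x : A).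
Proof.
apply: linearDZ => // c x.
transitivity (c *: (env_ract (1 : E) x : A)); last by congr (c *: _); apply: env_ract1.
exact: (linearZ_LR (env_ract_linear_l x) c 1).
Qed.
Definition ermod : khom (kr (env_rmod A)) A := Khom ermod_lin.

Section TraceComplex.
Variables (P : lmodType E^c).
Local Notation B := (khom (kr P) (khom (kl (env_lmod A)) k^o)).

Fact btrace_lin (b : B) : linear (fun p => b p (1 : A)).
Proof. by apply: linearDZ => *; rewrite ?(kfD b, kfZ b). Qed.
(** Evaluation at 1 identifies the balanced forms on P x A with the invariant forms on P, the
    inverse being [tbal]: tensoring with A over [env A] is dividing by commutators. *)
Definition btrace (b : B) : pebim P := Khom (btrace_lin b).

Lemma btraceK (b : B) : balanced b -> forall p (t : A), b p t = btrace b (ep t 1 *: p).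
Proof.
move=> hb p t /=; rewrite -[ep t 1]/(env_pure t 1 : E) hb; congr (kfun (b p) _).
by rewrite [RHS]env_lact_pure !mulr1.
Qed.

Lemma btrace_inv (b : B) : balanced b -> invar (btrace b).
Proof.
move=> hb a; apply: khomP => p /=; rewrite !hb; congr (kfun (b p) _).
by rewrite [LHS]env_lact_pure [RHS]env_lact_pure !mulr1 mul1r.
Qed.

Fact tbal_lin2 (t : pebim P) (p : P) : linear (fun x : kl (env_lmod A) => t (ep (x : A) 1 *: p)).
Proof.
apply: linearDZ => [x y|c x]; first by rewrite -[x + y]/(x + y : A) epDl eactD (kfD t).
by rewrite elmodZ epZl eactZ (kfZ t).
Qed.
Fact tbal_lin (t : pebim P) : linear (fun p : kr P => Khom (tbal_lin2 t p)).
Proof.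
apply: linearDZ => [p q|c p]; apply: khomP => x /=.
  by rewrite scalerDr (kfD t).
by rewrite [X in t X](kfZ (eact P (ep (x : A) 1))) (kfZ t).
Qed.
Definition tbal t : B := Khom (tbal_lin t).

Lemma tbal_balanced (t : pebim P) : invar t -> balanced (tbal t).
Proof.
move=> ht p r n; move: r.
have tn (a : A) q : t (ep a 1 *: q) = t (ep 1 a *: q).
  exact: (congr1 (fun u : khom (kr P) k^o => u q) (ht a)).
pose F := lin_of (env_lact_lin_l (n : A)).
apply: (@elift_ext P _ (fun r => tbal t ((r : E^c) *: p) n) (fun r => tbal t p (r *: n))).
- apply: linearDZ => [u v|c u] /=; first by rewrite eactD scalerDr (kfD t).
  by rewrite eactZ [X in t X](kfZ (eact P (ep (n : A) 1))) (kfZ t).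
- apply: linearDZ => [u v|c u] /=.
    by rewrite -[(u + v) *: n]/(F (u + v)) linearD epDl eactD (kfD t).
  by rewrite -[(c *: u) *: n]/(F (c *: u)) linearZ epZl eactZ (kfZ t).
move=> x y /=; rewrite -[env_pure x y *: n]/(env_lact _ _) env_lact_pure eactA epM mul1r.
have -> : ep (x * (n : A)) y = ep 1 y * ep (x * (n : A)) 1 by rewrite epM !mulr1.
by rewrite -eactA -tn eactA epM mulr1.
Qed.

End TraceComplex.

Lemma pebim_mor (P Q : lmodType E^c) (f : {linear P -> Q}) :
  bmor (kpre k^o (klin (cjr j) f) : khom (pebim Q) (pebim P)).
Proof. by split=> *; apply: khomP => p /=; rewrite linearZ. Qed.

(** The duals [pebim (P q)] form an acyclic coresolution of the dual of A, and their invariants are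
    the balanced forms. *)
Lemma hv_bal_exact (P : proj_resolution (env_rmod A)) m :
  hv m (dualb A) <-> bal_exact j P (env_lmod A) k^o m.
Proof.
pose d q : khom (pebim (P q)) (pebim (P q.+1)) := kpre _ (klin (cjr j) (res_d P q)).
pose au : khom (kr (P 0)) A := kcomp ermod (klin (cjr j) (res_aug P)).
pose i : khom (dualb A) (pebim (P 0)) := kpre _ au.
have -> : hv m (dualb A) <-> (forall x : pebim (P m.+1), invar x -> d m.+1 x = 0 ->
    exists2 y : pebim (P m), invar y & d m y = x).
  apply: (@hv_coresolution _ _ m (fun q => pebim (P q)) d _ i).
  - by move=> q n; apply: pebim_projective; apply: res_projective.
  - by move=> q; apply: pebim_mor.
  - by move=> q; apply: kpre_coexact => x; apply: res_exactS.
  - split=> *; apply: khomP => p /=; rewrite linearZ /=; congr (kfun _ _).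
      by rewrite [RHS]env_ract_pure mul1r.
    by rewrite [RHS]env_ract_pure mulr1.
  - move=> z e; apply: khomP => x; have [y <-] := res_aug_surj P (x : env_rmod A).
    exact: (congr1 (fun u : khom (kr (P 0)) k^o => u y) e).
  - by apply: kpre_coexact => x; exact: (@res_exact0 _ _ P x).
split=> ex.
  move=> b hb b0; have [||t ht e] := ex (btrace b).
  - exact: btrace_inv.
  - apply: khomP => p /=.
    exact: (congr1 (fun u : khom (kl (env_lmod A)) k^o => u (1 : A)) (b0 p)).
  exists (tbal t); first exact: tbal_balanced.
  move=> p; apply: khomP => x; rewrite (btraceK hb) -e /=.
  by rewrite linearZ.
move=> t ht t0; have [||b hb e] := ex (tbal t).
- exact: tbal_balanced.
- move=> p; apply: khomP => x /=; rewrite -linearZ.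
  exact: (congr1 (fun u : khom (kr (P m.+2)) k^o => u (ep (x : A) 1 *: p)) t0).
exists (btrace b); first exact: btrace_inv.
apply: khomP => p; have := congr1 (fun u : khom (kl (env_lmod A)) k^o => u (1 : A)) (e p).
rewrite /= => <-; congr (kfun t _).
exact: (@scale1r E^c (P m.+1) p).
Qed.

Lemma hh_hv m : hh_zero A m.+1 <-> hv m (dualb A).
Proof.
split=> [[P hP]|h].
  apply/(hv_bal_exact P); apply: (tensor_exact_bal (@ej_central k A)) => z hz; exact: hP.
have [P _] := resolution_exists (env_rmod A); exists P => z hz.
have /(hv_bal_exact P) ex := h.
exact: (bal_tensor_exact (@ej_central k A) ex).
Qed.

End HochschildHomology.

(** * Unital and induced modules *)

Section UnitalModules.
Variables (k : fieldType) (L : fdAlgType k).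

Definition unital (M : lm L) : Prop := forall x : M, la 1 x = x.

Definition tomod (M : lm L) (M1 : unital M) : Type := M.

Section ToMod.
Variables (M : lm L) (M1 : unital M).
HB.instance Definition _ := GRing.Zmodule.on (tomod M1).
Definition tomod_scale (a : L) (x : tomod M1) : tomod M1 := la a (x : M).
Fact tomod_scaleA a b x : tomod_scale a (tomod_scale b x) = tomod_scale (a * b) x.
Proof. exact: laA. Qed.
Fact tomod_scaleDr : right_distributive tomod_scale +%R.
Proof. by move=> a x y; apply: laDr. Qed.
Fact tomod_scaleDl x : {morph tomod_scale^~ x : a b / a + b}.
Proof. by move=> a b; apply: laDl. Qed.
HB.instance Definition _ := GRing.Zmodule_isLmodule.Build L (tomod M1)
  tomod_scaleA M1 tomod_scaleDr tomod_scaleDl.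

Fact tomod_lin : linear (fun x : kres (@kin k L) (tomod M1) => x : M).
Proof. by apply: linearDZ => // a x; rewrite -[LHS]/(la (kin L a) (x : M)) laZl M1. Qed.
Definition of_tomod : khom (kres (@kin k L) (tomod M1)) M := Khom tomod_lin.
Fact tomod_lin' : linear (fun x : M => x : kres (@kin k L) (tomod M1)).
Proof. by apply: linearDZ => // a x; rewrite -[RHS]/(la (kin L a) x) laZl M1. Qed.
Definition to_tomod : khom M (kres (@kin k L) (tomod M1)) := Khom tomod_lin'.

Lemma lhom_tomod (N : fdAlgType k) (al : khom N L) (alM : forall a b, al (a * b) = al a * al b)
    (M' : lm N) (i : khom M' M) (i' : khom M M') (W : lm N) n :
  (forall a x, i (la a x) = la (al a) (i x)) -> (forall a x, i' (la (al a) x) = la a (i' x)) ->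
  (forall x, i' (i x) = x) ->
  hv n (lhom (ofmod alM (tomod M1)) W) -> hv n (lhom M' W).
Proof.
move=> hi hi' ii; apply: (@hv_retract _ _ n (lhom (ofmod alM (tomod M1)) W) (lhom M' W)
  (kpre W (kcomp to_tomod i)) (kpre W (kcomp i' of_tomod))).
- by split=> *; apply: khomP => x //=; rewrite hi.
- by split=> *; apply: khomP => x //=; rewrite -[X in kfun _ X]hi'.
- by move=> h; apply: khomP => x /=; rewrite ii.
Qed.
End ToMod.

Lemma gldim_lhom : gldim_finite L ->
  exists d, forall n (M W : lm L), unital M -> (d <= n)%N -> hv n (lhom M W).
Proof.
move=> /gldim_hv[d hd]; exists d => n M W M1 hn.
exact: (@lhom_tomod M M1 L (kid L) (fun a b => erefl) M (kid M) (kid M) W n _ _ _ (hd n (tomod M1) W hn)).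
Qed.

Section Quotient.
Variables (M : lm L) (S : set M).
Hypotheses (hS : subspace S) (SL : forall a x, S x -> S (la a x)).

(** The quotient is realised on the image of a projection along S. *)
Lemma lm_quotient : exists (C : lm L) (p : khom M C), [/\
  forall a x, p (la a x) = la a (p x), forall x, p x = 0 <-> S x & forall y, exists x, p x = y].
Proof.
have [r [r0 hr]] := subspace_projector hS.
have rr x : r (r x) = r x.
  by apply/eqP; rewrite eq_sym -subr_eq0 -kfB r0.
have rl a x : r (la a (r x)) = r (la a x).
  by apply/eqP; rewrite eq_sym -subr_eq0 -kfB -laBr r0 //; apply/SL/hr.
have sC : subspace (fun y => r y = y).
  by split=> [|a x y hx hy]; rewrite ?kf0 // kfD kfZ hx hy.
pose l (a : L) (y : subk sC) : subk sC := Subk sC (rr (la a (skval y))).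
have lP : lm_axioms l.
  split=> *; apply: skval_inj; rewrite /= ?laE ?(kfD, kfZ) //.
  by rewrite rl laA.
have p_lin : linear (fun x => Subk sC (rr x)).
  by apply: linearDZ => *; apply: skval_inj; rewrite /= (kfD, kfZ).
exists (Lm lP), (Khom p_lin); split=> [a x|x|y].
- by apply: skval_inj; rewrite /= rl.
- split=> [h|/r0 h]; last exact: skval_inj.
  by rewrite -[x]subr0 -[0](congr1 (@skval _ _ _ sC) h) /=.
- by exists (skval y); apply: skval_inj; rewrite /= (skP y).
Qed.

End Quotient.
End UnitalModules.

Section SubModule.
Variables (k : fieldType) (L : fdAlgType k) (M : lm L) (S : set M).
Hypotheses (hS : subspace S) (SL : forall a x, S x -> S (la a x)).
Definition lmsub_l (a : L) (x : subk hS) : subk hS := Subk hS (SL a (skP x)).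
Fact lmsub_axioms : lm_axioms lmsub_l.
Proof. by split=> *; apply: skval_inj; rewrite /= ?laE ?laA. Qed.
Definition lmsub : lm L := Lm lmsub_axioms.
End SubModule.

Definition rightmod k (A U : fdAlgType k) (X : bim2 A U) (X1 : forall x : X, br x 1 = x) : Type := X.

(** * Induced modules X (x)_U Q *)

Section Induction.
Variables (k : fieldType) (A U : fdAlgType k) (X : bim2 A U) (X1 : forall x : X, br x 1 = x).
Local Notation Xm := (rightmod X1).
HB.instance Definition _ := GRing.Zmodule.on Xm.
Definition rightmod_scale (u : U^c) (x : Xm) : Xm := br (x : X) (u : U).
Fact rightmod_scaleA a b x : rightmod_scale a (rightmod_scale b x) = rightmod_scale (a * b) x.
Proof. exact: brA. Qed.
Fact rightmod_scaleDr : right_distributive rightmod_scale +%R.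
Proof. by move=> a x y; apply: brDl. Qed.
Fact rightmod_scaleDl x : {morph rightmod_scale^~ x : a b / a + b}.
Proof. by move=> a b; apply: brDr. Qed.
HB.instance Definition _ := GRing.Zmodule_isLmodule.Build U^c Xm
  rightmod_scaleA X1 rightmod_scaleDr rightmod_scaleDl.

Fact rightmod_lin : linear (fun x : kres (cjr (@kin k U)) Xm => x : X).
Proof. by apply: linearDZ => // c x; rewrite -[LHS]/(br (x : X) (kin U c)) brZr X1. Qed.
Definition of_rightmod : khom (kres (cjr (@kin k U)) Xm) X := Khom rightmod_lin.

Variable Q : lmodType U.
Local Notation T := (ktens (@kin_central k U) Xm Q).
Local Notation kQ := (kres (@kin k U) Q).
Local Notation "x ** q" := (tpure (@kin_central k U) (x : Xm) (q : Q)) (at level 40).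

Fact rightmod_bl_lin (a : A) : linear (fun x : Xm => bl a (x : X) : Xm).
Proof.
move=> u x y; rewrite -[u *: x]/(br (x : X) (u : U)) blDr blr.
by [].
Qed.
Definition induced_l a : khom T T := tmap (@kin_central k U) Q (lin_of (rightmod_bl_lin a)).

Lemma induced_lE a (x : X) q : induced_l a (x ** q) = bl a x ** q.
Proof. exact: tensor_mapE. Qed.

Fact induced_axioms : lm_axioms (fun a t => induced_l a t).
Proof.
split=> [a b t|c a t|a t t'|a c t|a b t]; rewrite ?(kfD, kfZ) //.
- rewrite -kDE; congr (kfun _ t); apply: ktens_ext => x q.
  by rewrite kE !induced_lE blDl -tensor_pureDl.
- rewrite -kZE; congr (kfun _ t); apply: ktens_ext => x q.
  rewrite kE !induced_lE blZl -tpureZl; congr (_ ** _).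
  by rewrite -[RHS]/(br (bl a (x : X)) (kin U c)) brZr X1.
- rewrite -[LHS]/(kcomp (induced_l a) (induced_l b) t); congr (kfun _ t).
  by apply: ktens_ext => x q; rewrite -[LHS]/(induced_l a (induced_l b (x ** q))) !induced_lE blA.
Qed.
Definition induced : lm A := Lm induced_axioms.

Lemma induced_unital : (forall x : X, bl 1 x = x) -> unital induced.
Proof.
move=> h t; rewrite -[RHS]/(kid T t) -[LHS]/(induced_l 1 t); congr (kfun _ t).
by apply: ktens_ext => x q; rewrite induced_lE h.
Qed.

Lemma induced_lift (W : lmodType k) (b0 : X -> kQ -> W) :
  (forall x, linear (b0 x)) -> (forall q, linear (b0^~ q)) ->
  (forall x u q, b0 (br x u) q = b0 x (u *: (q : Q))) ->
  exists h : khom T W, forall x q, h (x ** q) = b0 x q.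
Proof.
move=> hr hl hb; have b_lin : linear (fun x : kres (cjr (@kin k U)) Xm => Khom (hr (of_rightmod x))).
  move=> c x y; apply: khomP => q /=.
  by rewrite -[RHS]hl; congr (b0 _ q); apply: (kfun_lin of_rightmod).
have bal : @balanced _ _ _ Xm Q _ (Khom b_lin) by move=> x u q; apply: hb.
by exists (tlift (@kin_central k U) bal) => x q; rewrite [LHS](tlift_pure _ bal).
Qed.

(* [v] and [x0] exhibit [X] as a direct summand of the left module A. *)
Lemma induced_projective (W : lm A) n (v : khom X A) (x0 : X) :
  (forall a x, v (bl a x) = a * v x) -> (forall x, bl (v x) x0 = x) ->
  projective Q -> hv n (lhom induced W).
Proof.
move=> hv hx /projective_section[t ht].
apply: (@right_coinduced_hv _ _ n (-1)); first by rewrite oppr_eq0 oner_neq0.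
pose D := lhom induced W.
(* If t q is the sum of the u r, then x (x) q is the sum of the v(x u) x0 (x) r; here h replaces the
   action of v(x u). *)
pose s0 (h : khom A D) (x : X) (q : kQ) : W :=
  fsum (fun r (u : U) => (h (v (br x u)) : khom T W) (x0 ** r)) (t q).
have gD (h : khom A D) x r (a b : U) : (h (v (br x (a + b))) : khom T W) (x0 ** r) =
    (h (v (br x a)) : khom T W) (x0 ** r) + (h (v (br x b)) : khom T W) (x0 ** r).
  by rewrite brDr kfD (kfD h).
have s0r h x : linear (s0 h x).
  apply: linearDZ => [q q'|c q]; rewrite /s0; first by rewrite linearD fsumD.
  rewrite kresZ linearZ /= fsumZ // (fsum_morph (F := fun u : W => c *: u)) ?scaler0 //.
    by apply: eq_fsum => r u; rewrite kinl brZr kfZ (kfZ h).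
  exact: scalerDr.
have s0l h q : linear (s0 h ^~ q).
  apply: linearDZ => [x y|c x]; rewrite /s0.
    rewrite /fsum -big_split; apply: eq_bigr => r _.
    by rewrite brDl kfD (kfD h).
  rewrite (fsum_morph (F := fun u : W => c *: u)) ?scaler0 // => [|*]; last by rewrite scalerDr.
  by apply: eq_fsum => r u; rewrite brZl kfZ (kfZ h).
have s0b h x u q : s0 h (br x u) q = s0 h x (u *: (q : Q)).
  by rewrite /s0 linearZ fsumZ //; apply: eq_fsum => r w; rewrite brA.
have [s1 hs1] := choice (fun h => induced_lift (s0r h) (s0l h) (s0b h)).
have s_lin : linear (fun h => s1 h : D).
  apply: linearDZ => [h h'|c h]; apply: ktens_ext => x q; rewrite kE !hs1 /s0.
    by rewrite /fsum -big_split.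
  by rewrite (fsum_morph (F := fun u : W => c *: u)) ?scaler0 // => *; rewrite scalerDr.
exists (Khom s_lin); split=> [a h|h a].
  apply: ktens_ext => x q; rewrite /= !hs1 /s0.
  by rewrite (fsum_morph (F := la a)) ?la0r // => *; rewrite laDr.
apply: ktens_ext => x q; have ea : kfun (br (s1 h : D) a) (x ** q) = s1 h (bl a x ** q) by rewrite -induced_lE.
rewrite kE scaleN1r ea !hs1 /s0 fsumB.
congr (_ - _); first by apply: eq_fsum => r u; rewrite -blr hv.
rewrite -[in RHS](ht q) /fcover /= /flift.
have td r r' : x ** (r + r') = x ** r + x ** r' by apply: tensor_pureDr.
rewrite (fsum_morph (F := fun r => h a (x ** r))).
- by apply: eq_fsum => r u; rewrite /tpure tensor_mapE /= hx -tensor_pureA.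
- by have /(congr1 (fun z => z - x ** 0)) := td 0 0; rewrite addr0 addrK subrr => <-; rewrite kf0.
- by move=> r r'; rewrite td kfD.
Qed.

End Induction.

(** * Stratifying ideals *)

Section ActionMaps.
Variables (k : fieldType) (L : fdAlgType k).
Fact kla_lin (M : lm L) (a : L) : linear (fun x : M => la a x).
Proof. by apply: linearDZ => *; rewrite laE. Qed.
Definition kla (M : lm L) a := Khom (@kla_lin M a).
End ActionMaps.

Section HomBibimodule.
Variables (k : fieldType) (L R : fdAlgType k) (X Z : bim2 L R).
Local Notation D := (khom X Z).

Fact hb_l1_lin (u : R) (g : D) : linear (fun x => g (br x u)).
Proof. by apply: linearDZ => *; rewrite bE (kfD, kfZ). Qed.
Fact hb_r1_lin (g : D) (u : R) : linear (fun x => br (g x) u).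
Proof. by apply: linearDZ => *; rewrite (kfD, kfZ) bE. Qed.
Fact hb_l2_lin (a : L) (g : D) : linear (fun x => bl a (g x)).
Proof. by apply: linearDZ => *; rewrite (kfD, kfZ) bE. Qed.
Fact hb_r2_lin (g : D) (a : L) : linear (fun x => g (bl a x)).
Proof. by apply: linearDZ => *; rewrite bE (kfD, kfZ). Qed.

Definition hb_l1 u g : D := Khom (hb_l1_lin u g).
Definition hb_r1 g u : D := Khom (hb_r1_lin g u).
Definition hb_l2 a g : D := Khom (hb_l2_lin a g).
Definition hb_r2 g a : D := Khom (hb_r2_lin g a).

Fact hb_axioms1 : bim_axioms hb_l1 hb_r1.
Proof. by split=> *; apply: khomP => x /=; rewrite ?bE ?(kfD, kfZ) ?brA. Qed.
Fact hb_axioms2 : bim_axioms hb_l2 hb_r2.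
Proof. by split=> *; apply: khomP => x /=; rewrite ?bE ?(kfD, kfZ) ?blA. Qed.

Fact hb_ll u a g : hb_l1 u (hb_l2 a g) = hb_l2 a (hb_l1 u g).
Proof. exact: khomP. Qed.
Fact hb_lr u a g : hb_l1 u (hb_r2 g a) = hb_r2 (hb_l1 u g) a.
Proof. by apply: khomP => x /=; rewrite blr. Qed.
Fact hb_rl u a g : hb_r1 (hb_l2 a g) u = hb_l2 a (hb_r1 g u).
Proof. by apply: khomP => x /=; rewrite blr. Qed.
Fact hb_rr u a g : hb_r1 (hb_r2 g a) u = hb_r2 (hb_r1 g u) a.
Proof. exact: khomP. Qed.

Definition hombim : bibim R L := Bibim hb_axioms1 hb_axioms2 hb_ll hb_lr hb_rl hb_rr.

(** Through v and x0 the left module X is a direct summand of L, which makes Hom_k(X, Z) a retract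
    of a right coinduced bimodule. *)
Lemma hombim_hv2 n (v : khom X L) (x0 : X) :
  (forall a x, v (bl a x) = a * v x) -> (forall x, bl (v x) x0 = x) -> hv n (bb2 hombim).
Proof.
move=> hv hx; apply: (@right_coinduced_hv _ _ n (-1)); first by rewrite oppr_eq0 oner_neq0.
pose s0 (h : khom L (bb2 hombim)) (x : X) : Z := (h (v x) : D) x0.
have s0_lin h : linear (s0 h).
  by apply: linearDZ => *; rewrite /s0 (kfD, kfZ) (kfD h, kfZ h).
have s_lin : linear (fun h => Khom (s0_lin h) : bb2 hombim).
  by apply: linearDZ => *; apply: khomP.
exists (Khom s_lin); split=> [a h|h a]; first exact: khomP.
apply: khomP => x; rewrite scaleN1r.
rewrite -[LHS]/((h (a * v x) : D) x0 - (h a : D) (bl (v x) x0)) hx.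
by rewrite -hv.
Qed.

End HomBibimodule.

Section ExtBasics.
Variables (k : fieldType) (L : fdAlgType k).

Fact lm0_axioms (W : lmodType k) : lm_axioms (fun (a : L) (x : W) => 0).
Proof. by split=> *; rewrite ?addr0 ?scaler0. Qed.
Definition lm0 W : lm L := Lm (lm0_axioms W).

Fact reg_axioms : lm_axioms (fun a x : L => a * x).
Proof. by split=> *; rewrite ?mulrDl ?mulrDr ?algZl ?algZr ?mulrA. Qed.
Definition reglm : lm L := Lm reg_axioms.

Lemma lhom_reg n (W : lm L) : hv n (lhom reglm W).
Proof.
apply: (@right_coinduced_hv _ _ n (-1)); first by rewrite oppr_eq0 oner_neq0.
pose s0 (h : khom L (lhom reglm W)) (x : L) : W := (h x : khom L W) 1.
have s0_lin h : linear (s0 h) by apply: linearDZ => *; rewrite /s0 (kfD h, kfZ h).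
have s_lin : linear (fun h => Khom (s0_lin h) : lhom reglm W).
  by apply: linearDZ => *; apply: khomP.
exists (Khom s_lin); split=> [a h|h a]; first exact: khomP.
apply: khomP => x; rewrite scaleN1r.
by rewrite -[LHS]/((h (a * x) : khom L W) 1 - (h a : khom L W) (x * 1)) mulr1.
Qed.

End ExtBasics.

Section RestrictBimodule.
Variables (k : fieldType) (L R L' R' : fdAlgType k) (p : khom L' L) (q : khom R' R).
Hypotheses (pM : forall a b : L', p (a * b) = p a * p b).
Hypotheses (qM : forall a b : R', q (a * b) = q a * q b).
Variable D : bim2 L R.
Fact bimres_axioms : bim_axioms (fun a (x : D) => bl (p a) x) (fun (x : D) b => br x (q b)).
Proof. by split=> *; rewrite ?(kfD, kfZ) ?bE ?blA ?brA ?blr ?pM ?qM. Qed.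
Definition bimres : bim2 L' R' := Bim bimres_axioms.
End RestrictBimodule.

(** * Corner and quotient at a stratifying idempotent *)

Section Stratifying.
Variables (k : fieldType) (A U V : fdAlgType k) (e : A) (iota : khom U A) (pi : khom A V).
Local Notation f := (1 - e).

(** U is e A e through [iota], and V is A / A e A through [pi]: the kernel J of [pi] contains e, and
    f J f = 0 gives z = e z + f z e for z in J, so J = A e A. *)
Record corner_quotient : Prop := CornerQuotient {
  cq_ee : e * e = e;
  cq_iM : forall u v : U, iota (u * v) = iota u * iota v;
  cq_i1 : iota 1 = e;
  cq_iinj : forall u, iota u = 0 -> u = 0;
  cq_iimg : forall x, exists u, iota u = e * x * e;
  cq_pM : forall x y : A, pi (x * y) = pi x * pi y;
  cq_p1 : pi 1 = 1;
  cq_psurj : forall v, exists x, pi x = v;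
  cq_pe : pi e = 0;
  cq_pker : forall x, pi x = 0 -> f * x * f = 0
}.
Hypothesis CQ : corner_quotient.
Let ee := cq_ee CQ.
Let iM := cq_iM CQ.
Let i1 := cq_i1 CQ.
Let pM := cq_pM CQ.
Let p1 := cq_p1 CQ.
Let pe := cq_pe CQ.
Let pker := cq_pker CQ.

Lemma ei u : e * iota u = iota u. Proof. by rewrite -i1 -iM mul1r. Qed.
Lemma ie u : iota u * e = iota u. Proof. by rewrite -i1 -iM mulr1. Qed.
Lemma pf : pi f = 1. Proof. by rewrite kfB p1 pe subr0. Qed.
Lemma ef : e * f = 0. Proof. by rewrite mulrBr mulr1 ee subrr. Qed.
Lemma ff : f * f = f. Proof. by rewrite mulrBl mul1r ef subr0. Qed.

Fact sub_Ae : subspace (fun x : A => x * e = x).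
Proof. by split=> [|a x y hx hy]; rewrite ?mul0r // mulrDl algZl hx hy. Qed.
Fact sub_eA : subspace (fun y : A => e * y = y).
Proof. by split=> [|a x y hx hy]; rewrite ?mulr0 // mulrDr algZr hx hy. Qed.
Local Notation Ae := (subk sub_Ae).
Local Notation eA := (subk sub_eA).
Local Notation J := (subk (subspace_ker pi)).

Lemma AeP (x : Ae) : skval x * e = skval x. Proof. exact: (skP x). Qed.
Lemma eAP (y : eA) : e * skval y = skval y. Proof. exact: (skP y). Qed.
Lemma JP (z : J) : pi (skval z) = 0. Proof. exact: (skP z). Qed.

Fact toAe_sub (x : A) : (x * e) * e = x * e. Proof. by rewrite -mulrA ee. Qed.
Definition toAe x : Ae := Subk sub_Ae (toAe_sub x).
Fact toeA_sub (x : A) : e * (e * x) = e * x. Proof. by rewrite mulrA ee. Qed.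
Definition toeA x : eA := Subk sub_eA (toeA_sub x).

Fact Ae_l_sub (a : A) (x : Ae) : a * skval x * e = a * skval x.
Proof. by rewrite -mulrA AeP. Qed.
Fact Ae_r_sub (x : Ae) (u : U) : skval x * iota u * e = skval x * iota u.
Proof. by rewrite -mulrA ie. Qed.
Definition Ae_l a x : Ae := Subk sub_Ae (Ae_l_sub a x).
Definition Ae_r x u : Ae := Subk sub_Ae (Ae_r_sub x u).
Fact Ae_axioms : bim_axioms Ae_l Ae_r.
Proof.
by split=> *; apply: skval_inj; rewrite /= ?mulrDl ?mulrDr ?algZl ?algZr ?(kfD, kfZ)
  ?mulrDr ?algZr ?iM ?mulrA.
Qed.
Definition bAe : bim2 A U := Bim Ae_axioms.

Fact eA_l_sub (u : U) (y : eA) : e * (iota u * skval y) = iota u * skval y.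
Proof. by rewrite mulrA ei. Qed.
Fact eA_r_sub (y : eA) (a : A) : e * (skval y * a) = skval y * a.
Proof. by rewrite mulrA eAP. Qed.
Definition eA_l u y : eA := Subk sub_eA (eA_l_sub u y).
Definition eA_r y a : eA := Subk sub_eA (eA_r_sub y a).
Fact eA_axioms : bim_axioms eA_l eA_r.
Proof.
by split=> *; apply: skval_inj; rewrite /= ?mulrDl ?mulrDr ?algZl ?algZr ?(kfD, kfZ)
  ?mulrDl ?algZl ?iM ?mulrA.
Qed.
Definition beA : bim2 U A := Bim eA_axioms.

Lemma pAe (x : Ae) : pi (skval x) = 0. Proof. by rewrite -AeP pM pe mulr0. Qed.
Fact AeeA_sub (x : Ae) (y : eA) : pi (skval x * skval y) = 0.
Proof. by rewrite pM pAe mul0r. Qed.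
Definition prJ (x : Ae) (y : eA) : J := Subk (subspace_ker pi) (AeeA_sub x y).

Lemma J_decomp (z : J) : skval z = skval (toAe 1) * skval (toeA (skval z)) +
  skval (toAe (f * skval z)) * skval (toeA 1).
Proof.
rewrite /= mul1r mulr1 -mulrA ee mulrA ee -[LHS](subrK (e * skval z)) addrC; congr (_ + _).
rewrite -[X in X - _]mul1r -mulrBl.
by rewrite -[LHS]mulr1 -{2}(subrK e 1) mulrDr pker ?add0r // JP.
Qed.

Section Factor.
Variable W : lmodType k.

Definition ubal (g : khom Ae (khom eA W)) : Prop :=
  forall x u y, g (Ae_r x u) y = g x (eA_l u y).

(** Dual form of fAe (x)_U eAf = 0. *)
Hypothesis no_f : forall g, ubal g -> forall x y : A, g (toAe (f * x)) (toeA (y * f)) = 0.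

(** Dual form of Ae (x)_U eA = J. The map t is dictated by z = e z + f z e, and the part of g on fAe
    x eAf, which t cannot see, is zero by [no_f]. *)
Lemma ubal_factor g : ubal g -> exists t : khom J W, forall x y, g x y = t (prJ x y).
Proof.
move=> hg; pose t0 (z : J) := g (toAe 1) (toeA (skval z)) + g (toAe (f * skval z)) (toeA 1).
have toeAD (x y : A) : toeA (x + y) = toeA x + toeA y by apply: skval_inj; rewrite /= mulrDr.
have toeAZ c (x : A) : toeA (c *: x) = c *: toeA x by apply: skval_inj; rewrite /= algZr.
have toAeD (x y : A) : toAe (x + y) = toAe x + toAe y by apply: skval_inj; rewrite /= mulrDl.
have toAeZ c (x : A) : toAe (c *: x) = c *: toAe x by apply: skval_inj; rewrite /= algZl.
have t_lin : linear t0.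
  apply: linearDZ => [x y|c x]; rewrite /t0 /=.
    by rewrite toeAD mulrDr toAeD !(kfD, kE) addrACA.
  by rewrite toeAZ algZr toAeZ !(kfZ, kE) scalerDr.
exists (Khom t_lin) => x y; rewrite /= /t0 /=.
have [u hu] := cq_iimg CQ (skval x); rewrite -mulrA AeP in hu.
have [v hv] := cq_iimg CQ (skval y); rewrite eAP in hv.
have -> : toeA (skval x * skval y) = eA_l u y by apply: skval_inj; rewrite /= hu mulrA.
have -> : toAe (f * (skval x * skval y)) = Ae_r (toAe (f * skval x)) v.
  apply: skval_inj; rewrite /= hv -!mulrA; congr (_ * _).
  by rewrite [e * _]mulrA eAP.
have ex : x = Ae_r (toAe 1) u + toAe (f * skval x).
  apply: skval_inj; rewrite /= mul1r hu mulrA ee -mulrA AeP.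
  by rewrite mulrBl mul1r addrC subrK.
have ey : y = eA_l v (toeA 1) + toeA (skval y * f).
  apply: skval_inj; rewrite /= mulr1 hv -mulrA ee mulrA eAP.
  by rewrite mulrBr mulr1 addrC subrK.
rewrite {1}ex (kfD g) kE; congr (_ + _); first by rewrite hg.
by rewrite hg {1}ey (kfD (g _)) no_f // addr0.
Qed.

Lemma prJ_span (t : khom J W) : (forall x y, t (prJ x y) = 0) -> t = 0.
Proof.
move=> ht; apply: khomP => z.
have -> : z = prJ (toAe 1) (toeA (skval z)) + prJ (toAe (f * skval z)) (toeA 1).
  by apply: skval_inj; rewrite {1}J_decomp.
by rewrite kfD !ht addr0.
Qed.

End Factor.

Fact prJ_lin2 x : linear (prJ x).
Proof.
by apply: linearDZ => *; apply: skval_inj; rewrite /= ?mulrDr ?algZr.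
Qed.
Fact prJ_lin : linear (fun x => Khom (prJ_lin2 x)).
Proof.
by apply: linearDZ => *; apply: khomP => y; apply: skval_inj; rewrite /= ?mulrDl ?algZl.
Qed.
Definition prJh : khom Ae (khom eA J) := Khom prJ_lin.

Fact dprJ_lin (W : lmodType k) : linear (fun t : khom J W => kcomp (kpost eA t) prJh).
Proof. by apply: linearDZ => *; apply: khomP => x; apply: khomP. Qed.
Definition dprJ W : khom (khom J W) (khom Ae (khom eA W)) := Khom (@dprJ_lin W).

Section Coefficients.
Variable W : lm A.

Fact zW_axioms : bim_axioms
  (fun (a : A) (z : khom eA W) => kcomp (kla W a) z)
  (fun (z : khom eA W) (u : U) => kcomp z (kbl beA u)).
Proof.
by split=> *; apply: khomP => x; rewrite /= ?kE ?laE ?laA ?(axlDl eA_axioms, axlZl eA_axioms)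
  ?(kfD, kfZ) ?(axlA eA_axioms).
Qed.
Definition zW : bim2 A U := Bim zW_axioms.

Fact J_l_sub (a : A) (z : J) : pi (a * skval z) = 0.
Proof. by rewrite pM JP mulr0. Qed.
Definition J_l a z : J := Subk (subspace_ker pi) (J_l_sub a z).
Fact J_axioms : lm_axioms J_l.
Proof. by split=> *; apply: skval_inj; rewrite /= ?mulrDl ?mulrDr ?algZl ?algZr ?mulrA. Qed.
Definition Jlm : lm A := Lm J_axioms.

Fact eAlm_axioms : lm_axioms eA_l.
Proof. by split; case: eA_axioms. Qed.
Definition eAlm : lm U := Lm eAlm_axioms.

Fact sub_eW : subspace (fun w : W => la e w = w).
Proof. by split=> [|a x y hx hy]; rewrite ?la0r // laE laZr hx hy. Qed.
Local Notation eW := (subk sub_eW).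
Fact eW_l_sub (u : U) (w : eW) : la e (la (iota u) (skval w)) = la (iota u) (skval w).
Proof. by rewrite laA ei. Qed.
Definition eW_l u w : eW := Subk sub_eW (eW_l_sub u w).
Fact eW_axioms : lm_axioms eW_l.
Proof.
by split=> *; apply: skval_inj; rewrite /= ?laE ?(kfD, kfZ) ?laE ?laA ?iM.
Qed.
Definition eWlm : lm U := Lm eW_axioms.

Fact i2W_lin3 (t : khom eA eW) (x : Ae) : linear (fun y => la (skval x : A) (skval (t y))).
Proof. by apply: linearDZ => *; rewrite (kfD, kfZ) /= laE. Qed.
Fact i2W_lin2 (t : khom eA eW) : linear (fun x : Ae => Khom (i2W_lin3 t x)).
Proof. by apply: linearDZ => *; apply: khomP => y /=; rewrite laE. Qed.
Fact i2W_lin : linear (fun t : khom eA eW => Khom (i2W_lin2 t)).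
Proof. by apply: linearDZ => *; apply: khomP => x; apply: khomP => y; rewrite /= laE. Qed.
Definition i2W : khom (lhom eAlm eWlm) (khom Ae (khom eA W)) := Khom i2W_lin.

End Coefficients.

Hypothesis no_f : forall (W : lmodType k) (g : khom Ae (khom eA W)), ubal g ->
  forall x y : A, g (toAe (f * x)) (toeA (y * f)) = 0.

(** The U-structure does not involve the A-structures, which stay arbitrary so that the coefficients
    may be an A-module or the ground field. *)
Lemma invar_dprJ (W : lmodType k) (l : A -> khom eA W -> khom eA W)
    (P : bim_axioms l (fun (z : khom eA W) (u : U) => kcomp z (kbl beA u)))
    (l' : A -> khom J W -> khom J W) r' (P' : bim_axioms l' r') :
  let E := hombim bAe (Bim P) in
  bmor (dprJ W : khom (Bim P') (bb2 E)) ->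
  @invar_of _ _ _ (bb1 E) (bb2 E) (Bim P') (dprJ W) id.
Proof.
move=> E hm; split=> // [t h|t u|g hg].
- apply: prJ_span => x y.
  exact: (congr1 (fun g : khom Ae (khom eA W) => g x y) h).
- apply: khomP => x; apply: khomP => y /=; congr (kfun t _).
  by apply: skval_inj; rewrite /= mulrA.
- have [|t ht] := @ubal_factor W (@no_f W) g.
    move=> x u y.
    exact: (congr1 (fun g : khom Ae (khom eA W) => g x y) (hg u)).
  by exists t; apply: khomP => x; apply: khomP => y; rewrite ht.
Qed.

(** Dual form of the vanishing of Tor over U of Ae and eA in positive degrees. The U-structure
    ignores how A acts on W, so the zero action [lm0] stands for all of them. *)
Hypothesis hvE : forall (W : lmodType k) n, hv n (bb1 (hombim bAe (zW (lm0 A W)))).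

Lemma hvE1 (W : lmodType k) (l : A -> khom eA W -> khom eA W)
    (P : bim_axioms l (fun (z : khom eA W) (u : U) => kcomp z (kbl beA u))) n :
  hv n (bb1 (hombim bAe (Bim P))).
Proof.
pose E0 := bb1 (hombim bAe (zW (lm0 A W))); pose E := bb1 (hombim bAe (Bim P)).
by apply: (@hv_retract _ _ n E0 E (kid E0) (kid E0)); [| | by [] | exact: hvE];
  split=> *; apply: khomP.
Qed.

Lemma hvE2 (Z : bim2 A U) n : hv n (bb2 (hombim bAe Z)).
Proof.
apply: (@hombim_hv2 _ _ _ bAe Z n (skinc sub_Ae) (toAe 1)) => // x.
by apply: skval_inj; rewrite /= mul1r AeP.
Qed.

(** Among the bilinear maps on Ae x eA, the U-invariant ones are balanced, that is maps on J; the
    A-invariant ones are A-linear in x, hence determined at x = e by a map eA -> eW. *)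
Lemma lhom_J (W : lm A) n : hv n (lhom Jlm W) <-> hv n (lhom eAlm (eWlm W)).
Proof.
apply: (@hv_two_actions _ U A n (hombim bAe (zW W)) (lhom Jlm W) (dprJ W) _ (i2W W)).
- by move=> m; apply: hvE1.
- by move=> m; apply: hvE2.
- apply: (@invar_dprJ W _ (zW_axioms W) _ _ (lhom_axioms Jlm W)).
  split=> *; apply: khomP => x; apply: khomP => y //=; congr (kfun _ _).
  by apply: skval_inj; rewrite /= mulrA.
split.
- split=> *; apply: khomP => x; apply: khomP => y //=.
  by rewrite laA.
- move=> t h; apply: khomP => y; apply: skval_inj.
  have := congr1 (fun g : khom Ae (khom eA W) => g (toAe 1) y) h.
  by rewrite /= mul1r (skP (t y)).
- by move=> t a; apply: khomP => x; apply: khomP => y; rewrite /= laA.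
move=> g hg.
have gx (a : A) x y : g (Ae_l a x) y = la a (g x y).
  by have /esym := congr1 (fun g : khom Ae (khom eA W) => g x y) (hg a).
have h0 y : la e (g (toAe 1) y) = g (toAe 1) y.
  by rewrite -gx; congr (kfun (kfun g _) _); apply: skval_inj; rewrite /= mul1r ee.
have [t ht] := @khom_lift _ eA (eWlm W) W (skinc (sub_eW W)) (g (toAe 1))
  (fun z h => skval_inj (h : skval z = skval 0)) (fun y => ex_intro _ (Subk (sub_eW W) (h0 y)) erefl).
exists t; apply: khomP => x; apply: khomP => y /=.
rewrite -[skval (t y)]/(skinc _ (t y)) ht -gx; congr (kfun (kfun g _) _).
by apply: skval_inj; rewrite /= mul1r AeP.
Qed.

Fact V_axioms : lm_axioms (fun (a : A) (x : V) => pi a * x).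
Proof. by split=> *; rewrite ?(kfD, kfZ) ?mulrDl ?mulrDr ?algZl ?algZr ?pM ?mulrA. Qed.
Definition Vlm : lm A := Lm V_axioms.

Lemma J_exact : exact2 (skinc (subspace_ker pi)) pi.
Proof.
split=> [x h|y h|x|v]; first exact: skval_inj.
- by exists (Subk (subspace_ker pi) h).
- exact: JP.
- exact: cq_psurj CQ v.
Qed.

Lemma lhom_V_ses (W : lm A) : ses (lhom Vlm W) (lhom (reglm A) W) (lhom Jlm W).
Proof.
by apply: (@lhom_ses _ _ Jlm (reglm A) Vlm W _ _ _ _ J_exact) => // a x; rewrite /= pM.
Qed.

Lemma lhom_V_hvS (W : lm A) n : hv n (lhom Jlm W) -> hv n.+1 (lhom Vlm W).
Proof. by move=> h; apply: ses_hvA (lhom_V_ses W) h _; apply: lhom_reg. Qed.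

(** As eW = 0, Ext_A(J, W) = Ext_U(eA, eW) vanishes, which leaves degree 1. There the obstruction is
    Hom_A(J, W), zero because z = e z + f z e on J and a homomorphism sends e into eW. *)
Lemma lhom_V0 (W : lm A) n : (forall w : W, la e w = 0) -> hv n (lhom Vlm W).
Proof.
move=> W0; have hJ m : hv m (lhom Jlm W).
  apply/lhom_J/hv_zero => t; apply: khomP => y; apply: skval_inj.
  by rewrite -(skP (kfun t y)) W0.
case: n => [|n]; last exact: lhom_V_hvS.
have [i [p [hi hp ex]]] := lhom_V_ses W.
apply: (ses_H1 hi hp ex (lhom_reg 0 W)) => y hy; exists 0; first by move=> a; rewrite bl0r br0l.
rewrite kf0; apply/esym/khomP => z.
have hz a x : la a (kfun y x) = kfun y (J_l a x).
  exact: (congr1 (fun g : khom J W => g x) (hy a)).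
pose eJ : J := Subk (subspace_ker pi) pe.
have -> : z = J_l e z + J_l (f * skval z) eJ.
  by apply: skval_inj; rewrite {1}J_decomp /= mul1r mulr1 mulrA ee -[_ * e * e]mulrA ee.
have e0 : kfun y eJ = 0.
  by rewrite -(W0 (kfun y eJ)) hz; congr (kfun y _); apply: skval_inj; rewrite /= ee.
by rewrite (kfD y) -!hz W0 e0 la0r addr0.
Qed.

Fact J_r_sub (z : J) (a : A) : pi (skval z * a) = 0.
Proof. by rewrite pM JP mul0r. Qed.
Definition J_r z a : J := Subk (subspace_ker pi) (J_r_sub z a).
Fact J_bim_axioms : bim_axioms J_l J_r.
Proof. by split=> *; apply: skval_inj; rewrite /= ?mulrDl ?mulrDr ?algZl ?algZr ?mulrA. Qed.
Definition bJ : bim A := Bim J_bim_axioms.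

Lemma corner_map : exists ju : khom A U, forall x, iota (ju x) = e * x * e.
Proof.
have [ju hju] := @khom_lift _ A U A iota (kcomp (kmull e) (kmulr e)) (cq_iinj CQ)
  (fun x => let: ex_intro u h := cq_iimg CQ x in ex_intro _ u (etrans h (esym (mulrA _ _ _)))).
by exists ju => x; rewrite hju /= mulrA.
Qed.

Lemma iinj u v : iota u = iota v -> u = v.
Proof. by move=> h; apply/eqP; rewrite -subr_eq0; apply/eqP/(cq_iinj CQ); rewrite kfB h subrr. Qed.

(** The A-invariant forms on Ae x eA are the (x, y) |-> t(y x) with t a form on e A e; [ju] reads
    the product y x in U. *)
Lemma dual_J n : hv n (kdual bJ) <-> hv n (dualb U).
Proof.
have [ju hju] := corner_map.
have juM x u : ju (x * iota u) = ju x * u.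
  by apply: iinj; rewrite iM !hju -!mulrA ie ei.
have juM' x u : ju (iota u * x) = u * ju x.
  by apply: iinj; rewrite iM !hju !mulrA ie ei.
have jui u : ju (iota u) = u by apply: iinj; rewrite hju ei ie.
have i2_lin3 (t : khom U k^o) (x : Ae) : linear (fun y : eA => t (ju (skval y * skval x))).
  by apply: linearDZ => *; rewrite /= ?mulrDl ?algZl !(kfD, kfZ).
have i2_lin2 (t : khom U k^o) : linear (fun x : Ae => Khom (i2_lin3 t x)).
  by apply: linearDZ => *; apply: khomP => y; rewrite /= ?mulrDr ?algZr !(kfD, kfZ).
have i2_lin : linear (fun t : khom U k^o => Khom (i2_lin2 t)).
  by apply: linearDZ => *; apply: khomP => x; apply: khomP => y.
apply: (@hv_two_actions _ U A n (hombim bAe (kdual beA)) (kdual bJ) (dprJ k^o) (dualb U) (Khom i2_lin)).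
- by move=> m; apply: (@hvE1 _ _ (kdual_axioms beA)).
- by move=> m; apply: hvE2.
- apply: (@invar_dprJ k^o _ (kdual_axioms beA) _ _ (kdual_axioms bJ)).
  by split=> *; apply: khomP => x; apply: khomP => y //=; congr (kfun _ _);
    apply: skval_inj; rewrite /= mulrA.
split.
- split=> *; apply: khomP => x; apply: khomP => y /=; congr (kfun _ _).
    by rewrite mulrA juM.
  by rewrite -mulrA juM'.
- move=> t h; apply: khomP => u.
  have := congr1 (fun g : khom Ae (khom eA k^o) => g (toAe 1) (toeA (iota u))) h.
  by rewrite /= mul1r ei ie jui.
- by move=> t a; apply: khomP => x; apply: khomP => y; rewrite /= mulrA.
move=> g hg.
have gx (a : A) x y : g (Ae_l a x) y = g x (eA_r y a).
  by have /esym := congr1 (fun g : khom Ae (khom eA k^o) => g x y) (hg a).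
have t_lin : linear (fun u : U => toeA (iota u)).
  by apply: linearDZ => *; apply: skval_inj; rewrite /= (kfD, kfZ) ?mulrDr ?algZr.
exists (kcomp (g (toAe 1)) (Khom t_lin)); apply: khomP => x; apply: khomP => y /=.
have -> : x = Ae_l (skval x) (toAe 1) by apply: skval_inj; rewrite /= mul1r AeP.
rewrite gx; congr (kfun (g _) _); apply: skval_inj; rewrite /= hju mul1r.
by rewrite AeP -mulrA -[_ * _ * e]mulrA AeP !(mulrA e) ee mulrA eAP.
Qed.

Definition bVA : bim2 V A := bimres (fun a b : V => erefl (kid V (a * b))) pM (regb V).
Definition bAV : bim2 A V := bimres pM (fun a b : V => erefl (kid V (a * b))) (regb V).
Definition bAVA : bim A := bimres pM pM (regb V).

(** Among the forms on V x V, invariance over V gives t(x y) and invariance over A gives t(y x).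
    Acyclicity over A is [lhom_V0], as e acts by zero on the dual of V. *)
Lemma dual_V n : hv n (kdual bAVA) <-> hv n (dualb V).
Proof.
pose E := hombim bAV (kdual bVA).
have i1_lin3 (t : khom V k^o) (x : V) : linear (fun y : V => t (x * y)).
  by apply: linearDZ => *; rewrite ?mulrDr ?algZr (kfD, kfZ).
have i1_lin2 (t : khom V k^o) : linear (fun x : V => Khom (i1_lin3 t x)).
  by apply: linearDZ => *; apply: khomP => y; rewrite /= ?mulrDl ?algZl (kfD, kfZ).
have i1_lin : linear (fun t : khom V k^o => Khom (i1_lin2 t)).
  by apply: linearDZ => *; apply: khomP => x; apply: khomP => y.
have i2_lin3 (t : khom V k^o) (x : V) : linear (fun y : V => t (y * x)).
  by apply: linearDZ => *; rewrite ?mulrDl ?algZl (kfD, kfZ).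
have i2_lin2 (t : khom V k^o) : linear (fun x : V => Khom (i2_lin3 t x)).
  by apply: linearDZ => *; apply: khomP => y; rewrite /= ?mulrDr ?algZr (kfD, kfZ).
have i2_lin : linear (fun t : khom V k^o => Khom (i2_lin2 t)).
  by apply: linearDZ => *; apply: khomP => x; apply: khomP => y.
apply: (@hv_two_actions _ V A n E (kdual bAVA) (Khom i1_lin) (dualb V) (Khom i2_lin)).
- move=> m; apply: left_coinduced_hv.
  have s_lin2 (h : khom V E) : linear (fun x : V => (h x : khom V (khom V k^o)) 1).
    by apply: linearDZ => *; rewrite (kfD h, kfZ h).
  have s_lin : linear (fun h : khom V E => Khom (s_lin2 h) : E).
    by apply: linearDZ => *; apply: khomP.
  exists (Khom s_lin); split=> [h h' b e'|h h' b e'|h t e'];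
    apply: khomP => x; apply: khomP => y; rewrite /= e' //=.
  by rewrite mul1r.
- move=> m; have W_axioms : lm_axioms (fun (a : A) (z : kdual bVA) => bl a z).
    by split=> *; rewrite ?bE ?blA.
  apply: (@hv_retract _ _ m (lhom Vlm (Lm W_axioms)) (bb2 E) (kid E) (kid E)) => //.
  + by split=> *; apply: khomP.
  + by split=> *; apply: khomP.
  + by apply: lhom_V0 => w; apply: khomP => x; rewrite /= pe mulr0 kf0.
- split.
  + by split=> *; apply: khomP => x; apply: khomP => y; rewrite /= !mulrA.
  + move=> t h; apply: khomP => x.
    by have := congr1 (fun g : khom V (khom V k^o) => g 1 x) h; rewrite /= mul1r.
  + by move=> t v; apply: khomP => x; apply: khomP => y; rewrite /= mulrA.
  + move=> g hg; exists (g 1); apply: khomP => x; apply: khomP => y /=.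
    have /esym := congr1 (fun g : khom V (khom V k^o) => g 1 y) (hg x).
    by rewrite /= mul1r => <-.
- split.
  + by split=> *; apply: khomP => x; apply: khomP => y; rewrite /= !mulrA.
  + move=> t h; apply: khomP => x.
    by have := congr1 (fun g : khom V (khom V k^o) => g 1 x) h; rewrite /= mulr1.
  + by move=> t v; apply: khomP => x; apply: khomP => y; rewrite /= mulrA.
  + move=> g hg; exists (g 1); apply: khomP => x; apply: khomP => y /=.
    have [a <-] := cq_psurj CQ x.
    have := congr1 (fun g : khom V (khom V k^o) => g 1 y) (hg a).
    by rewrite /= mulr1.
Qed.

Lemma dual_ses : ses (kdual bAVA) (dualb A) (kdual bJ).
Proof.
exists (kpre k^o pi), (kpre k^o (skinc (subspace_ker pi))); split; last exact: kpre_exact J_exact.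
  by split=> *; apply: khomP => x; rewrite /= pM.
by split=> *; apply: khomP.
Qed.

Lemma pker_eq x y : pi x = pi y -> f * x * f = f * y * f.
Proof.
move=> h; apply/eqP; rewrite -subr_eq0 -(mulrBl f) -(mulrBr f x) pker //.
by rewrite kfB h subrr.
Qed.

(** For any linear section s of [pi], the map v |-> f s(v) f is multiplicative because f J f = 0,
    and [pi] splits it. *)
Lemma dual_retract n : hv n (dualb A) -> hv n (dualb V).
Proof.
have [s hs] := khom_section (cq_psurj CQ).
have sM v w : f * s (v * w) * f = f * s v * f * (f * s w * f).
  rewrite (@pker_eq _ (s v * f * s w)); last by rewrite !pM pf hs mulr1 !hs.
  by rewrite !mulrA -[f * s v * f * f]mulrA ff.
pose al := kcomp (kmull f) (kcomp (kmulr f) s).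
have alM v w : al (v * w) = al v * al w by rewrite /al /= !(mulrA f) sM.
have alK v : pi (al v) = v by rewrite /= !pM pf hs mul1r mulr1.
apply: (@hv_smor _ A V al pi alM pM alK n (dualb A) (dualb V) (kpre k^o al) (kpre k^o pi)).
- split=> [v t|t v]; apply: khomP => w; [transitivity (t (al w * al v)) | transitivity (t (al v * al w))];
    first [done | by rewrite -alM].
- by split=> *; apply: khomP => x; rewrite /= pM.
- by move=> t; apply: khomP => v; rewrite -[LHS]/(t (pi (al v))) alK.
Qed.

Lemma dual_corner_quotient N : (forall m, (N <= m)%N -> hv m (dualb A)) ->
  forall m, (N <= m)%N -> hv m (dualb U) /\ hv m (dualb V).
Proof.
move=> h m mN; have hV q : (N <= q)%N -> hv q (dualb V) by move=> /h; apply: dual_retract.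
split; last exact: hV.
(* The term DV enters one degree higher, at m + 1, which is still at least N. *)
by apply/dual_J; apply: (ses_hvB dual_ses); [exact: h | apply/dual_V/hV/leqW].
Qed.

(** * Global dimension of A from U and V *)

Section GlobalDimension.
Variables (W : lm A) (c : nat).
Hypothesis hVlm : forall (W' : lm A) n, (c <= n)%N -> hv n (lhom Vlm W').

(** F may have infinite rank. Since Hom_k(F, W) is a retract of Hom_k(V, Hom_k(F, W)), vanishing for
    V with coefficients Hom_k(F, W) suffices, which is why [hVlm] ranges over all coefficients. *)
Lemma lhom_V_projective (F : lmodType V) n : projective F -> (c <= n)%N ->
  hv n (lhom (ofmod pM F) W).
Proof.
move=> /projective_section[t ht] cn; pose kF := kres (@kin k V) F.
have W'_axioms : lm_axioms (fun (a : A) (h : khom kF W) => kcomp (kla W a) h).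
  by split=> *; apply: khomP => x; rewrite /= ?kE ?laE ?laA.
pose D := lhom Vlm (Lm W'_axioms).
have g'_lin2 (h : khom kF W) v : linear (fun q : kF => h (v *: (q : F))).
  by apply: linearDZ => [x y|b x]; rewrite ?scalerDr ?(kfD h) // -(kfZ h) !kresZ !scalerA kinl kinr.
have g'_lin1 (h : khom kF W) : linear (fun v : V => Khom (g'_lin2 h v)).
  apply: linearDZ => [x y|b x]; apply: khomP => q /=; first by rewrite scalerDl (kfD h).
  by rewrite -(kfZ h) kresZ scalerA kinl.
have g'_lin : linear (fun h : khom kF W => Khom (g'_lin1 h)).
  by apply: linearDZ => *; apply: khomP => v; apply: khomP => q.
pose s0 (h : khom V (khom kF W)) (p : kF) : W := fsum (fun q v => h v q) (t p).
have gD (h : khom V (khom kF W)) q a b : h (a + b) q = h a q + h b q by rewrite (kfD h).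
have s0_lin h : linear (s0 h).
  apply: linearDZ => [x y|b x]; rewrite /s0; first by rewrite linearD fsumD.
  rewrite kresZ linearZ /= fsumZ // (fsum_morph (F := fun u : W => b *: u)) ?scaler0 //.
    by apply: eq_fsum => q v; rewrite kinl (kfZ h).
  exact: scalerDr.
have s_lin : linear (fun h => Khom (s0_lin h)).
  apply: linearDZ => [h h'|b h]; apply: khomP => x; rewrite kE /= /s0.
    by rewrite /fsum -big_split.
  by rewrite (fsum_morph (F := fun u : W => b *: u)) ?scaler0 // => *; rewrite scalerDr.
apply: (@hv_retract _ _ n D (lhom (ofmod pM F) W) (Khom s_lin) (Khom g'_lin)); last exact: hVlm.
- split=> [a h|h a]; apply: khomP => p; rewrite /= /s0.
    by rewrite (fsum_morph (F := la a)) ?la0r // => *; rewrite laDr.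
  by rewrite linearZ fsumZ.
- split=> *; apply: khomP => v; apply: khomP => q //=.
  by rewrite scalerA.
move=> h; apply: khomP => p; rewrite /= /s0 -[in RHS](ht p) /fcover /= /flift.
by rewrite (fsum_morph (F := h)) ?(kf0 h) // => *; rewrite -(kfD h).
Qed.

Variable d : nat.
Hypothesis hVd : forall Y : lmodType V, pdlt d Y.

Lemma lhom_V_lmod (Y : lmodType V) n : (c + d <= n)%N -> hv n (lhom (ofmod pM Y) W).
Proof.
by move=> cn; apply: (hv_pdlt (c := c) _ (hVd Y)) => // Q Qp m; apply: lhom_V_projective.
Qed.

(** By z = e z + f z e, the ideal J kills a module killed by e, so N is a V-module. *)
Lemma lhom_e0 (N : lm A) n : unital N -> (forall x : N, la e x = 0) -> (c + d <= n)%N ->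
  hv n (lhom N W).
Proof.
move=> N1 N0 cn; have [s hs] := khom_section (cq_psurj CQ).
have l0 (z : J) (x : N) : la (skval z) x = 0.
  by rewrite J_decomp /= !mulr1 !mul1r laDl -!laA !N0 !la0r addr0.
have leq a b (x : N) : pi a = pi b -> la a x = la b x.
  move=> h; apply/eqP; rewrite -subr_eq0 -laBl.
  have ab : pi (a - b) = 0 by rewrite kfB h subrr.
  exact/eqP/(l0 (Subk (subspace_ker pi) ab)).
have V_ax : lm_axioms (fun (v : V) (x : N) => la (s v) x).
  split=> *; rewrite ?(kfD, kfZ) ?laE //; rewrite laA; apply: leq.
  by rewrite pM !hs.
have V1 : unital (Lm V_ax) by move=> x; rewrite -[RHS]N1; apply: leq; rewrite hs p1.
apply: (@lhom_tomod _ _ _ V1 A pi pM N (kid N) (kid N)) => //.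
- by move=> a x; apply: leq; rewrite hs.
- by move=> a x; apply: leq; rewrite hs.
exact: lhom_V_lmod.
Qed.

Fact bAe1 (x : bAe) : br x 1 = x.
Proof. by apply: skval_inj; rewrite /= i1 AeP. Qed.

(** Multiplication by e is exact and turns Ae (x)_U Q into Q. So the cokernel C of [psi] is killed
    by e, and the kernel K' has eK' isomorphic to K, of smaller projective dimension. Presenting eM
    by [phi] up to isomorphism lets K take the place of Y. *)
Lemma lhom_corner r (Y : lmodType U) : pdlt r Y ->
  forall (M : lm A) (phi : khom (kres (@kin k U) Y) M), unital M ->
  (forall y, phi y = 0 -> y = 0) -> (forall u (y : Y), phi (u *: y) = la (iota u) (phi y)) ->
  (forall x, la e x = x -> exists y, phi y = x) ->
  forall n, (c + d + r <= n)%N -> hv n (lhom M W).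
Proof.
elim: r Y => [|r IH] Y.
  move=> Y0 M phi M1 phii phil phis n; rewrite addn0; apply: lhom_e0 => // x.
  have [|y <-] := phis (la e x); first by rewrite laA ee.
  by rewrite (Y0 y) (kf0 phi).
move=> [Q [K [i [p [Qp ii ex ps Kr]]]]] M phi M1 phii phil phis [|n]; rewrite addnS // ltnS => cn.
have [ju hju] := corner_map.
pose T := induced bAe1 Q; pose kQ := kres (@kin k U) Q.
pose tp (x : Ae) (q : Q) : T := tpure (@kin_central k U) (x : rightmod bAe1) q.
have tpD x q q' : tp x (q + q') = tp x q + tp x q' by apply: tensor_pureDr.
have tpB x q q' : tp x (q - q') = tp x q - tp x q'.
  by apply/eqP; rewrite eq_sym subr_eq -tpD subrK.
have tpA x u q : tp (Ae_r x u) q = tp x (u *: q) by apply: tensor_pureA.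
have tpl a x q : la a (tp x q) = tp (Ae_l a x) q by apply: induced_lE.
have phie y : la e (phi y) = phi y by rewrite -i1 -phil scale1r.
have [psi hpsi] : exists psi : khom T M, forall x q, psi (tp x q) = la (skval x) (phi (p q)).
  apply: (@induced_lift _ _ _ _ bAe1 Q M (fun (x : Ae) (q : kQ) => la (skval x : A) (phi (p q)))).
  - by move=> x; apply: linearDZ => [q q'|b q]; rewrite -laE; congr (la _ _);
      [rewrite -(kfD phi) linearD | rewrite -(kfZ phi) kresZ linearZ].
  - by move=> q; apply: linearDZ => *; rewrite /= laE.
  - by move=> x u q; rewrite /= linearZ phil laA.
have psil a t : psi (la a t) = la a (psi t).
  rewrite -[LHS]/(kcomp psi (kla T a) t) -[RHS]/(kcomp (kla M a) psi t); congr (kfun _ t).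
  apply: ktens_ext => x q; rewrite -[LHS]/(psi (la a (tp x q))) tpl hpsi.
  by rewrite -[RHS]/(la a (psi (tp x q))) hpsi laA.
have psie q : psi (tp (toAe 1) q) = phi (p q) by rewrite hpsi /= mul1r phie.
pose sK := subspace_ker psi.
have Kl a (t : T) : psi t = 0 -> psi (la a t) = 0 by move=> h; rewrite psil h la0r.
have sI : subspace (fun x => exists t, psi t = x).
  split=> [|b _ _ [x <-] [y <-]]; first by exists 0; rewrite kf0.
  by exists (b *: x + y); rewrite kfD kfZ.
have Il a (x : M) : (exists t, psi t = x) -> exists t, psi t = la a x.
  by move=> [t <-]; exists (la a t); rewrite psil.
pose K' := @lmsub _ _ T _ sK Kl; pose I := @lmsub _ _ M _ sI Il.
have [C [pc [pcl pck pcs]]] := lm_quotient sI Il.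
have C1 : unital C by move=> x; have [y <-] := pcs x; rewrite -pcl M1.
have C0 (x : C) : la e x = 0.
  have [z <-] := pcs x; rewrite -pcl; apply/pck.
  have [|y hy] := phis (la e z); first by rewrite laA ee.
  by have [q hq] := ps y; exists (tp (toAe 1) q); rewrite psie hq hy.
have sesM : ses (lhom C W) (lhom M W) (lhom I W).
  apply: (@lhom_ses _ _ I M C W (skinc sI) pc) => //; split=> //= [x h|x /pck h|x].
  - exact: skval_inj.
  - by exists (Subk sI h).
  - exact/pck/(skP x).
have [||psi' hpsi'] := @khom_lift _ T I M (skinc sI) psi.
- by move=> y /= h; apply: skval_inj.
- by move=> t; have h : exists t', psi t' = psi t by [exists t]; exists (Subk sI h).
have {}hpsi' t : skval (psi' t) = psi t := hpsi' t.
have sesI : ses (lhom I W) (lhom T W) (lhom K' W).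
  apply: (@lhom_ses _ _ K' T I W (skinc sK) psi') => //.
    by move=> a t; apply: skval_inj; rewrite /= !hpsi' psil.
  split=> //= [x h|t h|x|x].
  - exact: skval_inj.
  - have h0 : psi t = 0 by rewrite -hpsi' h.
    by exists (Subk sK h0).
  - by apply: skval_inj; rewrite hpsi'; exact: (skP x).
  - by have [t ht] := skP x; exists t; apply: skval_inj; rewrite hpsi'.
have hT m : hv m (lhom T W).
  apply: (@induced_projective _ _ _ bAe bAe1 Q W m (skinc sub_Ae) (toAe 1)) => // x.
  by apply: skval_inj; rewrite /= mul1r AeP.
have hI : hv n.+1 (lhom I W).
  apply: (ses_hvA sesI); last exact: hT.
  have pik kk : p (i kk) = 0 by apply/ex; exists kk.
  have phi0 (kk : K) : psi (tp (toAe 1) (i kk)) = 0 by rewrite psie pik (kf0 phi).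
  pose phi' (kk : kres (@kin k U) K) : K' := Subk sK (phi0 kk).
  have phi'_lin : linear phi'.
    apply: linearDZ => [x y|b x]; apply: skval_inj; rewrite /=; first by rewrite linearD tpD.
    by rewrite kresZ linearZ; apply: tpureZr.
  (* The map x (x) q |-> (e x e) q is a left inverse of q |-> e (x) q, which is therefore
     injective. *)
  have [rho hrho] : exists rho : khom T kQ, forall x q, rho (tp x q) = ju (skval x) *: q.
    apply: (@induced_lift _ _ _ _ bAe1 Q kQ
      (fun (x : Ae) (q : kQ) => (ju (skval x : A) *: (q : Q) : kQ))).
    - move=> x; apply: linearDZ => [q q'|b q]; first by rewrite scalerDr.
      by rewrite !kresZ !scalerA kinl kinr.
    - move=> q; apply: linearDZ => [x y|b x] /=; rewrite (kfD, kfZ) ?scalerDl //.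
      by rewrite kresZ scalerA kinl.
    - move=> x u q; rewrite scalerA.
      have ex' : ju (skval (Ae_r x u)) = ju (skval x) * u.
        by apply: iinj; rewrite iM !hju /= -!mulrA ie ei.
      exact: (congr1 (fun c : U => c *: (q : Q)) ex').
  have {}hrho q : rho (tp (toAe 1) q) = q.
    rewrite [LHS]hrho; have -> : ju (skval (toAe 1)) = 1.
      by apply: iinj; rewrite hju i1 /= mul1r ee ee.
    exact: (scale1r (q : Q)).
  apply: (IH K Kr K' (Khom phi'_lin)) => //.
  - move=> t; apply: skval_inj => /=; apply: (@induced_unital _ _ _ bAe bAe1 Q).
    by move=> x; apply: skval_inj; rewrite /= mul1r.
  - move=> y /(congr1 (@skval _ _ _ sK)) /= h; apply: ii.
    by rewrite -[LHS]hrho h (kf0 rho).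
  - move=> u y; apply: skval_inj; rewrite -[LHS]/(tp (toAe 1) (i (u *: y))).
    rewrite -[RHS]/(la (iota u) (tp (toAe 1) (i y))) linearZ -tpA tpl; congr (tp _ _).
    by apply: skval_inj; rewrite /= !mul1r ei ie.
  move=> z hz; have {}hz : la e (skval z : T) = skval z := congr1 (@skval _ _ _ sK) hz.
  (* On generators, e x (x) q = e (x) (e x e) q, so eT consists of the e (x) q. *)
  have et (t : T) : exists q, la e t = tp (toAe 1) q.
    move: t; apply: tensor_ind => [x q||t t' [q hq] [q' hq']].
    - exists (ju (skval (x : Ae)) *: q); rewrite -tpA -[LHS]/(la e (tp x q)) tpl.
      congr (tp _ _); apply: skval_inj; rewrite /= mul1r hju.
      by rewrite -[e * _ * e]mulrA AeP mulrA ee.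
    - by exists 0; rewrite la0r -(subrr (0 : Q)) tpB subrr.
    - by exists (q - q'); rewrite tpB -hq -hq'; apply: laBr.
  have [q hq] := et (skval z).
  have /ex[kk hkk] : p q = 0.
    by apply: phii; rewrite -psie -hq hz; exact: (skP z).
  by exists kk; apply: skval_inj; rewrite /= hkk -hq hz.
apply: (ses_hvC sesM); last exact: hI.
apply: lhom_e0 => //; apply: leqW; exact: leq_trans (leq_addr _ _) cn.
Qed.

End GlobalDimension.

Lemma gldim_corner_quotient : gldim_finite U -> gldim_finite V -> gldim_finite A.
Proof.
move=> hU hV; have [d1 hd1] := gldim_lhom hU.
have [dU hdU] := gldim_pdlt hU; have [dV hdV] := gldim_pdlt hV.
have hVlm (W : lm A) n : (d1.+1 <= n)%N -> hv n (lhom Vlm W).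
  case: n => // n dn; apply/lhom_V_hvS/lhom_J/hd1 => //.
  by move=> x; apply: skval_inj; rewrite /= i1 eAP.
(* The three terms are: d1 + 1 for Ext_A(V, W), the 1 coming from the passage from J to V; dV for
   V-modules; dU for eM. *)
apply: (@gldim_of_hv _ _ (d1.+1 + dV + dU)) => M W.
set M' := ofmod _ M; have M1 : unital M' by move=> x; exact: (scale1r (x : M)).
have eM1 : unital (eWlm M') by move=> x; apply: skval_inj; rewrite /= i1; exact: (skP x).
apply: (@lhom_corner _ d1.+1 hVlm dV hdV dU (tomod eM1) (hdU _) M'
  (kcomp (skinc (sub_eW M')) (of_tomod eM1))) => //.
- by move=> y h; apply: skval_inj.
- by move=> x h; exists (Subk (sub_eW M') h : tomod eM1).
Qed.

Lemma han_corner_quotient : han U -> han V -> han A.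
Proof.
(* Homological degrees above N are indices from N on for [hv], which is shifted by one. *)
move=> hU hV [N hN]; have h m : (N <= m)%N -> hv m (dualb A) by move=> ?; apply/hh_hv/hN.
have {}h := dual_corner_quotient h.
apply: gldim_corner_quotient; [apply: hU | apply: hV]; exists N => -[//|m] hm;
  by apply/hh_hv; case: (h m hm).
Qed.

End Stratifying.

(** * Strongly stratifying chains *)

Section StronglyStratifying.
Variables (k : fieldType) (B U V : fdAlgType k) (e : idem B) (iota : khom U B) (pi : khom B V).
Hypothesis he : strongly_stratifying e.
Hypotheses (iM : forall u v, iota (u * v) = iota u * iota v) (i1 : iota 1 = idem_val e).
Hypotheses (iinj : forall u, iota u = 0 -> u = 0) (iimg : forall x, exists u, iota u = idem_val e * x * idem_val e).
Hypotheses (pM : forall x y, pi (x * y) = pi x * pi y) (p1 : pi 1 = 1).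
Hypothesis psurj : forall v, exists x, pi x = v.
Hypothesis pker : forall x, pi x = 0 <-> x \in gen_space e.
Local Notation f := (idem_compl e).
Local Notation ev := (idem_val e).
Local Notation kr M := (kres (cjr (@kin k (corner e))) M).
Local Notation kl N := (kres (@kin k (corner e)) N).

Lemma rpeirceZ (a : idem B) c (m : kr (rpeirce a e)) :
  vsval (c *: m : rpeirce a e) = c *: vsval (m : rpeirce a e).
Proof.
rewrite -[LHS]/(vsval (peirce_mul (m : rpeirce a e) (kin (corner e) c))) peirce_mulE.
by rewrite [vsval (c *: _)]linearZ algZr /= peirce_r.
Qed.

Lemma lpeirceZ (a : idem B) c (m : kl (lpeirce e a)) :
  vsval (c *: m : lpeirce e a) = c *: vsval (m : lpeirce e a).
Proof.
rewrite -[LHS]/(vsval (peirce_mul (kin (corner e) c) (m : lpeirce e a))) peirce_mulE.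
by rewrite [vsval (c *: _)]linearZ algZl /= peirce_l.
Qed.

(* The dual form of f B e (x) e B f = 0. *)
Lemma tensor_vanish (W : lmodType k) (b : B -> B -> W) :
  (forall x, linear (b x)) -> (forall y, linear (b^~ y)) ->
  (forall x u y, b (x * (ev * u * ev)) y = b x (ev * u * ev * y)) ->
  forall x y, b ((1 - ev) * x * ev) (ev * y * (1 - ev)) = 0.
Proof.
move=> br bl bb x y; case: he => _ h0 _.
have b_lin2 (m : rpeirce f e) : linear (fun n : kl (lpeirce e f) => b (vsval m) (vsval (n : lpeirce e f))).
  by move=> c n n' /=; rewrite -br -lpeirceZ.
have b_lin : linear (fun m : kr (rpeirce f e) => Khom (b_lin2 m)).
  move=> c m m'; apply: khomP => n /=.
  by rewrite -[RHS]bl -rpeirceZ.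
have bal : @balanced _ _ _ (rpeirce f e) (lpeirce e f) _ (Khom b_lin).
  move=> m u n /=.
  rewrite -[in LHS]/(vsval (peirce_mul m u)) -[in RHS]/(vsval (peirce_mul u n)) !peirce_mulE.
  have eu : ev * vsval u * ev = vsval u by rewrite peirce_l peirce_r.
  by rewrite -eu bb.
have hx : (1 - ev) * x * ev \in peirce f e.
  apply/peirceP; rewrite -[idem_val f]/(1 - ev) !mulrA (idemP f) -!mulrA idemP //.
have hy : ev * y * (1 - ev) \in peirce e f.
  by apply/peirceP; rewrite -[idem_val f]/(1 - ev) !mulrA idemP -!mulrA (idemP f).
have := tlift_pure (@kin_central _ _) bal (Subvs hx : rpeirce f e) (Subvs hy : lpeirce e f).
rewrite [tpure _ _ _]h0 => e0; transitivity (tlift (@kin_central k (corner e)) bal 0); [exact: (esym e0) | exact: kf0].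
Qed.

(** The ideal is spanned by the a e b, and f a e b f = (f a e)(e b f) is the value on fBe x eBf of a
    balanced map, the product. *)
Lemma strongly_stratifying_corner : corner_quotient ev iota pi.
Proof.
split=> //; first exact: (idemP e).
  by apply/pker; have := mem_gen_space ev 1 1; rewrite mul1r mulr1.
move=> x /pker hx; have : x \in lker (linfun (peirce_proj f f)).
  apply: subvP hx; apply: gen_space_ind => a b; rewrite memv_ker lfunE /= /peirce_proj /=.
  have := @tensor_vanish B (fun x y => x * y) _ _ _ a b.
  rewrite !mulrA -[_ * ev * ev]mulrA idemP => -> //.
  - by move=> u c v w; rewrite mulrDr algZr.
  - by move=> u c v w; rewrite mulrDl algZl.
  - by move=> u v w; rewrite !mulrA.
by rewrite memv_ker lfunE => /eqP.
Qed.
Local Notation CQ := strongly_stratifying_corner.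
Let sAe := @sub_Ae k B ev.
Let seA := @sub_eA k B ev.
Local Notation Ae := (subk sAe).
Local Notation eA := (subk seA).

Lemma strongly_stratifying_no_f (W : lmodType k) (g : khom Ae (khom eA W)) : ubal CQ g ->
  forall x y : B, g (toAe CQ ((1 - ev) * x)) (toeA CQ (y * (1 - ev))) = 0.
Proof.
move=> hg x y; pose b (x y : B) := g (toAe CQ x) (toeA CQ y).
have toAeE c u v : toAe CQ (c *: u + v) = c *: toAe CQ u + toAe CQ v.
  by apply: skval_inj; rewrite /= mulrDl algZl.
have toeAE c u v : toeA CQ (c *: u + v) = c *: toeA CQ u + toeA CQ v.
  by apply: skval_inj; rewrite /= mulrDr algZr.
have := @tensor_vanish W b _ _ _ x y.
have -> : b ((1 - ev) * x * ev) (ev * y * (1 - ev)) =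
    g (toAe CQ ((1 - ev) * x)) (toeA CQ (y * (1 - ev))).
  rewrite /b; congr (kfun (kfun g _) _); apply: skval_inj; rewrite /=.
    by rewrite -[_ * ev * ev]mulrA idemP.
  by rewrite !mulrA idemP.
apply.
- by move=> u c v w; rewrite /b toeAE (kfun_lin (g _)).
- by move=> v c u w; rewrite /b toAeE (kfun_lin g).
move=> v u w; rewrite /b; have [z hz] := iimg u.
have -> : toAe CQ (v * (ev * u * ev)) = Ae_r CQ (toAe CQ v) z.
  by apply: skval_inj; rewrite /= hz -!mulrA (mulrA ev ev) !idemP.
rewrite hg; congr (kfun (g _) _); apply: skval_inj; rewrite /= hz.
by rewrite !mulrA idemP -[_ * ev * ev]mulrA idemP.
Qed.

(** The hypothesis is about Tor over [corner e]; it is carried to U along the isomorphism induced by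
    [iota], and from Peirce spaces to Ae and eA. *)
Lemma strongly_stratifying_hvE (W : lmodType k) n :
  hv n (bb1 (hombim (bAe CQ) (zW CQ (lm0 B W)))).
Proof.
case: he => ht _ _; have {}ht := tor_hv W (ht n.+1 isT).
have [be hbe] : exists be : khom (corner e) U, forall x, iota (be x) = vsval x.
  have v_lin : linear (fun x : corner e => vsval x) by move=> c x y; rewrite linearP.
  apply: (@khom_lift _ (corner e) U B iota (Khom v_lin)) => // x.
  by have [u hu] := iimg (vsval x); exists u; rewrite hu peirce_l peirce_r.
have al_in u : iota u \in peirce e e by apply/peirceP; rewrite -i1 -!iM mulr1 mul1r.
have al_lin : linear (fun u : U => Subvs (al_in u) : corner e).
  by move=> c u v; apply: val_inj; rewrite [RHS]linearP /= (kfun_lin iota).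
have jr_in (x : Ae) : skval x \in peirce (idem1 B) e.
  by apply/peirceP; rewrite mul1r; exact: (skP x).
have jl_in (y : eA) : skval y \in peirce e (idem1 B).
  by apply/peirceP; rewrite mulr1; exact: (skP y).
have jr_lin : linear (fun x : Ae => Subvs (jr_in x) : kr (rpeirce (idem1 B) e)).
  move=> c x y; apply: val_inj; rewrite /=; congr (_ + _).
  exact: (esym (@rpeirceZ (idem1 B) c (Subvs (jr_in x)))).
have jl_lin : linear (fun x : eA => Subvs (jl_in x) : kl (lpeirce e (idem1 B))).
  move=> c x y; apply: val_inj; rewrite /=; congr (_ + _).
  exact: (esym (@lpeirceZ (idem1 B) c (Subvs (jl_in x)))).
have qr_sub (x : rpeirce (idem1 B) e) : vsval x * ev = vsval x by rewrite peirce_r.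
have ql_sub (x : lpeirce e (idem1 B)) : ev * vsval x = vsval x by rewrite peirce_l.
have qr_lin : linear (fun x : kr (rpeirce (idem1 B) e) => Subk sAe (qr_sub x)).
  by move=> c x y; apply: skval_inj; rewrite /= -rpeirceZ.
have ql_lin : linear (fun x : kl (lpeirce e (idem1 B)) => Subk seA (ql_sub x)).
  by move=> c x y; apply: skval_inj; rewrite /= -lpeirceZ.
pose g X Y X' Y' (p : khom X' X) (q : khom Y' Y) : khom (khom X (khom Y W)) (khom X' (khom Y' W)) :=
  kcomp (kpost X' (kpre W q)) (kpre _ p).
refine (@hv_smor _ (corner e) U (Khom al_lin) be _ _ _ n (rbim (rpeirce (idem1 B) e) (lpeirce e (idem1 B)) W) (bb1 (hombim (bAe CQ) (zW CQ (lm0 B W))))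
  (g _ _ _ _ (Khom jr_lin) (Khom jl_lin)) (g _ _ _ _ (Khom qr_lin) (Khom ql_lin)) _ _ _ ht).
- by move=> u v; apply: val_inj; rewrite /= peirce_mulE /= iM.
- move=> u v; apply/eqP; rewrite -subr_eq0; apply/eqP/iinj.
  by rewrite kfB iM !hbe peirce_mulE subrr.
- by move=> u; apply/eqP; rewrite -subr_eq0; apply/eqP/iinj; rewrite kfB hbe subrr.
- split=> [u h|h u]; apply: khomP => x; apply: khomP => y /=.
    congr (kfun (kfun h _) _); apply: val_inj; rewrite /=.
    by rewrite -[LHS]/(vsval (peirce_mul _ _)) peirce_mulE.
  congr (kfun (kfun h _) _); apply: val_inj; rewrite /=.
  by rewrite -[LHS]/(vsval (peirce_mul _ _)) peirce_mulE.
- split=> [u h|h u]; apply: khomP => x; apply: khomP => y /=.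
    congr (kfun (kfun h _) _); apply: skval_inj; rewrite /= hbe.
    by rewrite -[RHS]/(vsval (peirce_mul _ _)) peirce_mulE.
  congr (kfun (kfun h _) _); apply: skval_inj; rewrite /= hbe.
  by rewrite -[RHS]/(vsval (peirce_mul _ _)) peirce_mulE.
- move=> h; apply: khomP => x; apply: khomP => y /=.
  by congr (kfun (kfun h _) _); apply: skval_inj.
Qed.

Lemma strongly_stratifying_han : han U -> han V -> han B.
Proof.
exact: (han_corner_quotient (@strongly_stratifying_no_f) (@strongly_stratifying_hvE)).
Qed.

End StronglyStratifying.

(** * Quotient algebras and one step of the chain *)

Section QuotientAlgebra.
Variables (k : fieldType) (A : fdAlgType k) (I : ideal A).

Fact kquo_lin : linear (quo_pi I : A -> quo I).
Proof. by move=> c x y; rewrite quo_piD quo_piZ. Qed.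
Definition kquo : khom A (quo I) := Khom kquo_lin.

Lemma kquo_surj (u : quo I) : exists x, kquo x = u.
Proof. by exists (repr u); apply: quo_repr. Qed.

Lemma kquo0 x : kquo x = 0 <-> x \in ideal_space I.
Proof.
rewrite -(kf0 kquo); apply: iff_trans (quo_piP _ _ _) _; by rewrite subr0.
Qed.

Lemma kquoM x y : kquo (x * y) = kquo x * kquo y.
Proof. exact: (esym (quo_mulE I x y)). Qed.

Lemma kquo_ind (P : quo I -> Prop) : (forall x, P (kquo x)) -> forall u, P u.
Proof. by move=> h u; have [x <-] := kquo_surj u. Qed.

Lemma kquo_factor (X : lmodType k) (h : khom A X) : (forall x, x \in ideal_space I -> h x = 0) ->
  exists h' : khom (quo I) X, forall x, h' (kquo x) = h x.
Proof. by move=> h0; apply: khom_extend => x /kquo0/h0. Qed.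

End QuotientAlgebra.

Lemma gldim_zero_ring k (A : fdAlgType k) : (1 : A) = 0 -> gldim_finite A.
Proof.
move=> e; exists 0 => M; have [P _] := resolution_exists M; exists P => n _ x.
by rewrite -[x]scale1r e scale0r.
Qed.

Section ChainStep.
Variables (k : fieldType) (A : fdAlgType k).

Lemma gen_space0 : gen_space (0 : A) = 0%VS.
Proof.
apply/eqP; rewrite -subv0; apply: gen_space_ind => x y.
by rewrite mulr0 mul0r mem0v.
Qed.

Lemma gen_space1 (x : A) : x \in gen_space (1 : A).
Proof. by have := mem_gen_space 1 x 1; rewrite !mulr1. Qed.

Lemma han_quo1 : han (quo (gen_ideal (1 : A))).
Proof.
move=> _; apply: gldim_zero_ring.
exact: ((kquo0 (gen_ideal (1 : A)) 1).2 (gen_space1 1)).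
Qed.

(** A and A/0 are distinct as algebras; the idempotent 0, whose corner is zero, transfers the
    property between them. *)
Lemma han_quo0 : han (quo (gen_ideal (0 : A))) -> han A.
Proof.
move=> hV; set V := quo _ in hV; set U := quo (gen_ideal (1 : A)).
have U0 (u : U) : u = 0 by move: u; apply: kquo_ind => x; apply/kquo0/gen_space1.
have CQ : @corner_quotient k A U V 0 0 (kquo (gen_ideal 0)).
  split=> [||||x|||||x]; rewrite ?mulr0 ?kE //.
  - by move=> u v; rewrite !kE mulr0.
  - by exists 0.
  - exact: kquoM.
  - exact: kquo_surj.
  - exact: kf0.
  - by move/kquo0; rewrite /= gen_space0 memv0 => /eqP->; rewrite mulr0 mul0r.
apply: (han_corner_quotient (CQ := CQ) _ _ (@han_quo1) hV) => [W g _ x y|W n].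
  have -> : toAe CQ ((1 - 0) * x) = 0 by apply: skval_inj; rewrite /= mulr0.
  by rewrite (kf0 g).
apply: hv_zero => g; apply: khomP => x.
have -> : x = 0 by apply: skval_inj; rewrite -[LHS](AeP x) mulr0.
exact: (kf0 g).
Qed.

Variables (s : A) (e : idem A).
Local Notation ev := (idem_val e).
Hypotheses (ss : s * s = s) (se : s * ev = 0) (es : ev * s = 0).
Local Notation I := (gen_ideal s).
Local Notation eI := (idem_class I e).

Fact corner_ideal_lin : linear (fun x : corner e => vsval x).
Proof. by move=> c x y; rewrite linearP. Qed.
Let kv : khom (corner e) A := Khom corner_ideal_lin.
Let kvM (x y : corner e) : kv (x * y) = kv x * kv y.
Proof. exact: peirce_mulE. Qed.
Definition corner_space : {vspace corner e} := (linfun (lin_of corner_ideal_lin) @^-1: I)%VS.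
Lemma corner_spaceP (x : corner e) : (x \in corner_space) = (kv x \in gen_space s).
Proof. by rewrite -memv_preim lfunE. Qed.
Fact corner_idealMl (x y : corner e) : y \in corner_space -> x * y \in corner_space.
Proof. by rewrite !corner_spaceP kvM; apply: gen_spaceMl. Qed.
Fact corner_idealMr (x y : corner e) : x \in corner_space -> x * y \in corner_space.
Proof. by rewrite !corner_spaceP kvM; apply: gen_spaceMr. Qed.
(** The intersection of e A e with I. The quotient by it is isomorphic to the corner of A/I at the
    class of e, but is by construction a quotient of e A e. *)
Definition corner_ideal : ideal (corner e) := Ideal corner_idealMl corner_idealMr.

Lemma han_quo_step : strongly_stratifying eI -> han (quo corner_ideal) ->
  han (quo (gen_ideal (s + ev))) -> han (quo I).
Proof.
set V := quo (gen_ideal (s + ev)) => hs hU hV.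
have [iota hiota] : exists iota : khom (quo corner_ideal) (quo I),
    forall x : corner e, iota (kquo corner_ideal x) = kquo I (kv x).
  apply: (@kquo_factor _ _ corner_ideal (quo I) (kcomp (kquo I) kv)) => x hx.
  by apply/kquo0; rewrite -corner_spaceP.
(* By orthogonality s = s (s + e). *)
have sV (x : A) : x \in gen_space s -> x \in gen_space (s + ev).
  apply: subvP; apply: gen_space_ind => a b.
  by have := mem_gen_space (s + ev) (a * s) b; rewrite -(mulrA a) mulrDr ss se addr0.
have [pi hpi] : exists pi : khom (quo I) V, forall x, pi (kquo I x) = kquo (gen_ideal (s + ev)) x.
  by apply: (@kquo_factor _ _ I V (kquo (gen_ideal (s + ev)))) => x /sV hx; apply/kquo0.
(* Modulo I the ideals generated by s + e and by e agree. *)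
have p0 x : pi (kquo I x) = 0 <-> kquo I x \in gen_space (idem_val eI).
  pose kl := linfun (lin_of (@kquo_lin _ _ I)).
  rewrite hpi kquo0; split=> hx.
    suff : x \in (kl @^-1: gen_space (idem_val eI))%VS by rewrite -memv_preim lfunE.
    apply: subvP hx; apply: gen_space_ind => a b; rewrite -memv_preim lfunE /=.
    rewrite -[quo_pi I _]/(kquo I _) mulrDr mulrDl kfD.
    have -> : kquo I (a * s * b) = 0 by apply/kquo0/mem_gen_space.
    rewrite add0r !kquoM; exact: mem_gen_space.
  pose pl := linfun (lin_of (kfun_lin pi)).
  have : kquo I x \in lker pl.
    apply: subvP hx; apply: gen_space_ind; apply: kquo_ind => a; apply: kquo_ind => b.
    rewrite memv_ker lfunE; apply/eqP; transitivity (pi (kquo I (a * ev * b))).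
      by rewrite !kquoM.
    rewrite hpi; apply/kquo0.
    have := mem_gen_space (s + ev) (a * ev) b.
    by rewrite -(mulrA a) mulrDr es add0r idemP.
  by rewrite memv_ker lfunE /= => /eqP; rewrite hpi => /kquo0.
apply: (@strongly_stratifying_han _ (quo I) (quo corner_ideal) V eI iota pi hs) hU hV.
- apply: kquo_ind => x; apply: kquo_ind => y.
  by rewrite -kquoM !hiota -kquoM -kvM.
- exact: (hiota 1).
- apply: kquo_ind => x; rewrite hiota => /kquo0 hx.
  by apply/kquo0; rewrite -corner_spaceP in hx.
- apply: kquo_ind => x.
  have xe : ev * x * ev \in peirce e e by apply/peirceP; rewrite !mulrA idemP -!mulrA idemP.
  by exists (kquo corner_ideal (Subvs xe)); rewrite hiota -[kv _]/(ev * x * ev) !kquoM.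
- by apply: kquo_ind => x; apply: kquo_ind => y; rewrite -kquoM !hpi kquoM.
- exact: (hpi 1).
- by apply: kquo_ind => x; exists (kquo I x).
- by apply: kquo_ind => x.
Qed.

End ChainStep.

Theorem theorem5p7 (k : fieldType) (C : fdAlgType k -> Prop)
  (C_quo : closed_under_quotients C)
  (C_han : forall A : fdAlgType k, C A -> han A)
  (A : fdAlgType k) (n : nat) (n_gt0 : (0 < n)%N)
  (A_chain : exists e : 'I_n -> idem A, class_chain C e) :
  han A.
Proof.
have [e [[[eO e1] hs] hC]] := A_chain.
pose s (i : nat) : A := \sum_(j < n | (j < i)%N) idem_val (e j).
have sS (i : 'I_n) : s i.+1 = s i + idem_val (e i).
  rewrite /s (bigD1 i) //= addrC; congr (_ + _); apply: eq_bigl => j.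
  by rewrite ltnS ltn_neqAle andbC.
have se (i : 'I_n) : s i * idem_val (e i) = 0.
  by rewrite mulr_suml big1 // => j ji; rewrite eO //; apply: contraTneq ji => ->; rewrite ltnn.
have es (i : 'I_n) : idem_val (e i) * s i = 0.
  by rewrite mulr_sumr big1 // => j ji; rewrite eO //; apply: contraTneq ji => <-; rewrite ltnn.
have ss i : s i * s i = s i.
  rewrite {1}/s mulr_suml; apply: eq_bigr => j ji; rewrite mulr_sumr (bigD1 j) //= idemP.
  by rewrite big1 ?addr0 // => j' /andP[_ jj]; rewrite eO // eq_sym.
have sn : s n = 1 by rewrite -e1; apply: eq_bigl => j; rewrite ltn_ord.
have s0 : s 0 = 0 by rewrite /s big_pred0.
(* The index runs backwards: m = 0 is the zero algebra A/A, and m = n is A/0. *)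
have H m : (m <= n)%N -> han (quo (gen_ideal (s (n - m)%N))).
  elim: m => [|m IH] mn; first by rewrite subn0 sn; exact: han_quo1.
  have im : (n - m.+1 < n)%N by rewrite -subSn // subSS leq_subr.
  pose i := Ordinal im; have := IH (ltnW mn); have -> : (n - m = i.+1)%N by rewrite /= -subSn // subSS.
  rewrite sS => hV; apply: (han_quo_step (ss i) (se i) (es i) (hs i) _ hV).
  exact/C_han/C_quo/hC.
by have := H n (leqnn n); rewrite subnn s0; apply: han_quo0.
Qed.
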